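(* Let $m\geq 3$ and for $i=1,\ldots,m$ let $\psi_i$ be a primitive Dirichlet character modulo $\ell_i$; put $\ell^*=\max(\ell_1,\ldots,\ell_m)$. Then for every $\varepsilon>0$ there exist constants $C_{m,\varepsilon}>0$ and $c_{m,\varepsilon}>0$ such that for all (sufficiently large) primes $q\geq C_{m,\varepsilon}(\ell^* )^{m/(2m-4)+\varepsilon}$ and every Dirichlet character $\chi$ modulo $q$, $$\#\{(\chi_i)_i\in\mathbf{Wide}^*(q,m;\chi):\ L(\psi_1\chi_1,1/2)\cdots L(\psi_m\chi_m,1/2)\neq 0\}\geq c_{m,\varepsilon}\, q^{5m/6-1-\varepsilon}(\ell^* )^{-m/6}.$$
   Context: For a Dirichlet character $\chi$, $L(\chi,s)=\sum_{n\geq1}\chi(n)n^{-s}$ (for $\mathrm{Re}\, s>1$), extended by meromorphic continuation. For an integer $q$ and a Dirichlet character $\chi$ mod $q$, $\mathbf{Wide}^*(q,m;\chi)$ denotes the set of $m$-tuples $(\chi_1,\ldots,\chi_m)$ of primitive Dirichlet characters modulo $q$ with $\chi_1\cdots\chi_m=\chi$. *)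

(* Defs.v *)
From Stdlib Require Import Reals ZArith Arith Lia ClassicalEpsilon Znumtheory.
From Coquelicot Require Import Coquelicot.
Open Scope R_scope.

Definition is_dirichlet_char (q : nat) (chi : nat -> C) : Prop :=
  (0 < q)%nat /\
  (forall n, chi (n + q)%nat = chi n) /\
  (forall m n, chi (m * n)%nat = Cmult (chi m) (chi n)) /\
  chi 1%nat = RtoC 1 /\
  (forall n, chi n = RtoC 0 <-> Nat.gcd n q <> 1%nat).

(* Primitive: not induced by a character of any modulus d | q, d < q,
   i.e. for each such d there is a unit a = 1 (mod d) with chi a <> 1. *)
Definition is_primitive_char (q : nat) (chi : nat -> C) : Prop :=
  is_dirichlet_char q chi /\
  forall d : nat, Nat.divide d q -> (d < q)%nat ->
    exists a : nat, Nat.gcd a q = 1%nat /\ Nat.modulo a d = Nat.modulo 1 d /\ chi a <> RtoC 1.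

(* n^{-s} = exp(-s log n) for n >= 1 *)
Definition cpow_neg (n : nat) (s : C) : C :=
  let a := - Re s * ln (INR n) in
  let b := - Im s * ln (INR n) in
  (exp a * cos b, exp a * sin b).

(* F is the meromorphic continuation of L(chi, s) = sum_{n>=1} chi(n) n^{-s}:
   F is complex-differentiable on C \ {1} (the only possible pole of a
   Dirichlet L-function) and agrees with the Dirichlet series for Re s > 1. *)
Definition L_continuation (chi : nat -> C) (F : C -> C) : Prop :=
  (forall z : C, z <> RtoC 1 -> @ex_derive C_AbsRing C_NormedModule F z) /\
  (forall s : C, 1 < Re s ->
     @is_series C_AbsRing C_NormedModule
       (fun n => Cmult (chi (S n)) (cpow_neg (S n) s)) (F s)).

(* L(chi, s): value of the (unique) continuation. *)
Definition Lval (chi : nat -> C) (s : C) : C :=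
  epsilon (inhabits (fun _ : C => RtoC 0)) (L_continuation chi) s.

Fixpoint cprod (m : nat) (f : nat -> C) : C :=
  match m with O => RtoC 1 | S k => Cmult (cprod k f) (f k) end.

Fixpoint nmax (m : nat) (l : nat -> nat) : nat :=
  match m with O => O | S k => Nat.max (nmax k l) (l k) end.

Definition Wide (q m : nat) (chi : nat -> C) (chis : nat -> nat -> C) : Prop :=
  (forall i, (i < m)%nat -> is_primitive_char q (chis i)) /\
  (forall n, cprod m (fun i => chis i n) = chi n).

Definition tuple_eq (m : nat) (a b : nat -> nat -> C) : Prop :=
  forall i, (i < m)%nat -> a i = b i.

Definition card_ge (m : nat) (P : (nat -> nat -> C) -> Prop) (N : nat) : Prop :=
  exists f : nat -> (nat -> nat -> C),
    (forall k, (k < N)%nat -> P (f k)) /\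
    (forall k1 k2, (k1 < N)%nat -> (k2 < N)%nat -> tuple_eq m (f k1) (f k2) -> k1 = k2).

(* Main.v *)
Require Import Defs.
From Stdlib Require Import Reals ZArith Arith Znumtheory.
From Coquelicot Require Import Coquelicot.
From HB Require Import structures.
From Stdlib Require Import Lra Lia ClassicalEpsilon Classical ssreflect.
From mathcomp Require all_boot all_algebra all_fingroup zify cyclic.
Open Scope R_scope.

(* The number of tuples with nonvanishing product is bounded below by Cauchy-Schwarz, as the square
   of a first moment over a second moment, both taken over all wide tuples.
   Orthogonality of the characters turns the first moment of [prod_i L(psi_i chi_i, 1/2)] into
   [sum_(y mod q) chi(y) prod_i Z_i(y)], where [Z_i(y)] is the regularised sum of
   [psi_i(n) n^(-1/2)] over [n = y mod q]. Polya-Vinogradov along [n = y + q k] gives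
   [Z_i(y) = psi_i(y) y^(-1/2) + O(l_i^(1/4) q^(-1/2) log)], and the resulting main term
   [sum_y f(y) y^(-m/2)], with [f] a character, is bounded away from 0 because m >= 3.
   In the second moment one factor is estimated pointwise by convexity and the other m - 1
   factors by the mean square over the characters mod [q].
   The value [Lval] at 1/2 is identified with a conditionally convergent series: repeated
   differencing continues additive twists of the zeta series, Gauss sums pass to characters, and the
   continuation is unique by Goursat's theorem and integration against a Gaussian. *)

(** Origin of the exponents: with [L] the largest [l_i], every class sum carries an error [r] of
    order [q^(-1/2) L^(1/4)] up to logarithms. Expanding the product of [m] perturbed factors and
    summing over [y] leaves [r log q + q r^m]; the second term becomes small once [q] exceeds
    [L^(m/(2m-4))] by the margin that [eps] grants. The same hypothesis yields [L < q^2], so [q^2]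
    divides no [l_i]. Under that condition at most two of the characters [chi] mod [q] fail to be
    primitive together with [psi_i chi] modulo [lcm(l_i, q)]. Their central values are replaced by
    0: orthogonality can then run over all characters, the exceptions cost only an error of size
    [r], and no tuple containing one of them is ever counted. The first moment has size [q^(m-1)]
    and the second is at most [(qL)^(1/2) (q + (qL)^(1/2))^(m-1)] up to logarithms. The bound
    [q^(5m/6-1) L^(-m/6)] is one monomial lying below the resulting quotient both for [L <= q] and
    for [L > q]. [Lval] is an [epsilon] choice, so nothing is known of it beyond [L_continuation]; a
    continuation has to be constructed, and uniqueness is needed only at the point 1/2. *)

Module Analysis.

(** * Complex differentiation and Goursat's theorem *)

Definition cderiv (f : C -> C) (z l : C) : Prop :=
  forall eps : R, 0 < eps -> exists del : R, 0 < del /\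
    forall w : C, Cmod (w - z) < del ->
      Cmod (f w - f z - (w - z) * l) <= eps * Cmod (w - z).

Lemma cderiv_is_derive (f : C -> C) (z l : C) :
  @is_derive C_AbsRing C_NormedModule f z l <-> cderiv f z l.
Proof.
split.
- move=> [_ H] eps He.
  have [d Hd] := H z (fun P HP => HP) (mkposreal eps He).
  exists d; split; first exact: cond_pos.
  by move=> w Hw; apply: Hd.
- move=> H; split; first exact: is_linear_scal_l.
  move=> x Hx eps.
  have E := @is_filter_lim_locally_unique C_AbsRing (AbsRing_NormedModule C_AbsRing) z x Hx.
  have {E} E : x = z by [].
  rewrite E.
  have [d [Hd Hd']] := H eps (cond_pos eps).
  by exists (mkposreal d Hd) => w Hw; apply: Hd'.
Qed.

(** Total differentiability of the pair, with the Cauchy-Riemann equations built into the shape of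
    the Jacobian: [B1 + i B2] is the complex derivative. In this form contour integrals reduce to
    real integrals along the sides of rectangles. *)
Definition holo2 (U V : R -> R -> R) (x y : R) : Prop :=
  exists B1 B2 : R, forall eps, 0 < eps -> exists del, 0 < del /\
    forall x' y', Rabs (x' - x) < del -> Rabs (y' - y) < del ->
      Rabs (U x' y' - U x y - (B1 * (x' - x) - B2 * (y' - y)))
        <= eps * (Rabs (x' - x) + Rabs (y' - y)) /\
      Rabs (V x' y' - V x y - (B2 * (x' - x) + B1 * (y' - y)))
        <= eps * (Rabs (x' - x) + Rabs (y' - y)).

Lemma Cmod_le_abs (z : C) : Cmod z <= Rabs (Re z) + Rabs (Im z).
Proof.
have -> : z = (RtoC (Re z) + Ci * RtoC (Im z))%C.
{ rewrite [LHS]surjective_pairing /Cplus /Cmult /=; congr pair; rewrite /Re /Im; ring. }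
apply: Rle_trans (Cmod_triangle _ _) _.
rewrite Cmod_mult !Cmod_R Cmod_Ci re_plus im_plus re_mult im_mult /=.
rewrite !Rmult_0_l !Rmult_1_l !Rplus_0_l ?Rminus_0_r ?Rplus_0_r. lra.
Qed.

Lemma im_le_Cmod (z : C) : Rabs (Im z) <= Cmod z.
Proof.
apply: Rle_trans (Rmax_Cmod z); exact: Rmax_r.
Qed.

Lemma cderiv_holo2 (f : C -> C) (x y : R) (l : C) :
  cderiv f (x, y) l -> holo2 (fun x y => Re (f (x, y))) (fun x y => Im (f (x, y))) x y.
Proof.
move=> H; exists (Re l), (Im l) => eps He.
have [d [Hd Hf]] := H eps He.
exists (d / 2); split; first lra.
move=> x' y' Hx Hy.
have Hm : Cmod ((x', y') - (x, y))%C <= Rabs (x' - x) + Rabs (y' - y) by exact: Cmod_le_abs.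
have Hl : Cmod ((x', y') - (x, y))%C < d by lra.
have {Hf} Hf := Hf _ Hl.
have Hf' : Cmod (f (x', y') - f (x, y) - ((x', y') - (x, y)) * l) <= eps * (Rabs (x' - x) + Rabs (y' - y)) by nra.
split.
- apply: Rle_trans Hf'; apply: Rle_trans (re_le_Cmod _); apply: Req_le; congr Rabs.
  rewrite /Re /Im /=; ring.
- apply: Rle_trans Hf'; apply: Rle_trans (im_le_Cmod _); apply: Req_le; congr Rabs.
  rewrite /Re /Im /=; ring.
Qed.

Lemma holo2_continuous (U V : R -> R -> R) (x y : R) : holo2 U V x y ->
  continuous (fun t => U t y) x /\ continuous (fun t => U x t) y /\
  continuous (fun t => V t y) x /\ continuous (fun t => V x t) y.
Proof.
move=> [B1 [B2 H]].
have [d [Hd Hf]] := H 1 Rlt_0_1.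
have key : forall (g : R -> R) z, (exists K d, 0 < d /\ forall t, Rabs (t - z) < d -> Rabs (g t - g z) <= K * Rabs (t - z)) -> continuous g z.
{ move=> g z [K [e [He Hg]]].
  apply/continuity_pt_filterlim => eps Heps.
  have HK : 0 < Rabs K + 1 by have := Rabs_pos K; lra.
  exists (Rmin e (eps / (Rabs K + 1))); split.
  { apply: Rmin_pos => //; exact: Rdiv_lt_0_compat. }
  move=> t [_ Ht]; rewrite /= /R_dist in Ht *.
  have H1 := Rmin_l e (eps / (Rabs K + 1)); have H2 := Rmin_r e (eps / (Rabs K + 1)).
  have H3 : Rabs (g t - g z) <= K * Rabs (t - z) by apply: Hg; lra.
  have H4 := Rle_abs K.
  have H5 : Rabs (t - z) < eps / (Rabs K + 1) by lra.
  have H6 : Rabs (t - z) * (Rabs K + 1) < eps.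
  { have := Rmult_lt_compat_r _ _ _ HK H5. rewrite /Rdiv Rmult_assoc Rinv_l; lra. }
  have := Rabs_pos (t - z); nra. }
have H0 : forall z, Rabs (z - z) < d by move=> z; rewrite Rminus_diag Rabs_R0.
have E0 : forall z, Rabs (z - z) = 0 by move=> z; rewrite Rminus_diag Rabs_R0.
have bnd : forall a b t e, Rabs (a - (b * t)) <= 1 * e -> Rabs t = e -> Rabs a <= (Rabs b + 1) * Rabs t.
{ move=> a b t e Ha Ht.
  have -> : a = (a - b * t) + b * t by ring.
  apply: Rle_trans (Rabs_triang _ _) _. rewrite Rabs_mult. rewrite -Ht in Ha. lra. }
split; [|split; [|split]]; apply: key.
- exists (Rabs B1 + 1), d; split=> // t Ht.
  have [A _] := Hf t y Ht (H0 y). apply: (bnd _ _ _ (Rabs (t - x))) => //.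
  rewrite E0 Rminus_diag Rmult_0_r in A. rewrite Rminus_0_r Rplus_0_r in A. exact: A.
- exists (Rabs (-B2) + 1), d; split=> // t Ht.
  have [A _] := Hf x t (H0 x) Ht. apply: (bnd _ _ _ (Rabs (t - y))) => //.
  rewrite E0 Rminus_diag Rmult_0_r Rplus_0_l in A.
  have -> : - B2 * (t - y) = 0 - B2 * (t - y) by ring. exact: A.
- exists (Rabs B2 + 1), d; split=> // t Ht.
  have [_ A] := Hf t y Ht (H0 y). apply: (bnd _ _ _ (Rabs (t - x))) => //.
  rewrite E0 Rminus_diag Rmult_0_r !Rplus_0_r in A. exact: A.
- exists (Rabs B1 + 1), d; split=> // t Ht.
  have [_ A] := Hf x t (H0 x) Ht. apply: (bnd _ _ _ (Rabs (t - y))) => //.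
  rewrite E0 Rminus_diag Rmult_0_r !Rplus_0_l in A. exact: A.
Qed.

Lemma RInt_near_const (g : R -> R) (a b k M : R) : a <= b -> ex_RInt g a b ->
  (forall t, a <= t <= b -> Rabs (g t - k) <= M) ->
  Rabs (RInt g a b - k * (b - a)) <= (b - a) * M.
Proof.
move=> Hab Hex Hk.
have Hc : ex_RInt (fun _ : R => k) a b by exact: ex_RInt_const.
have -> : RInt g a b - k * (b - a) = RInt (fun t => minus (g t) k) a b.
{ rewrite RInt_minus // RInt_const /minus /plus /opp /scal /= /mult /=. ring. }
apply: abs_RInt_le_const => //. exact: ex_RInt_minus.
Qed.

Section Rect.
Variables (U V : R -> R -> R) (A B A' B' : R).
Hypothesis hol : forall x y, A <= x <= B -> A' <= y <= B' -> holo2 U V x y.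

(** Real part of the counterclockwise contour integral of [U + i V]. The imaginary part is reached
    by applying the result to [- i f]. *)
Definition rectJ (a b c d : R) : R :=
  RInt (fun x => U x c - U x d) a b - RInt (fun y => V b y - V a y) c d.

Lemma exUx a b c : A <= a -> a <= b -> b <= B -> A' <= c <= B' -> ex_RInt (fun x => U x c) a b.
Proof.
move=> H1 H2 H3 H4. apply: ex_RInt_continuous => z; rewrite Rmin_left // Rmax_right // => Hz.
have Hh : holo2 U V z c by apply: hol; lra.
by have [? [? [? ?]]] := holo2_continuous _ _ _ _ Hh.
Qed.

Lemma exVy a c d : A <= a <= B -> A' <= c -> c <= d -> d <= B' -> ex_RInt (fun y => V a y) c d.
Proof.
move=> H1 H2 H3 H4. apply: ex_RInt_continuous => z; rewrite Rmin_left // Rmax_right // => Hz.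
have Hh : holo2 U V a z by apply: hol; lra.
by have [? [? [? ?]]] := holo2_continuous _ _ _ _ Hh.
Qed.

Lemma rectJ_split4 a b c d : A <= a -> a <= b -> b <= B -> A' <= c -> c <= d -> d <= B' ->
  let x := (a + b) / 2 in let y := (c + d) / 2 in
  rectJ a b c d = rectJ a x c y + rectJ x b c y + rectJ a x y d + rectJ x b y d.
Proof.
move=> H1 H2 H3 H4 H5 H6 x y.
have Hx : a <= x <= b by rewrite /x; lra.
have Hy : c <= y <= d by rewrite /y; lra.
have eqJ : forall a b c d, A <= a -> a <= b -> b <= B -> A' <= c -> c <= d -> d <= B' ->
  rectJ a b c d = (RInt (fun x => U x c) a b - RInt (fun x => U x d) a b) - (RInt (fun y => V b y) c d - RInt (fun y => V a y) c d).
{ move=> *. rewrite /rectJ. congr Rminus.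
  - apply: RInt_minus; apply: exUx; lra.
  - apply: RInt_minus; apply: exVy; lra. }
have chU : forall c, A' <= c <= B' -> RInt (fun x => U x c) a b = RInt (fun x => U x c) a x + RInt (fun x => U x c) x b.
{ move=> c' Hc'. symmetry; apply: RInt_Chasles; apply: exUx; lra. }
have chV : forall a, A <= a <= B -> RInt (fun x => V a x) c d = RInt (fun x => V a x) c y + RInt (fun x => V a x) y d.
{ move=> c' Hc'. symmetry; apply: RInt_Chasles; apply: exVy; lra. }
rewrite !eqJ; try lra. rewrite !chU; try lra. rewrite !chV; try lra.
Qed.

(** The affine part contributes [B2 * (d - c) * (b - a)] to both integrals and cancels. What remains
    in each integrand is two differentiability remainders, each at most [2 * eps * s]. *)
Lemma rectJ_bound_local u v B1 B2 eps r a b c d :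
  (forall x' y', Rabs (x' - u) < r -> Rabs (y' - v) < r ->
      Rabs (U x' y' - U u v - (B1 * (x' - u) - B2 * (y' - v)))
        <= eps * (Rabs (x' - u) + Rabs (y' - v)) /\
      Rabs (V x' y' - V u v - (B2 * (x' - u) + B1 * (y' - v)))
        <= eps * (Rabs (x' - u) + Rabs (y' - v))) ->
  0 < eps ->
  A <= a -> a <= b -> b <= B -> A' <= c -> c <= d -> d <= B' ->
  forall s, s < r -> (forall x, a <= x <= b -> Rabs (x - u) <= s) ->
  (forall y, c <= y <= d -> Rabs (y - v) <= s) ->
  Rabs (rectJ a b c d) <= 4 * eps * s * ((b - a) + (d - c)).
Proof.
move=> Hl He H1 H2 H3 H4 H5 H6 s Hs Hx Hy.
rewrite /rectJ.
have K1 : Rabs (RInt (fun x => U x c - U x d) a b - (B2 * (d - c)) * (b - a)) <= (b - a) * (4 * eps * s).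
{ apply: RInt_near_const => //.
  - apply: (ex_RInt_minus (V := R_NormedModule)); apply: exUx; lra.
  - move=> t Ht.
    have Hc : Rabs (c - v) <= s by apply: Hy; lra.
    have Hd : Rabs (d - v) <= s by apply: Hy; lra.
    have Ht' := Hx _ Ht.
    have [P1 _] : _ := Hl t c ltac:(lra) ltac:(lra).
    have [P2 _] : _ := Hl t d ltac:(lra) ltac:(lra).
    have -> : U t c - U t d - B2 * (d - c) = (U t c - U u v - (B1 * (t - u) - B2 * (c - v))) - (U t d - U u v - (B1 * (t - u) - B2 * (d - v))) by ring.
    apply: Rle_trans (Rabs_triang _ _) _. rewrite Rabs_Ropp.
    have : Rabs (t - u) + Rabs (c - v) <= 2 * s by lra.
    have : Rabs (t - u) + Rabs (d - v) <= 2 * s by lra.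
    nra. }
have K2 : Rabs (RInt (fun y => V b y - V a y) c d - (B2 * (b - a)) * (d - c)) <= (d - c) * (4 * eps * s).
{ apply: RInt_near_const => //.
  - apply: (ex_RInt_minus (V := R_NormedModule)); apply: exVy; lra.
  - move=> t Ht.
    have Hc : Rabs (a - u) <= s by apply: Hx; lra.
    have Hd : Rabs (b - u) <= s by apply: Hx; lra.
    have Ht' := Hy _ Ht.
    have [_ P1] : _ := Hl a t ltac:(lra) ltac:(lra).
    have [_ P2] : _ := Hl b t ltac:(lra) ltac:(lra).
    have -> : V b t - V a t - B2 * (b - a) = (V b t - V u v - (B2 * (b - u) + B1 * (t - v))) - (V a t - V u v - (B2 * (a - u) + B1 * (t - v))) by ring.
    apply: Rle_trans (Rabs_triang _ _) _. rewrite Rabs_Ropp.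
    have : Rabs (a - u) + Rabs (t - v) <= 2 * s by lra.
    have : Rabs (b - u) + Rabs (t - v) <= 2 * s by lra.
    nra. }
move: K1 K2. set X := RInt _ _ _; set Y := RInt _ _ _ => K1 K2.
have -> : X - Y = (X - B2 * (d - c) * (b - a)) - (Y - B2 * (b - a) * (d - c)) by ring.
apply: Rle_trans (Rabs_triang _ _) _. rewrite Rabs_Ropp. nra.
Qed.

(** Bisection: an integral exceeding [eps] times the squared size of the rectangle keeps doing so on
    some quarter at every scale, which contradicts [rectJ_bound_local] at the common point of the
    nested rectangles. *)
Lemma goursat_rect : A <= B -> A' <= B' -> rectJ A B A' B' = 0.
Proof.
move=> HAB HAB'.
set S := (B - A) + (B' - A').
have key : forall eps, 0 < eps -> Rabs (rectJ A B A' B') <= eps * S ^ 2.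
{ move=> eps He. apply: Rnot_lt_le => Hbad.
  pose w n := (B - A) / 2 ^ n; pose h n := (B' - A') / 2 ^ n.
  have wS : forall n, w (Datatypes.S n) = w n / 2 by move=> n; rewrite /w /=; field; apply: pow_nonzero; lra.
  have hS : forall n, h (Datatypes.S n) = h n / 2 by move=> n; rewrite /h /=; field; apply: pow_nonzero; lra.
  have w0 : forall n, 0 <= w n.
  { move=> n; apply: Rdiv_le_0_compat; first lra. by apply: pow_lt; lra. }
  have h0 : forall n, 0 <= h n.
  { move=> n; apply: Rdiv_le_0_compat; first lra. by apply: pow_lt; lra. }
  pose bad n (p : R * R) := A <= fst p /\ fst p + w n <= B /\ A' <= snd p /\ snd p + h n <= B' /\
     eps * (w n + h n) ^ 2 < Rabs (rectJ (fst p) (fst p + w n) (snd p) (snd p + h n)).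
  (* The premise [bad n p] sits under the existential so that choice yields a total map, which can
     be iterated from the whole rectangle. *)
  have step : forall n p, exists p', bad n p -> bad (Datatypes.S n) p' /\ fst p <= fst p' /\ snd p <= snd p' /\
     fst p' + w (Datatypes.S n) <= fst p + w n /\ snd p' + h (Datatypes.S n) <= snd p + h n.
  { move=> n p. case: (classic (bad n p)) => [Hb|]; last by exists p.
    have [P1 [P2 [P3 [P4 P5]]]] := Hb.
    have W := w0 n; have H := h0 n.
    have E := rectJ_split4 (fst p) (fst p + w n) (snd p) (snd p + h n) ltac:(lra) ltac:(lra) ltac:(lra) ltac:(lra) ltac:(lra) ltac:(lra).
    move: E; rewrite /=.
    have -> : (fst p + (fst p + w n)) / 2 = fst p + w n / 2 by field.
    have -> : (snd p + (snd p + h n)) / 2 = snd p + h n / 2 by field.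
    have -> : fst p + w n = (fst p + w n / 2) + w n / 2 by field.
    have -> : snd p + h n = (snd p + h n / 2) + h n / 2 by field.
    move=> E.
    have -> : (fst p + w n / 2) + w n / 2 = fst p + w n by field.
    have -> : (snd p + h n / 2) + h n / 2 = snd p + h n by field.
    pose qd x y := rectJ x (x + w n / 2) y (y + h n / 2).
    have E' : rectJ (fst p) (fst p + w n) (snd p) (snd p + h n) = qd (fst p) (snd p) + qd (fst p + w n / 2) (snd p) + qd (fst p) (snd p + h n / 2) + qd (fst p + w n / 2) (snd p + h n / 2).
    { rewrite /qd -E. congr rectJ; field. }
    rewrite E' in P5.
    have pick : forall x y, (x = fst p \/ x = fst p + w n / 2) -> (y = snd p \/ y = snd p + h n / 2) -> eps * (w n / 2 + h n / 2) ^ 2 < Rabs (qd x y) ->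
       exists p', bad n p -> bad (Datatypes.S n) p' /\ fst p <= fst p' /\ snd p <= snd p' /\
     fst p' + w (Datatypes.S n) <= fst p + w n /\ snd p' + h (Datatypes.S n) <= snd p + h n.
    { move=> x y Hx Hy Hq. exists (x, y) => _. rewrite /bad !wS !hS /= in Hq *.
      case: Hx => Hx; case: Hy => Hy; subst x y; rewrite /qd in Hq; repeat split; lra. }
    apply: NNPP => Hno.
    have nb : forall x y, (x = fst p \/ x = fst p + w n / 2) -> (y = snd p \/ y = snd p + h n / 2) -> Rabs (qd x y) <= eps * (w n / 2 + h n / 2) ^ 2.
    { move=> x y Hx Hy. apply: Rnot_lt_le => Hc. by apply: Hno; apply: (pick x y). }
    have Q1 := nb (fst p) (snd p) (or_introl eq_refl) (or_introl eq_refl).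
    have Q2 := nb _ (snd p) (or_intror eq_refl) (or_introl eq_refl).
    have Q3 := nb (fst p) _ (or_introl eq_refl) (or_intror eq_refl).
    have Q4 := nb _ _ (or_intror eq_refl) (or_intror eq_refl).
    move: P5 Q1 Q2 Q3 Q4.
    set q1 := qd _ _; set q2 := qd _ _; set q3 := qd _ _; set q4 := qd _ _ => P5 Q1 Q2 Q3 Q4.
    have T1 := Rabs_triang (q1 + q2 + q3) q4. have T2 := Rabs_triang (q1 + q2) q3. have T3 := Rabs_triang q1 q2.
    have : eps * (w n + h n) ^ 2 = 4 * (eps * (w n / 2 + h n / 2) ^ 2) by field.
    lra. }
  pose nx n p := proj1_sig (constructive_indefinite_description _ (step n p)).
  have nxP : forall n p, bad n p -> bad (Datatypes.S n) (nx n p) /\ fst p <= fst (nx n p) /\ snd p <= snd (nx n p) /\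
     fst (nx n p) + w (Datatypes.S n) <= fst p + w n /\ snd (nx n p) + h (Datatypes.S n) <= snd p + h n.
  { move=> n p; rewrite /nx; by case: (constructive_indefinite_description _ (step n p)). }
  pose ps := fix ps n := match n with O => (A, A') | Datatypes.S k => nx k (ps k) end.
  have psB : forall n, bad n (ps n).
  { elim=> [|n IH]; last by case: (nxP _ _ IH).
    rewrite /bad /w /h /=. rewrite !Rdiv_1_r. repeat split; try lra.
    have -> : A + (B - A) = B by ring. have -> : A' + (B' - A') = B' by ring.
    by rewrite /S in Hbad; rewrite /= in Hbad; lra. }
  have mono1 : forall n, fst (ps n) <= fst (ps (Datatypes.S n)) by move=> n; have [_ [? _]] := nxP _ _ (psB n).
  have mono2 : forall n, snd (ps n) <= snd (ps (Datatypes.S n)) by move=> n; have [_ [_ [? _]]] := nxP _ _ (psB n).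
  have dec1 : forall n, fst (ps (Datatypes.S n)) + w (Datatypes.S n) <= fst (ps n) + w n by move=> n; have [_ [_ [_ [? _]]]] := nxP _ _ (psB n).
  have dec2 : forall n, snd (ps (Datatypes.S n)) + h (Datatypes.S n) <= snd (ps n) + h n by move=> n; have [_ [_ [_ [_ ?]]]] := nxP _ _ (psB n).
  have nest : forall (a e : nat -> R), (forall n, a n <= a (Datatypes.S n)) -> (forall n, 0 <= e n) ->
     (forall n, a (Datatypes.S n) + e (Datatypes.S n) <= a n + e n) ->
     exists u, forall n, a n <= u <= a n + e n.
  { move=> a e Ha He0 Hd.
    have am : forall n k, a n <= a (n + k)%nat.
    { move=> n; elim=> [|k IH]; first by rewrite Nat.add_0_r; lra.
      rewrite Nat.add_succ_r. by have := Ha (n + k)%nat; lra. }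
    have em : forall n k, a (n + k)%nat + e (n + k)%nat <= a n + e n.
    { move=> n; elim=> [|k IH]; first by rewrite Nat.add_0_r; lra.
      rewrite Nat.add_succ_r. by have := Hd (n + k)%nat; lra. }
    have cross : forall n k, a k <= a n + e n.
    { move=> n k. case: (Nat.le_ge_cases n k) => H.
      - have -> : k = (n + (k - n))%nat by lia. have := em n (k - n)%nat; have := He0 (n + (k - n))%nat; lra.
      - have := am k (n - k)%nat. have -> : (k + (n - k) = n)%nat by lia. have := He0 n; lra. }
    have [u [Hu1 Hu2]] : {u | is_lub (fun x => exists n, x = a n) u}.
    { apply: completeness.
      - exists (a O + e O) => x [n ->]; exact: cross.
      - by exists (a O), O. }
    exists u => n; split; first by apply: Hu1; exists n.
    apply: Hu2 => x [k ->]; exact: cross. }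
  have [u Hu] := nest (fun n => fst (ps n)) w mono1 w0 dec1.
  have [v Hv] := nest (fun n => snd (ps n)) h mono2 h0 dec2.
  have Hu0 : A <= u <= B by have := Hu O; rewrite /w /= Rdiv_1_r; lra.
  have Hv0 : A' <= v <= B' by have := Hv O; rewrite /h /= Rdiv_1_r; lra.
  have [B1 [B2 HB]] := hol u v Hu0 Hv0.
  (* The factor 4 in [rectJ_bound_local] turns [eps / 4] into exactly the threshold exceeded by
     [bad]. *)
  have [r [Hr Hl]] := HB (eps / 4) ltac:(lra).
  have [n Hn] : exists n, S / 2 ^ n < r.
  { case: (Req_dec S 0) => [->|HS]; first by exists O; rewrite /=; lra.
    have HS' : 0 < S by rewrite /S in HS *; lra.
    have [N HN] := pow_lt_1_zero (/ 2) ltac:(rewrite Rabs_pos_eq; lra) (r / S) ltac:(by apply: Rdiv_lt_0_compat; lra).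
    exists N. have := HN N (le_n N). rewrite Rabs_pos_eq; last by apply: pow_le; lra.
    rewrite pow_inv => HH.
    have := Rmult_lt_compat_r _ _ _ HS' HH. rewrite /Rdiv (Rmult_assoc r) Rinv_l //. lra. }
  have [P1 [P2 [P3 [P4 P5]]]] := psB n.
  have W := w0 n; have H := h0 n.
  have ES : S / 2 ^ n = w n + h n by rewrite /S /w /h /Rdiv; ring.
  have := rectJ_bound_local u v B1 B2 (eps / 4) r (fst (ps n)) (fst (ps n) + w n) (snd (ps n)) (snd (ps n) + h n) Hl ltac:(lra) P1 ltac:(lra) P2 P3 ltac:(lra) P4 (w n + h n) ltac:(lra).
  have Hun := Hu n; have Hvn := Hv n.
  move=> K.
  have K1 : forall x, fst (ps n) <= x <= fst (ps n) + w n -> Rabs (x - u) <= w n + h n.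
  { move=> x Hx. apply: Rabs_le; lra. }
  have K2 : forall x, snd (ps n) <= x <= snd (ps n) + h n -> Rabs (x - v) <= w n + h n.
  { move=> x Hx. apply: Rabs_le; lra. }
  have := K K1 K2.
  have -> : 4 * (eps / 4) * (w n + h n) * (fst (ps n) + w n - fst (ps n) + (snd (ps n) + h n - snd (ps n))) = eps * (w n + h n) ^ 2 by field.
  lra. }
have S0 : 0 <= S by rewrite /S; lra.
case: (Req_dec (rectJ A B A' B') 0) => // Hne.
have Hp : 0 < Rabs (rectJ A B A' B') by apply: Rabs_pos_lt.
have HS : 0 < S ^ 2 + 1 by nra.
have := key (Rabs (rectJ A B A' B') / 2 / (S ^ 2 + 1)) ltac:(apply: Rdiv_lt_0_compat; lra).
set X := Rabs _ in Hp *.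
have -> : X / 2 / (S ^ 2 + 1) * S ^ 2 = X / 2 * (S ^ 2 / (S ^ 2 + 1)) by field; lra.
have : S ^ 2 / (S ^ 2 + 1) <= 1 by apply/Rle_div_l; lra.
nra.
Qed.
End Rect.

(** [C] carries two normed module structures: [L_continuation] is stated over [C_NormedModule],
    while the product and composition rules live over [AbsRing_NormedModule]. [cderiv] is the
    neutral ground between them. *)
Lemma cderiv_is_derive_ring (f : C -> C) (z l : C) :
  @is_derive C_AbsRing (AbsRing_NormedModule C_AbsRing) f z l <-> cderiv f z l.
Proof.
split.
- move=> [_ H] eps He.
  have [d Hd] := H z (fun P HP => HP) (mkposreal eps He).
  exists d; split; first exact: cond_pos.
  by move=> w Hw; apply: Hd.
- move=> H; split; first exact: is_linear_scal_l.
  move=> x Hx eps.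
  have E := @is_filter_lim_locally_unique C_AbsRing (AbsRing_NormedModule C_AbsRing) z x Hx.
  have {}E : x = z by [].
  rewrite E.
  have [d [Hd Hd']] := H eps (cond_pos eps).
  by exists (mkposreal d Hd) => w Hw; apply: Hd'.
Qed.

Lemma cderiv_mult (f g : C -> C) (z a b : C) : cderiv f z a -> cderiv g z b ->
  cderiv (fun w => f w * g w)%C z (a * g z + f z * b)%C.
Proof.
move=> /cderiv_is_derive_ring Hf /cderiv_is_derive_ring Hg.
apply/cderiv_is_derive_ring. apply: (is_derive_mult f g z a b Hf Hg). exact: Cmult_comm.
Qed.

Lemma cderiv_plus (f g : C -> C) (z a b : C) : cderiv f z a -> cderiv g z b ->
  cderiv (fun w => f w + g w)%C z (a + b)%C.
Proof.
move=> /cderiv_is_derive_ring Hf /cderiv_is_derive_ring Hg.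
apply/cderiv_is_derive_ring. exact: (@is_derive_plus C_AbsRing (AbsRing_NormedModule C_AbsRing) f g z a b Hf Hg).
Qed.

Lemma cderiv_const (c z : C) : cderiv (fun _ => c) z (RtoC 0).
Proof. by apply/cderiv_is_derive_ring; apply: is_derive_const. Qed.

Lemma cderiv_id (z : C) : cderiv (fun w => w) z (RtoC 1).
Proof. by apply/cderiv_is_derive_ring; apply: is_derive_id. Qed.

Lemma cderiv_comp (f g : C -> C) (z a b : C) : cderiv f (g z) a -> cderiv g z b ->
  cderiv (fun w => f (g w)) z (b * a)%C.
Proof.
move=> /cderiv_is_derive_ring Hf /cderiv_is_derive_ring Hg.
apply/cderiv_is_derive_ring. exact: (@is_derive_comp C_AbsRing (AbsRing_NormedModule C_AbsRing) f g z a b Hf Hg).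
Qed.

Lemma cderiv_ext (f g : C -> C) (z l : C) : (forall w, f w = g w) -> cderiv f z l -> cderiv g z l.
Proof. move=> E H eps He; have [d [Hd K]] := H eps He; exists d; split=> // w Hw; rewrite -!E; exact: K. Qed.

Lemma cderiv_scal (c : C) (f : C -> C) (z a : C) : cderiv f z a -> cderiv (fun w => c * f w)%C z (c * a)%C.
Proof.
move=> H. have := cderiv_mult _ _ _ _ _ (cderiv_const c z) H.
by rewrite Cmult_0_l Cplus_0_l.
Qed.

Lemma Ceq (z w : C) : Re z = Re w -> Im z = Im w -> z = w.
Proof. rewrite /Re /Im (surjective_pairing z) (surjective_pairing w) /= => -> ->. done. Qed.

(** * The complex exponential and derivatives along real paths *)

Definition cexp (w : C) : C := (exp (Re w) * cos (Im w), exp (Re w) * sin (Im w)).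

Lemma cexp_add (z w : C) : cexp (z + w) = (cexp z * cexp w)%C.
Proof. apply: Ceq; rewrite /cexp /Re /Im /= exp_plus ?cos_plus ?sin_plus; ring. Qed.

Lemma cexp_0 : cexp 0 = RtoC 1.
Proof. by apply: Ceq; rewrite /cexp /Re /Im /= exp_0 ?cos_0 ?sin_0; ring. Qed.

Lemma Cmod_cexp (w : C) : Cmod (cexp w) = exp (Re w).
Proof.
rewrite /cexp /Cmod /=.
have -> : exp (Re w) * cos (Im w) * (exp (Re w) * cos (Im w) * 1) + exp (Re w) * sin (Im w) * (exp (Re w) * sin (Im w) * 1) = exp (Re w) * exp (Re w) * (Rsqr (sin (Im w)) + Rsqr (cos (Im w))) by rewrite /Rsqr; ring.
rewrite sin2_cos2 Rmult_1_r sqrt_square //. by apply: Rlt_le; apply: exp_pos.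
Qed.

Lemma cpow_neg_cexp n s : cpow_neg n s = cexp (- s * RtoC (ln (INR n)))%C.
Proof.
rewrite /cpow_neg /cexp; have -> : Re (- s * RtoC (ln (INR n))) = - Re s * ln (INR n) by rewrite /Re /=; ring.
have -> // : Im (- s * RtoC (ln (INR n))) = - Im s * ln (INR n) by rewrite /Im /=; ring.
Qed.

Definition rderiv (g : R -> C) (t : R) (l : C) : Prop :=
  is_derive (fun x => Re (g x)) t (Re l) /\ is_derive (fun x => Im (g x)) t (Im l).

Lemma rderiv_eq g t l l' : l = l' -> rderiv g t l -> rderiv g t l'.
Proof. by move=> ->. Qed.

Lemma rderiv_ext f g t l : (forall x, f x = g x) -> rderiv f t l -> rderiv g t l.
Proof. by move=> E [A B]; split; [apply: is_derive_ext A|apply: is_derive_ext B] => x; rewrite E. Qed.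

Lemma rderiv_const c t : rderiv (fun _ => c) t (RtoC 0).
Proof. by split; rewrite ?re_RtoC ?im_RtoC; apply: is_derive_const. Qed.

Lemma rderiv_plus f g t a b : rderiv f t a -> rderiv g t b -> rderiv (fun x => f x + g x)%C t (a + b)%C.
Proof.
move=> [A1 A2] [B1 B2]; split.
- apply: (is_derive_ext (fun x => Re (f x) + Re (g x))) => //. rewrite re_plus. exact: (is_derive_plus (V := R_NormedModule)).
- apply: (is_derive_ext (fun x => Im (f x) + Im (g x))) => //. rewrite im_plus. exact: (is_derive_plus (V := R_NormedModule)).
Qed.

Lemma rderiv_mult f g t a b : rderiv f t a -> rderiv g t b -> rderiv (fun x => f x * g x)%C t (a * g t + f t * b)%C.
Proof.
move=> [A1 A2] [B1 B2].
have M : forall (u v : R -> R) u' v', is_derive u t u' -> is_derive v t v' -> is_derive (fun x => u x * v x) t (u' * v t + u t * v').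
{ move=> u v u' v' Hu Hv. apply: (is_derive_mult u v t u' v' Hu Hv). exact: Rmult_comm. }
split.
- apply: (is_derive_ext (fun x => Re (f x) * Re (g x) - Im (f x) * Im (g x))).
    by move=> x; rewrite re_mult.
  have -> : Re (a * g t + f t * b) = (Re a * Re (g t) + Re (f t) * Re b) - (Im a * Im (g t) + Im (f t) * Im b).
    rewrite re_plus !re_mult; ring.
  apply: (is_derive_minus (V := R_NormedModule)); exact: M.
- apply: (is_derive_ext (fun x => Re (f x) * Im (g x) + Im (f x) * Re (g x))).
    by move=> x; rewrite im_mult.
  have -> : Im (a * g t + f t * b) = (Re a * Im (g t) + Re (f t) * Im b) + (Im a * Re (g t) + Im (f t) * Re b).
    rewrite im_plus !im_mult; ring.
  apply: (is_derive_plus (V := R_NormedModule)); exact: M.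
Qed.

Lemma rderiv_scal c g t l : rderiv g t l -> rderiv (fun x => c * g x)%C t (c * l)%C.
Proof.
move=> H. apply: rderiv_eq (rderiv_mult _ _ _ _ _ (rderiv_const c t) H). ring.
Qed.

Lemma rderiv_RtoC (u : R -> R) t l : is_derive u t l -> rderiv (fun x => RtoC (u x)) t (RtoC l).
Proof. move=> H; split => //=. exact: is_derive_const. Qed.

Lemma rderiv_cexp g t l : rderiv g t l -> rderiv (fun x => cexp (g x)) t (l * cexp (g t))%C.
Proof.
move=> [A1 A2].
have HE : is_derive (fun x => exp (Re (g x))) t (Re l * exp (Re (g t))).
{ apply: (is_derive_comp exp (fun x => Re (g x))) => //. exact: is_derive_exp. }
have HC : is_derive (fun x => cos (Im (g x))) t (Im l * - sin (Im (g t))).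
{ apply: (is_derive_comp cos (fun x => Im (g x))) => //. exact: is_derive_cos. }
have HS : is_derive (fun x => sin (Im (g x))) t (Im l * cos (Im (g t))).
{ apply: (is_derive_comp sin (fun x => Im (g x))) => //. exact: is_derive_sin. }
split.
- have -> : Re (l * cexp (g t)) = (Re l * exp (Re (g t))) * cos (Im (g t)) + exp (Re (g t)) * (Im l * - sin (Im (g t))).
    rewrite /cexp /Re /Im /=; ring.
  apply: (is_derive_mult (fun x => exp (Re (g x))) (fun x => cos (Im (g x))) t _ _ HE HC). exact: Rmult_comm.
- have -> : Im (l * cexp (g t)) = (Re l * exp (Re (g t))) * sin (Im (g t)) + exp (Re (g t)) * (Im l * cos (Im (g t))).
    rewrite /cexp /Re /Im /=; ring.
  apply: (is_derive_mult (fun x => exp (Re (g x))) (fun x => sin (Im (g x))) t _ _ HE HS). exact: Rmult_comm.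
Qed.

(** The mean value theorem fails for complex values; it is applied to the real and imaginary parts
    separately, whence the factor 2. *)
Lemma rderiv_mvt (g dg : R -> C) (a b M : R) : a <= b ->
  (forall t, a <= t <= b -> rderiv g t (dg t)) ->
  (forall t, a <= t <= b -> Cmod (dg t) <= M) ->
  Cmod (g b - g a) <= 2 * M * (b - a).
Proof.
move=> Hab Hg HM.
have key : forall (p dp : R -> R), (forall t, a <= t <= b -> is_derive p t (dp t)) -> (forall t, a <= t <= b -> Rabs (dp t) <= M) -> Rabs (p b - p a) <= M * (b - a).
{ move=> p dp Hp Hd.
  have [c [Hc1 Hc2]] := MVT_gen p a b dp
    ltac:(by rewrite Rmin_left // Rmax_right // => x Hx; apply: Hp; lra)
    ltac:(rewrite Rmin_left // Rmax_right // => x Hx; apply/continuity_pt_filterlim; apply: (ex_derive_continuous p); eexists; exact: Hp).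
  rewrite Rmin_left // Rmax_right // in Hc1.
  rewrite Hc2 Rabs_mult (Rabs_pos_eq (b - a)); last lra.
  apply: Rmult_le_compat_r; [lra|exact: Hd]. }
have K1 := key (fun t => Re (g t)) (fun t => Re (dg t)) (fun t Ht => proj1 (Hg t Ht)) (fun t Ht => Rle_trans _ _ _ (re_le_Cmod _) (HM t Ht)).
have K2 := key (fun t => Im (g t)) (fun t => Im (dg t)) (fun t Ht => proj2 (Hg t Ht)) (fun t Ht => Rle_trans _ _ _ (im_le_Cmod _) (HM t Ht)).
apply: Rle_trans (Cmod_le_abs _) _.
rewrite /Cminus re_plus im_plus re_opp im_opp. rewrite /Rminus in K1 K2 *. lra.
Qed.

Lemma cexp_sub1_bound (w : C) : Cmod (cexp w - 1) <= 2 * Cmod w * exp (Cmod w).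
Proof.
pose g t := cexp (RtoC t * w).
have -> : (cexp w - 1 = g 1 - g 0)%C.
{ by rewrite /g Cmult_1_l Cmult_0_l cexp_0. }
have W := Cmod_ge_0 w.
have -> : 2 * Cmod w * exp (Cmod w) = 2 * (Cmod w * exp (Cmod w)) * (1 - 0) by ring.
apply: (rderiv_mvt g (fun t => w * g t)%C); first lra.
- move=> t _. rewrite /g. apply: rderiv_cexp.
  apply: rderiv_eq (rderiv_mult _ _ _ _ _ (rderiv_RtoC (fun x => x) t 1 (is_derive_id t)) (rderiv_const w t)). ring.
- move=> t Ht. rewrite Cmod_mult. apply: Rmult_le_compat_l => //. rewrite /g Cmod_cexp.
  have : Re (RtoC t * w) <= Cmod w.
  { rewrite re_scal_l. have := re_le_Cmod w. have := Rle_abs (Re w). have := Rabs_pos (Re w). nra. }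
  case=> [H|->]; [by apply: Rlt_le; apply: exp_increasing|lra].
Qed.

Lemma cexp_taylor2 (w : C) : Cmod (cexp w - 1 - w) <= 4 * Cmod w ^ 2 * exp (Cmod w).
Proof.
pose g t := (cexp (RtoC t * w) - RtoC t * w)%C.
have -> : (cexp w - 1 - w = g 1 - g 0)%C.
{ rewrite /g Cmult_1_l Cmult_0_l cexp_0. ring. }
have W := Cmod_ge_0 w.
have -> : 4 * Cmod w ^ 2 * exp (Cmod w) = 2 * (Cmod w * (2 * Cmod w * exp (Cmod w))) * (1 - 0) by ring.
apply: (rderiv_mvt g (fun t => w * (cexp (RtoC t * w) - 1))%C); first lra.
- move=> t _. rewrite /g.
  have D : rderiv (fun x => RtoC x * w)%C t w.
    apply: rderiv_eq (rderiv_mult _ _ _ _ _ (rderiv_RtoC (fun x => x) t 1 (is_derive_id t)) (rderiv_const w t)). ring.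
  have D1 := rderiv_plus _ _ _ _ _ (rderiv_cexp _ _ _ D) (rderiv_scal (-1)%C _ _ _ D).
  apply: rderiv_eq (rderiv_ext _ _ _ _ _ D1); first ring.
  move=> x; ring.
- move=> t Ht. rewrite Cmod_mult. apply: Rmult_le_compat_l => //.
  apply: Rle_trans (cexp_sub1_bound _) _.
  rewrite Cmod_mult Cmod_R Rabs_pos_eq; last lra.
  have E : exp (t * Cmod w) <= exp (Cmod w).
  { have : t * Cmod w <= Cmod w by nra. case=> [H|->]; [by apply: Rlt_le; apply: exp_increasing|lra]. }
  have := exp_pos (t * Cmod w).
  have : t * Cmod w <= Cmod w by nra. have : 0 <= t * Cmod w by nra. nra.
Qed.

Lemma cderiv_cexp (z : C) : cderiv cexp z (cexp z).
Proof.
move=> eps He.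
have Hz := exp_pos (Re z).
pose K := 4 * exp (Re z) * exp 1.
have HK : 0 < K by rewrite /K; have := exp_pos 1; nra.
exists (Rmin 1 (eps / K)); split.
{ apply: Rmin_pos; [lra|exact: Rdiv_lt_0_compat]. }
move=> w Hw.
set h := (w - z)%C in Hw *.
have -> : (cexp w - cexp z - h * cexp z = cexp z * (cexp h - 1 - h))%C.
{ have -> : (w = z + h)%C by rewrite /h; ring. rewrite cexp_add. ring. }
rewrite Cmod_mult Cmod_cexp.
have T := cexp_taylor2 h.
have H1 := Rmin_l 1 (eps / K); have H2 := Rmin_r 1 (eps / K).
have P := Cmod_ge_0 h.
have E : exp (Cmod h) <= exp 1 by apply: Rlt_le; apply: exp_increasing; lra.
have H3 : Cmod h * K <= eps.
{ have H4 : Cmod h < eps / K by lra. have := Rmult_lt_compat_r _ _ _ HK H4. rewrite /Rdiv Rmult_assoc Rinv_l; lra. }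
apply: Rle_trans (_ : exp (Re z) * (4 * Cmod h ^ 2 * exp 1) <= _).
{ apply: Rmult_le_compat_l; first lra. apply: Rle_trans T _. apply: Rmult_le_compat_l => //. nra. }
rewrite /K in H3. nra.
Qed.

(** * Uniqueness of analytic continuation *)

Lemma continuous_bounded (g : R -> R) (a b : R) : a <= b ->
  (forall t, a <= t <= b -> continuous g t) -> exists M, forall t, a <= t <= b -> Rabs (g t) <= M.
Proof.
move=> Hab Hg.
have Hc : forall c, a <= c <= b -> continuity_pt (fun t => Rabs (g t)) c.
{ move=> c Hc. apply/continuity_pt_filterlim. apply: (continuous_comp g Rabs); first exact: Hg.
  exact: continuous_Rabs. }
have [Mx [HM _]] := continuity_ab_maj _ a b Hab Hc.
by exists (Rabs (g Mx)).
Qed.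

Lemma RInt_ge_const (g : R -> R) a b k : a <= b -> ex_RInt g a b ->
  (forall t, a < t < b -> k <= g t) -> k * (b - a) <= RInt g a b.
Proof.
move=> Hab Hex Hk.
have -> : k * (b - a) = RInt (fun _ => k) a b.
{ rewrite RInt_const /scal /= /mult /=; ring. }
by apply: RInt_le => //; apply: ex_RInt_const.
Qed.

(* Integrating [E] against the Gaussian [exp (N (z - w)^2)] along a rectangle whose left side is
   centred at [w]: on that side the kernel concentrates at [w], on the horizontal sides it is
   exponentially smaller because they are longer than the rectangle is wide, and on the right
   side [E] vanishes. *)
Lemma holomorphic_vanish_step (E : C -> C) :
  (forall z, z <> RtoC 0 -> exists l, cderiv E z l) ->
  (forall z, 0 < Re z -> E z = RtoC 0) ->
  forall z, 0 < Re z + Im z -> E z = RtoC 0.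
Proof.
move=> HE H0 [x y]; rewrite /Re /Im /= => Ht.
case: (Rlt_le_dec 0 x) => Hx; first exact: H0.
apply: NNPP => Hne.
set w : C := (x, y).
(* The lower side of the rectangle lies at height [t / 2], clear of the possible singularity at 0,
   the right side lies in [0 < Re z], and the half-height [h] exceeds the width [wd] by [t / 4]. *)
pose t := x + y. pose b := t / 4. pose h := y - t / 2. pose c := y - h. pose d := y + h. pose wd := b - x.
have Htp : 0 < t by rewrite /t; lra.
have Hb : 0 < b by rewrite /b; lra.
have Hh : wd < h by rewrite /wd /h /b /t; rewrite /t in Htp; lra.
have Hwd : 0 < wd by rewrite /wd; lra.
have Hc : 0 < c by rewrite /c /h; lra.
pose kap := h ^ 2 - wd ^ 2.
have Hk : 0 < kap by rewrite /kap; nra.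
(* Multiplying by the conjugate makes the value at [w] the positive real [m0], so the real part
   stays bounded below near [w]. *)
pose c0 := Cconj (E w).
pose m0 := Cmod (E w) ^ 2.
have Hm0 : 0 < m0 by rewrite /m0; apply: pow_lt; apply/Cmod_gt_0.
have nz : forall s r, c <= r -> (s, r) <> RtoC 0.
{ move=> s r Hr [_ Hr']. lra. }
have hE2 : forall s r, c <= r -> holo2 (fun s r => Re (c0 * E (s, r))) (fun s r => Im (c0 * E (s, r))) s r.
{ move=> s r Hr. have [l Hl] := HE (s, r) (nz s r Hr).
  exact: (cderiv_holo2 (fun z => c0 * E z)%C s r _ (cderiv_scal c0 _ _ _ Hl)). }
have hcont := fun s r Hr => holo2_continuous _ _ _ _ (hE2 s r Hr).
have [M [HM0 [HMl HMt]]] : exists M, 0 <= M /\ (forall r, c <= r <= d -> Cmod (c0 * E (x, r)) <= M) /\ (forall s, x <= s <= b -> Cmod (c0 * E (s, c)) <= M /\ Cmod (c0 * E (s, d)) <= M).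
{ have [M1 H1] := continuous_bounded (fun r => Re (c0 * E (x, r))) c d ltac:(rewrite /c /d; lra) (fun r Hr => proj1 (proj2 (hcont x r (proj1 Hr)))).
  have [M2 H2] := continuous_bounded (fun r => Im (c0 * E (x, r))) c d ltac:(rewrite /c /d; lra) (fun r Hr => proj2 (proj2 (proj2 (hcont x r (proj1 Hr))))).
  have [M3 H3] := continuous_bounded (fun s => Re (c0 * E (s, c))) x b ltac:(lra) (fun s Hs => proj1 (hcont s c (Rle_refl c))).
  have [M4 H4] := continuous_bounded (fun s => Im (c0 * E (s, c))) x b ltac:(lra) (fun s Hs => proj1 (proj2 (proj2 (hcont s c (Rle_refl c))))).
  have Hcd : c <= d by rewrite /c /d; lra.
  have [M5 H5] := continuous_bounded (fun s => Re (c0 * E (s, d))) x b ltac:(lra) (fun s Hs => proj1 (hcont s d Hcd)).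
  have [M6 H6] := continuous_bounded (fun s => Im (c0 * E (s, d))) x b ltac:(lra) (fun s Hs => proj1 (proj2 (proj2 (hcont s d Hcd)))).
  have P : forall u u' (A B : R -> R), (exists t, u <= t <= u') -> forall M M', (forall t, u <= t <= u' -> Rabs (A t) <= M) -> (forall t, u <= t <= u' -> Rabs (B t) <= M') -> 0 <= M /\ 0 <= M'.
  { move=> u u' A B [s Hs] N N' HA HB. have := HA s Hs; have := HB s Hs. have := Rabs_pos (A s); have := Rabs_pos (B s). lra. }
  have [Q1 Q2] := P _ _ _ _ (ex_intro _ c (conj (Rle_refl c) Hcd)) _ _ H1 H2.
  have Hxb : x <= b by lra.
  have [Q3 Q4] := P _ _ _ _ (ex_intro _ x (conj (Rle_refl x) Hxb)) _ _ H3 H4.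
  have [Q5 Q6] := P _ _ _ _ (ex_intro _ x (conj (Rle_refl x) Hxb)) _ _ H5 H6.
  exists (M1 + M2 + M3 + M4 + M5 + M6); split; first lra. split.
  - move=> r Hr. apply: Rle_trans (Cmod_le_abs _) _. have := H1 r Hr; have := H2 r Hr. lra.
  - move=> s Hs. split; apply: Rle_trans (Cmod_le_abs _) _.
    + have := H3 s Hs; have := H4 s Hs. lra.
    + have := H5 s Hs; have := H6 s Hs. lra. }
pose phi r := Re (c0 * E (x, r)).
have phiy : phi y = m0.
{ rewrite /phi /m0 -/w Cmult_comm /c0. apply: RtoC_inj. rewrite -Cmod2_conj. by rewrite re_RtoC. }
have Hcy : c <= y by rewrite /c; lra.
(* The condition [eta ^ 2 <= kap] lets the single factor [exp (- N * eta ^ 2)] dominate the kernel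
   both on the horizontal sides and on the left side away from [w]. *)
have [eta [He1 [He2 [He3 He4]]]] : exists eta, 0 < eta /\ eta <= h /\ eta ^ 2 <= kap /\ forall r, Rabs (r - y) <= eta -> m0 / 2 <= phi r.
{ have Hphi : continuity_pt phi y by apply/continuity_pt_filterlim; exact: (proj1 (proj2 (hcont x y Hcy))).
  have [e [He He']] := Hphi (m0 / 2) ltac:(lra).
  exists (Rmin (e / 2) (Rmin h (Rmin 1 kap))).
  have A1 := Rmin_l (e / 2) (Rmin h (Rmin 1 kap)). have A2 := Rmin_r (e / 2) (Rmin h (Rmin 1 kap)).
  have A3 := Rmin_l h (Rmin 1 kap). have A4 := Rmin_r h (Rmin 1 kap).
  have A5 := Rmin_l 1 kap. have A6 := Rmin_r 1 kap.
  have A0 : 0 < Rmin (e / 2) (Rmin h (Rmin 1 kap)) by repeat apply: Rmin_pos; lra.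
  split=> //. split; first lra. split; first nra.
  move=> r Hr. case: (Req_dec y r) => [<-|Hyr]; first by rewrite phiy; lra.
  have Hre : Rabs (r - y) < e by lra.
  have := He' r (conj (conj I Hyr) Hre).
  rewrite /= /R_dist phiy. case/Rabs_def2. lra. }
pose K N (z : C) := cexp (RtoC N * ((z - w) * (z - w))).
have main : forall N, 0 <= N -> (m0 / 2) * eta * exp (- N * (eta ^ 2 / 4)) <= (2 * h * M + 2 * wd * M) * exp (- N * eta ^ 2).
{ move=> N HN.
  (* The factor [- i] moves the real part of the integrand on the left side into the imaginary part,
     which is what [rectJ] integrates on vertical sides. *)
  pose f z := (- Ci * (c0 * E z * K N z))%C.
  have hf : forall s r, x <= s <= b -> c <= r <= d -> holo2 (fun s r => Re (f (s, r))) (fun s r => Im (f (s, r))) s r.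
  { move=> s r Hs [Hr _].
    have [l Hl] := HE (s, r) (nz s r Hr).
    apply: (cderiv_holo2 f s r _ (cderiv_scal (- Ci)%C _ _ _ (cderiv_mult _ _ _ _ _ (cderiv_scal c0 _ _ _ Hl) (cderiv_comp cexp (fun z => RtoC N * ((z - w) * (z - w)))%C _ _ _ (cderiv_cexp _) _)))).
    have D : cderiv (fun z => z - w)%C (s, r) (RtoC 1 + RtoC 0)%C := cderiv_plus _ _ _ _ _ (cderiv_id _) (cderiv_const (- w)%C _).
    exact: (cderiv_scal (RtoC N) _ _ _ (cderiv_mult _ _ _ _ _ D D)). }
  have Hxb : x <= b by lra.
  have Hcd : c <= d by rewrite /c /d; lra.
  have G := goursat_rect _ _ x b c d hf Hxb Hcd.
  rewrite /rectJ in G.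
  have EV : RInt (fun r => Im (f (b, r)) - Im (f (x, r))) c d = RInt (fun r => phi r * exp (- N * (r - y) ^ 2)) c d.
  { apply: RInt_ext => r _.
    have -> : f (b, r) = RtoC 0 by rewrite /f H0 //; rewrite Cmult_0_r Cmult_0_l Cmult_0_r.
    rewrite im_RtoC /f /phi.
    have -> : K N (x, r) = RtoC (exp (- N * (r - y) ^ 2)).
    { rewrite /K /cexp.
      have -> : Re (N * (((x, r) - w) * ((x, r) - w))) = - N * (r - y) ^ 2 by rewrite /w /Re /=; ring.
      have -> : Im (N * (((x, r) - w) * ((x, r) - w))) = 0 by rewrite /w /Im /=; ring.
      rewrite cos_0 sin_0 Rmult_1_r Rmult_0_r //. }
    set z := (c0 * E (x, r))%C. set e := exp _. rewrite im_mult re_opp im_opp re_scal_r im_scal_r /Re /Im /=. ring. }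
  rewrite EV in G.
  have exphi : forall p q, c <= p -> p <= q -> ex_RInt (fun r => phi r * exp (- N * (r - y) ^ 2)) p q.
  { move=> p q Hp Hpq. apply: ex_RInt_continuous; rewrite Rmin_left // Rmax_right // => z Hz.
    apply: (continuous_mult (K := R_AbsRing) phi).
    - apply: (proj1 (proj2 (hcont x z _))). lra.
    - apply: ex_derive_continuous. by auto_derive. }
  have L : (m0 / 2) * eta * exp (- N * (eta ^ 2 / 4)) - 2 * h * M * exp (- N * eta ^ 2) <= RInt (fun r => phi r * exp (- N * (r - y) ^ 2)) c d.
  { have Q1 : c <= y - eta / 2 by rewrite /c; lra.
    have Q2 : y + eta / 2 <= d by rewrite /d; lra.
    rewrite -(RInt_Chasles _ c (y - eta / 2) d); [|by apply: exphi; lra|by apply: exphi; lra].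
    rewrite -(RInt_Chasles _ (y - eta / 2) (y + eta / 2) d); [|by apply: exphi; lra|by apply: exphi; lra].
    have low : forall r, c <= r <= d -> - M * exp (- N * eta ^ 2) <= phi r * exp (- N * (r - y) ^ 2).
    { move=> r Hr. have P1 := exp_pos (- N * eta ^ 2). have P2 := exp_pos (- N * (r - y) ^ 2).
      case: (Rle_dec (Rabs (r - y)) eta) => Hr2.
      - have := He4 r Hr2. nra.
      - have Hs : eta ^ 2 <= (r - y) ^ 2.
        { rewrite -(pow2_abs (r - y)). apply: pow_incr. lra. }
        have Hexp : exp (- N * (r - y) ^ 2) <= exp (- N * eta ^ 2).
        { have : - N * (r - y) ^ 2 <= - N * eta ^ 2 by nra.
          case=> [HH|->]; [by apply: Rlt_le; apply: exp_increasing|lra]. }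
        have : - M <= phi r.
        { have := HMl r Hr. have := re_le_Cmod (c0 * E (x, r)). rewrite -/(phi r).
          move/Rabs_le_between. lra. }
        nra. }
    have Qa : y - eta / 2 <= d by lra.
    have Qb : c <= y + eta / 2 by lra.
    have I1 := RInt_ge_const (fun r => phi r * exp (- N * (r - y) ^ 2)) c (y - eta / 2) _ Q1 (exphi _ _ (Rle_refl _) Q1) (fun r Hr => low r (conj (Rlt_le _ _ (proj1 Hr)) (Rle_trans _ _ _ (Rlt_le _ _ (proj2 Hr)) Qa))).
    have I3 := RInt_ge_const (fun r => phi r * exp (- N * (r - y) ^ 2)) (y + eta / 2) d _ Q2 (exphi _ _ Qb Q2) (fun r Hr => low r (conj (Rle_trans _ _ _ Qb (Rlt_le _ _ (proj1 Hr))) (Rlt_le _ _ (proj2 Hr)))).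
    have I2 : m0 / 2 * exp (- N * (eta ^ 2 / 4)) * (y + eta / 2 - (y - eta / 2)) <= RInt (fun r => phi r * exp (- N * (r - y) ^ 2)) (y - eta / 2) (y + eta / 2).
    { apply: RInt_ge_const; [lra|by apply: exphi; lra|] => r Hr.
      have A1 : Rabs (r - y) <= eta by apply: Rabs_le; lra.
      have Hexp : exp (- N * (eta ^ 2 / 4)) <= exp (- N * (r - y) ^ 2).
      { have sq : (r - y) ^ 2 <= eta ^ 2 / 4.
        { have := Rmult_le_pos (eta / 2 - (r - y)) (eta / 2 + (r - y)) ltac:(lra) ltac:(lra). lra. }
        have : - N * (eta ^ 2 / 4) <= - N * (r - y) ^ 2 by nra.
        case=> [HH|->]; [by apply: Rlt_le; apply: exp_increasing|lra]. }
      have := He4 r A1. have := exp_pos (- N * (eta ^ 2 / 4)). nra. }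
    have P1 := exp_pos (- N * eta ^ 2).
    have Q3 : (y - eta / 2 - c) + (d - (y + eta / 2)) <= 2 * h by rewrite /c /d; lra.
    have Q4 : 0 <= M * exp (- N * eta ^ 2) by apply: Rmult_le_pos; lra.
    have Q5 := Rmult_le_compat_r _ _ _ Q4 Q3. have Q6 : y + eta / 2 - (y - eta / 2) = eta by field.
    rewrite Q6 in I2. apply: Rle_trans (Rplus_le_compat _ _ _ _ I1 (Rplus_le_compat _ _ _ _ I2 I3)). lra. }
  have Up : Rabs (RInt (fun s => Re (f (s, c)) - Re (f (s, d))) x b) <= (b - x) * (2 * M * exp (- N * eta ^ 2)).
  { apply: abs_RInt_le_const => //.
    - apply: (ex_RInt_minus (V := R_NormedModule)); apply: ex_RInt_continuous; rewrite Rmin_left // Rmax_right // => s Hs.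
      + exact: (proj1 (holo2_continuous _ _ _ _ (hf s c Hs (conj (Rle_refl c) Hcd)))).
      + exact: (proj1 (holo2_continuous _ _ _ _ (hf s d Hs (conj Hcd (Rle_refl d))))).
    - move=> s Hs.
      have side : forall r, (r - y) ^ 2 = h ^ 2 -> Cmod (c0 * E (s, r)) <= M -> Rabs (Re (f (s, r))) <= M * exp (- N * eta ^ 2).
      { move=> r Hr HMr. apply: Rle_trans (re_le_Cmod _) _. rewrite /f Cmod_mult Cmod_opp Cmod_Ci Rmult_1_l Cmod_mult.
        apply: Rmult_le_compat => //; try exact: Cmod_ge_0.
        rewrite /K Cmod_cexp.
        have -> : Re (N * (((s, r) - w) * ((s, r) - w))) = N * ((s - x) ^ 2 - (r - y) ^ 2) by rewrite /w /Re /=; ring.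
        rewrite Hr.
        have : N * ((s - x) ^ 2 - h ^ 2) <= - N * eta ^ 2.
        { have : (s - x) ^ 2 <= wd ^ 2 by apply: pow_incr; rewrite /wd; lra. rewrite /kap in He3. nra. }
        case=> [HH|->]; [by apply: Rlt_le; apply: exp_increasing|lra]. }
      have [T1 T2] := HMt s Hs.
      have S1 := side c ltac:(rewrite /c; ring) T1.
      have S2 := side d ltac:(rewrite /d; ring) T2.
      apply: Rle_trans (Rabs_triang _ _) _. rewrite Rabs_Ropp. lra. }
  have Up' := Rle_trans _ _ _ (Rle_abs _) Up.
  rewrite -/wd in Up'. lra. }
(* After division by [exp (- N * eta ^ 2)] the left side of [main] still grows at least like
   [a * N], while the right side is the constant [B]; [N = (B + 1) / a] is the contradiction. *)
pose a := (m0 / 2) * eta * (3 / 4 * eta ^ 2).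
have Ha : 0 < a by rewrite /a; have : 0 < eta ^ 2 by [apply: pow_lt]; have : 0 < m0 / 2 * eta by [apply: Rmult_lt_0_compat; lra]; nra.
pose B := 2 * h * M + 2 * wd * M.
have HB : 0 <= B by rewrite /B; nra.
pose N := (B + 1) / a.
have HN : 0 < N by apply: Rdiv_lt_0_compat; lra.
have := main N ltac:(lra). rewrite -/B.
have -> : - N * (eta ^ 2 / 4) = N * (3 / 4 * eta ^ 2) + - N * eta ^ 2 by field.
rewrite exp_plus. have P := exp_pos (- N * eta ^ 2).
rewrite -Rmult_assoc => /(Rmult_le_reg_r _ _ _ P) HH.
have X := exp_ineq1_le (N * (3 / 4 * eta ^ 2)).
have : a * N = B + 1 by rewrite /N; field; lra.
rewrite {1}/a. have : 0 < m0 / 2 * eta by apply: Rmult_lt_0_compat; lra. nra.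
Qed.

(** Each application of [holomorphic_vanish_step] turns the half-plane where [F - G] vanishes by 45
    degrees about the point 1, and multiplication by [u = 1 + i] restores the normal form. Two turns
    leave 1/2 on the boundary, three put it inside: [1 + u ^ 3 * (1 + i) / 8 = 1 / 2]. *)
Lemma continuation_unique (F G : C -> C) :
  (forall z, z <> RtoC 1 -> exists l, cderiv F z l) ->
  (forall z, z <> RtoC 1 -> exists l, cderiv G z l) ->
  (forall z, 1 < Re z -> F z = G z) ->
  F (RtoC (/ 2)) = G (RtoC (/ 2)).
Proof.
move=> HF HG HFG.
pose u : C := (1, 1).
have hu : u <> RtoC 0 by move=> [H _]; lra.
pose E k z := (F (1 + u ^ k * z) - G (1 + u ^ k * z))%C.
have dE : forall k z, z <> RtoC 0 -> exists l, cderiv (E k) z l.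
{ move=> k z Hz.
  have nz : (1 + u ^ k * z)%C <> RtoC 1.
  { move=> H. have : (u ^ k * z)%C = RtoC 0.
    { have -> : (u ^ k * z = (1 + u ^ k * z) - 1)%C by ring. rewrite H; ring. }
    apply: Cmult_neq_0 => //. exact: Cpow_nz. }
  have D := cderiv_plus _ _ _ _ _ (cderiv_const 1 z) (cderiv_scal (u ^ k) _ _ _ (cderiv_id z)).
  have [a Ha] := HF _ nz. have [b Hb] := HG _ nz.
  eexists. apply: (cderiv_plus _ (fun z => - G (1 + u ^ k * z))%C).
  - exact: (cderiv_comp F (fun z => 1 + u ^ k * z)%C _ _ _ Ha D).
  - apply: (cderiv_ext (fun z => (-1) * G (1 + u ^ k * z)))%C; first by move=> ?; ring.
    apply: cderiv_scal. exact: (cderiv_comp G (fun z => 1 + u ^ k * z)%C _ _ _ Hb D). }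
have Hk : forall k z, 0 < Re z -> E k z = RtoC 0.
{ elim=> [|k IH] z Hz.
  - rewrite /E HFG; first by ring. rewrite /Re /= in Hz *. lra.
  - have -> : E (S k) z = E k (u * z)%C.
    { rewrite /E Cpow_S. by have -> : (u * u ^ k * z = u ^ k * (u * z))%C by ring. }
    apply: (holomorphic_vanish_step _ (dE k) IH).
    rewrite /u /Re /Im /= in Hz *. lra. }
have := Hk 3%nat (/ 8, / 8)%R ltac:(rewrite /Re /=; lra).
rewrite /E. have -> : (1 + u ^ 3 * (/ 8, / 8)%R)%C = RtoC (/ 2).
{ apply: Ceq; rewrite /u /Re /Im /=; field. }
move=> H. have -> : F (RtoC (/2)) = (F (RtoC (/2)) - G (RtoC (/2)) + G (RtoC (/2)))%C by ring.
rewrite H; ring.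
Qed.

(** * Continuation of Dirichlet series by repeated differencing *)

Fixpoint fdiff (k : nat) (u : R -> C) (x : R) : C :=
  match k with O => u x | S j => fdiff j u x - fdiff j u (x + 1) end%C.

Lemma fdiffS k u x : fdiff (S k) u x = (fdiff k u x - fdiff k u (x + 1))%C.
Proof. by []. Qed.

Lemma fdiff_ext k u v x : (forall t, u t = v t) -> fdiff k u x = fdiff k v x.
Proof. by move=> E; elim: k x => [|k IH] x //=; rewrite !IH. Qed.

Lemma fdiff_plus k u v x : fdiff k (fun t => u t + v t)%C x = (fdiff k u x + fdiff k v x)%C.
Proof. by elim: k x => [|k IH] x //=; rewrite !IH; ring. Qed.

Lemma fdiff_scal k c u x : fdiff k (fun t => c * u t)%C x = (c * fdiff k u x)%C.
Proof. by elim: k x => [|k IH] x //=; rewrite !IH; ring. Qed.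

Lemma rderiv_shift u t l : rderiv u (t + 1) l -> rderiv (fun x => u (x + 1)) t l.
Proof.
move=> [A B].
have D : is_derive (fun x : R => x + 1) t 1 by auto_derive.
split.
- have := is_derive_comp (fun y => Re (u y)) (fun x => x + 1) t _ _ A D.
  by rewrite /scal /= /mult /= Rmult_1_l.
- have := is_derive_comp (fun y => Im (u y)) (fun x => x + 1) t _ _ B D.
  by rewrite /scal /= /mult /= Rmult_1_l.
Qed.

Lemma rderiv_fdiff k u u' : (forall t, 1 <= t -> rderiv u t (u' t)) ->
  forall t, 1 <= t -> rderiv (fdiff k u) t (fdiff k u' t).
Proof.
move=> H; elim: k => [|k IH] t Ht /=; first exact: H.
have D1 := IH t Ht. have D2 := rderiv_shift _ _ _ (IH (t + 1) ltac:(lra)).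
apply: (rderiv_ext (fun x => fdiff k u x + (-1) * fdiff k u (x + 1)))%C.
  move=> x; ring.
apply: rderiv_eq (rderiv_plus _ _ _ _ _ D1 (rderiv_scal (-1)%C _ _ _ D2)). ring.
Qed.

(* x^{-s} (al (x^{-h} - 1 + h ln x) + be + ga ln x): a family closed under d/dx which contains
   x^{-s}, its s-derivative, and the second-order Taylor remainder in s. *)
Definition pwr (s h al be ga : C) (x : R) : C :=
  (cexp (- s * RtoC (ln x)) *
   (al * (cexp (- h * RtoC (ln x)) - 1 + h * RtoC (ln x)) + be + ga * RtoC (ln x)))%C.

(** Differentiation in [x] raises [s] by 1 and only mixes the coefficients linearly. This is the
    source of the decay: every difference gains a factor [1 / x]. *)
Lemma pwr_deriv s h al be ga t : 0 < t ->
  rderiv (pwr s h al be ga) t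
    (pwr (s + 1) h ((- s - h) * al) (ga - s * be) (al * h * h - s * ga) t).
Proof.
move=> Ht.
have DL : rderiv (fun x => RtoC (ln x)) t (RtoC (/ t)).
{ apply: rderiv_RtoC. exact: is_derive_ln. }
have D1 := rderiv_cexp _ _ _ (rderiv_scal (- s)%C _ _ _ DL).
have D2 := rderiv_cexp _ _ _ (rderiv_scal (- h)%C _ _ _ DL).
have D3 := rderiv_plus _ _ _ _ _ (rderiv_plus _ _ _ _ _ (rderiv_scal al _ _ _ (rderiv_plus _ _ _ _ _ (rderiv_plus _ _ _ _ _ D2 (rderiv_const (- (1))%C t)) (rderiv_scal h _ _ _ DL))) (rderiv_const be t)) (rderiv_scal ga _ _ _ DL).
apply: rderiv_eq (rderiv_mult _ _ _ _ _ D1 D3).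
rewrite /pwr.
have -> : (- (s + 1) * ln t = - s * ln t + - RtoC (ln t))%C by ring.
rewrite cexp_add.
have -> : cexp (- RtoC (ln t)) = RtoC (/ t).
{ apply: Ceq; rewrite /cexp re_opp im_opp re_RtoC im_RtoC Ropp_0 cos_0 sin_0 exp_Ropp exp_ln //=; ring. }
ring.
Qed.

Lemma exp_le x y : x <= y -> exp x <= exp y.
Proof. case=> [H|->]; [by apply: Rlt_le; apply: exp_increasing|lra]. Qed.

Lemma ln_ge0 x : 1 <= x -> 0 <= ln x.
Proof. move=> H. rewrite -ln_1. apply: ln_le; lra. Qed.

(** Two powers of [x] are given away. They absorb [x^(-h)] and the powers of [ln x], so that one
    bound serves [x^(-s)], its derivative in [s] and the Taylor remainder; the factor [Cmod h ^ 2]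
    is kept for the latter. *)
Lemma pwr_bound0 s h al be ga x : Cmod h <= 1 -> 1 <= x ->
  Cmod (pwr s h al be ga x) <= 8 * (Cmod al * Cmod h ^ 2 + Cmod be + Cmod ga) * exp ((2 - Re s) * ln x).
Proof.
move=> Hh Hx. have L0 := ln_ge0 x Hx. set L := ln x in L0 *.
have -> : (2 - Re s) * L = - Re s * L + 2 * L by ring.
rewrite exp_plus /pwr -/L Cmod_mult Cmod_cexp.
have -> : Re (- s * RtoC L) = - Re s * L by rewrite re_scal_r re_opp.
have P := exp_pos (- Re s * L). have E2 := exp_pos (2 * L).
have Ha := Cmod_ge_0 al. have Hb := Cmod_ge_0 be. have Hg := Cmod_ge_0 ga. have Hh0 := Cmod_ge_0 h.
have A1 := exp_ineq1_le L. have A2 := exp_pos L.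
have EL : exp (2 * L) = exp L * exp L by rewrite -exp_plus; congr exp; ring.
have EH : exp (2 * (L / 2)) = exp (L / 2) * exp (L / 2) by rewrite -exp_plus; congr exp; ring.
have A3 := exp_ineq1_le (L / 2).
have E3 : exp L = exp (L / 2) * exp (L / 2) by rewrite -EH; congr exp; field.
have LL : L * L <= 2 * exp L.
{ have A4 := exp_ineq1_le (L / 4).
  have E4 : exp (L / 2) = exp (L / 4) * exp (L / 4) by rewrite -exp_plus; congr exp; field.
  have Q : (1 + L / 4) * (1 + L / 4) <= exp (L / 2) by rewrite E4; nra.
  have Q' : ((1 + L / 4) * (1 + L / 4)) * ((1 + L / 4) * (1 + L / 4)) <= exp L by rewrite E3; nra.
  nra. }
have R : Cmod (cexp (- h * RtoC L) - 1 + h * RtoC L) <= 8 * Cmod h ^ 2 * exp (2 * L).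
{ have := cexp_taylor2 (- h * RtoC L).
  have -> : (cexp (- h * L) - 1 - - h * L = cexp (- h * L) - 1 + h * L)%C by ring.
  have -> : Cmod (- h * RtoC L) = Cmod h * L by rewrite Cmod_mult Cmod_opp Cmod_R Rabs_pos_eq.
  move=> T; apply: Rle_trans T _.
  have X : exp (Cmod h * L) <= exp L by apply: exp_le; nra.
  have X0 := exp_pos (Cmod h * L).
  have -> : 4 * (Cmod h * L) ^ 2 * exp (Cmod h * L) = 4 * Cmod h ^ 2 * ((L * L) * exp (Cmod h * L)) by ring.
  have -> : 8 * Cmod h ^ 2 * exp (2 * L) = 4 * Cmod h ^ 2 * (2 * exp L * exp L) by rewrite EL; ring.
  apply: Rmult_le_compat_l; first nra.
  apply: Rmult_le_compat; nra. }
have GL : Cmod (ga * RtoC L) <= Cmod ga * exp (2 * L).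
{ rewrite Cmod_mult Cmod_R Rabs_pos_eq //. apply: Rmult_le_compat_l => //. rewrite EL. nra. }
have BL : Cmod be <= Cmod be * exp (2 * L) by have := exp_ineq1_le (2 * L); nra.
have AL : Cmod (al * (cexp (- h * RtoC L) - 1 + h * RtoC L)) <= Cmod al * (8 * Cmod h ^ 2 * exp (2 * L)).
{ rewrite Cmod_mult. exact: Rmult_le_compat_l. }
have T1 := Cmod_triangle (al * (cexp (- h * RtoC L) - 1 + h * RtoC L) + be) (ga * RtoC L).
have T2 := Cmod_triangle (al * (cexp (- h * RtoC L) - 1 + h * RtoC L)) be.
have -> : 8 * (Cmod al * Cmod h ^ 2 + Cmod be + Cmod ga) * (exp (- Re s * L) * exp (2 * L)) = exp (- Re s * L) * (8 * (Cmod al * Cmod h ^ 2 + Cmod be + Cmod ga) * exp (2 * L)) by ring.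
apply: Rmult_le_compat_l; first lra.
have N1 : 0 <= Cmod be * exp (2 * L) by nra.
have N2 : 0 <= Cmod ga * exp (2 * L) by nra.
lra.
Qed.

(** Induction on [k] by the mean value bound on [[x, x + 1]]. The derivative has parameter [s + 1],
    so the induction hypothesis is used on the ball of radius [S0 + 1]. *)
Lemma fdiff_pwr_bound k : forall S0, 0 <= S0 -> exists K, 0 <= K /\ forall s h al be ga x,
  Cmod s <= S0 -> Cmod h <= 1 -> 1 <= x ->
  Cmod (fdiff k (pwr s h al be ga) x) <=
    K * (Cmod al * Cmod h ^ 2 + Cmod be + Cmod ga) * exp ((2 - Re s - INR k) * ln x).
Proof.
elim: k => [|k IH] S0 HS.
- exists 8; split; first lra. move=> s h al be ga x Hs Hh Hx. rewrite Rminus_0_r. exact: pwr_bound0.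
- have [K [HK0 HK]] := IH (S0 + 1) ltac:(lra).
  exists (2 * (K * (S0 + 2)) * exp (S0 + 1 + INR k)); split.
  { have := exp_pos (S0 + 1 + INR k). have : 0 <= K * (S0 + 2) by nra. nra. }
  move=> s h al be ga x Hs Hh Hx.
  set N := Cmod al * Cmod h ^ 2 + Cmod be + Cmod ga.
  have Ha := Cmod_ge_0 al. have Hb := Cmod_ge_0 be. have Hg := Cmod_ge_0 ga. have Hh0 := Cmod_ge_0 h. have Hs0 := Cmod_ge_0 s.
  have HN : 0 <= N by rewrite /N; nra.
  pose u' := pwr (s + 1) h ((- s - h) * al) (ga - s * be) (al * h * h - s * ga).
  have D : forall t, x <= t <= x + 1 -> rderiv (fdiff k (pwr s h al be ga)) t (fdiff k u' t).
  { move=> t Ht. apply: rderiv_fdiff; last lra. move=> r Hr. apply: pwr_deriv. lra. }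
  set e := (2 - Re s - INR (S k)).
  have B : forall t, x <= t <= x + 1 -> Cmod (fdiff k u' t) <= K * ((S0 + 2) * N) * (exp (S0 + 1 + INR k) * exp (e * ln x)).
  { move=> t Ht.
    have Hs1 : Cmod (s + 1) <= S0 + 1.
    { apply: Rle_trans (Cmod_triangle _ _) _. rewrite Cmod_1. lra. }
    have Ht1 : 1 <= t by lra.
    apply: Rle_trans (HK (s + 1)%C h _ _ _ t Hs1 Hh Ht1) _.
    have -> : 2 - Re (s + 1) - INR k = e by rewrite re_plus re_RtoC /e S_INR; ring.
    apply: Rmult_le_compat.
    - apply: Rmult_le_pos => //. have := Cmod_ge_0 ((- s - h) * al). have := Cmod_ge_0 (ga - s * be). have := Cmod_ge_0 (al * h * h - s * ga). nra.
    - exact: Rlt_le (exp_pos _).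
    - apply: Rmult_le_compat_l => //.
      have T1 : Cmod ((- s - h) * al) <= (S0 + 1) * Cmod al.
      { rewrite Cmod_mult. apply: Rmult_le_compat_r => //. apply: Rle_trans (Cmod_triangle _ _) _. rewrite !Cmod_opp. lra. }
      have T2 : Cmod (ga - s * be) <= Cmod ga + S0 * Cmod be.
      { apply: Rle_trans (Cmod_triangle _ _) _. rewrite Cmod_opp Cmod_mult. nra. }
      have T3 : Cmod (al * h * h - s * ga) <= Cmod al * Cmod h ^ 2 + S0 * Cmod ga.
      { apply: Rle_trans (Cmod_triangle _ _) _. rewrite Cmod_opp !Cmod_mult. nra. }
      have Hh2 : 0 <= Cmod h ^ 2 by nra.
      have T1' : Cmod ((- s - h) * al) * Cmod h ^ 2 <= (S0 + 1) * (Cmod al * Cmod h ^ 2) by nra.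
      rewrite /N. nra.
    (* The exponent [e] may have either sign; since [ln t] exceeds [ln x] by at most 1, replacing
       [t] by [x] costs at most [exp] of a bound for [Rabs e]. *)
    - rewrite -exp_plus. apply: exp_le.
      have Lx := ln_ge0 x Hx.
      have L1 : ln x <= ln t by apply: ln_le; lra.
      have L2 : ln t <= ln x + 1.
      { have -> : ln t = ln x + ln (t / x).
        { rewrite -ln_mult; [congr ln; field; lra|lra|apply: Rdiv_lt_0_compat; lra]. }
        have P : 0 < t / x by apply: Rdiv_lt_0_compat; lra.
        have : t / x <= exp 1.
        { have := exp_ineq1_le 1. have : t / x <= 2 by apply/Rle_div_l; lra. lra. }
        move=> Q. have := ln_le _ _ P Q. rewrite ln_exp. lra. }
      have He : Rabs e <= S0 + 1 + INR k.
      { have R1 := re_le_Cmod s. move: R1 => /Rabs_le_between R1. rewrite /e S_INR. apply: Rabs_le. have := pos_INR k. lra. }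
      move: He => /Rabs_le_between He. nra. }
  have := rderiv_mvt _ _ x (x + 1) _ ltac:(lra) D B.
  rewrite /=.
  have -> : Cmod (fdiff k (pwr s h al be ga) x - fdiff k (pwr s h al be ga) (x + 1)) = Cmod (fdiff k (pwr s h al be ga) (x + 1) - fdiff k (pwr s h al be ga) x).
  { rewrite -Cmod_opp. congr Cmod. ring. }
  move=> H. apply: Rle_trans H _. apply: Req_le. rewrite -/e. ring.
Qed.

Fixpoint csum (f : nat -> C) (n : nat) : C :=
  match n with O => RtoC 0 | S k => csum f k + f k end%C.

Definition clim (u : nat -> C) (l : C) : Prop :=
  forall eps, 0 < eps -> exists N, forall n, (N <= n)%nat -> Cmod (u n - l) < eps.

Lemma csum_ext f g n : (forall i, (i < n)%nat -> f i = g i) -> csum f n = csum g n.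
Proof. elim: n => [|n IH] H //=. rewrite (H n); last lia. by rewrite IH // => i Hi; apply: H; lia. Qed.

Lemma csum_plus f g n : csum (fun i => f i + g i)%C n = (csum f n + csum g n)%C.
Proof. by elim: n => [|n /= ->] /=; ring. Qed.

Lemma csum_scal c f n : csum (fun i => c * f i)%C n = (c * csum f n)%C.
Proof. by elim: n => [|n /= ->] /=; ring. Qed.

Lemma clim_unique u l l' : clim u l -> clim u l' -> l = l'.
Proof.
move=> H H'. apply: NNPP => Hne.
have P : 0 < Cmod (l - l').
{ apply/Cmod_gt_0. by apply: Cminus_eq_contra. }
have [N HN] := H (Cmod (l - l') / 2) ltac:(lra). have [N' HN'] := H' (Cmod (l - l') / 2) ltac:(lra).
have A := HN (N + N')%nat ltac:(lia). have B := HN' (N + N')%nat ltac:(lia).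
have : (l - l' = (u (N + N')%nat - l') + - (u (N + N')%nat - l))%C by ring.
move=> E. have := Cmod_triangle (u (N + N')%nat - l') (- (u (N + N')%nat - l)). rewrite -E Cmod_opp. lra.
Qed.

Lemma clim_ext u v l : (forall n, u n = v n) -> clim u l -> clim v l.
Proof. move=> E H eps He. have [N HN] := H eps He. exists N => n Hn. rewrite -E. exact: HN. Qed.

Lemma clim_const c : clim (fun _ => c) c.
Proof. move=> eps He; exists O => n _. have -> : (c - c = 0)%C by ring. by rewrite Cmod_0. Qed.

Lemma clim_plus u v a b : clim u a -> clim v b -> clim (fun n => u n + v n)%C (a + b)%C.
Proof.
move=> H H' eps He. have [N HN] := H (eps / 2) ltac:(lra). have [N' HN'] := H' (eps / 2) ltac:(lra).
exists (N + N')%nat => n Hn. have A := HN n ltac:(lia). have B := HN' n ltac:(lia).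
have -> : (u n + v n - (a + b) = (u n - a) + (v n - b))%C by ring.
have := Cmod_triangle (u n - a) (v n - b). lra.
Qed.

Lemma clim_scal c u a : clim u a -> clim (fun n => c * u n)%C (c * a)%C.
Proof.
move=> H eps He. have P := Cmod_ge_0 c.
have [N HN] := H (eps / (Cmod c + 1)) ltac:(apply: Rdiv_lt_0_compat; lra).
exists N => n Hn. have -> : (c * u n - c * a = c * (u n - a))%C by ring.
rewrite Cmod_mult. have A := HN n Hn. have Q := Cmod_ge_0 (u n - a).
have : Cmod (u n - a) * (Cmod c + 1) < eps.
{ have := Rmult_lt_compat_r (Cmod c + 1) _ _ ltac:(lra) A. rewrite /Rdiv Rmult_assoc Rinv_l; lra. }
nra.
Qed.

Lemma clim_le u l M : clim u l -> (forall n, Cmod (u n) <= M) -> Cmod l <= M.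
Proof.
move=> H HM. apply: Rnot_lt_le => Hlt.
have [N HN] := H (Cmod l - M) ltac:(lra).
have A := HN N (le_n N). have B := HM N.
have E : (l = u N + - (u N - l))%C by ring.
have := Cmod_triangle (u N) (- (u N - l)). rewrite -E Cmod_opp. lra.
Qed.

Lemma csum_norm_le f K n : (forall i, Cmod (f i) <= K * (/ INR (S i) - / INR (S (S i)))) ->
  Cmod (csum f n) <= K * (1 - / INR (S n)).
Proof.
move=> H; elim: n => [|n IH]; first by rewrite /= Cmod_0 Rinv_1; lra.
change (csum f (S n)) with (csum f n + f n)%C.
apply: Rle_trans (Cmod_triangle _ _) _. have := H n. lra.
Qed.

Lemma csum_abs_conv f K : 0 <= K -> (forall i, Cmod (f i) <= K * (/ INR (S i) - / INR (S (S i)))) ->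
  exists l, clim (csum f) l /\ Cmod l <= K.
Proof.
move=> HK H.
have inv0 : forall n, 0 < / INR (S n) by move=> n; apply: Rinv_0_lt_compat; apply: lt_0_INR; lia.
have key : forall p : C -> R, (forall a b, p (a + b)%C = p a + p b) -> p (RtoC 0) = 0 -> (forall a, Rabs (p a) <= Cmod a) ->
  exists r : R, forall eps, 0 < eps -> exists N, forall n, (N <= n)%nat -> Rabs (p (csum f n) - r) < eps.
{ move=> p pD p0 pC.
  (* Adding the telescoping majorant makes the partial sums increasing and bounded, so they converge
     by monotonicity. *)
  pose v n := p (csum f n) + K * (1 - / INR (S n)).
  have [r Hr] : ex_finite_lim_seq v.
  { apply: (ex_finite_lim_seq_incr _ (K + K)).
    - move=> n. rewrite /v /= pD. have A := H n. have B := pC (f n). move: (Rle_trans _ _ _ B A) => /Rabs_le_between. rewrite /=. lra.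
    - move=> n. rewrite /v. have A := csum_norm_le f K n H. have B := pC (csum f n).
      move: (Rle_trans _ _ _ B A) => /Rabs_le_between. have := inv0 n. nra. }
  have Hi : is_lim_seq (fun n => K * (1 - / INR (S n))) K.
  { have E : K = K * (1 - 0) by ring. rewrite {2}E.
    have L1 : is_lim_seq (fun n => / INR (S n)) 0.
    { apply: (is_lim_seq_inv _ p_infty) => //. exact: (proj1 (is_lim_seq_incr_1 INR p_infty) is_lim_seq_INR). }
    apply: (is_lim_seq_scal_l _ K (Finite (1 - 0))). apply: is_lim_seq_minus'; [exact: is_lim_seq_const|exact: L1]. }
  have Hp : is_lim_seq (fun n => p (csum f n)) (r - K).
  { apply: (is_lim_seq_ext (fun n => v n - K * (1 - / INR (S n)))); first by move=> n; rewrite /v; ring.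
    exact: is_lim_seq_minus'. }
  exists (r - K) => eps He. move/is_lim_seq_spec: Hp => Hp. exact: (Hp (mkposreal eps He)). }
have [a Ha] := key Re re_plus (re_RtoC 0) re_le_Cmod.
have [b Hb] := key Im im_plus (im_RtoC 0) im_le_Cmod.
have L : clim (csum f) (a, b).
{ move=> eps He. have [N HN] := Ha (eps / 2) ltac:(lra). have [N' HN'] := Hb (eps / 2) ltac:(lra).
  exists (N + N')%nat => n Hn. have A := HN n ltac:(lia). have B := HN' n ltac:(lia).
  apply: Rle_lt_trans (Cmod_le_abs _) _. rewrite /Cminus re_plus im_plus re_opp im_opp. rewrite /Rminus in A B. rewrite /Re /Im /= in A B *. lra. }
exists (a, b); split=> //. apply: clim_le L _ => n.
apply: Rle_trans (csum_norm_le f K n H) _. have := inv0 n. nra.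
Qed.

Lemma cderiv_quadratic (f : C -> C) (s l : C) (K : R) : 0 <= K ->
  (forall h, Cmod h <= 1 -> Cmod (f (s + h) - f s - h * l)%C <= K * Cmod h ^ 2) -> cderiv f s l.
Proof.
move=> HK H eps He.
exists (Rmin 1 (eps / (K + 1))); split.
{ apply: Rmin_pos; [lra|apply: Rdiv_lt_0_compat; lra]. }
move=> w Hw. have H1 := Rmin_l 1 (eps / (K + 1)); have H2 := Rmin_r 1 (eps / (K + 1)).
have := H (w - s)%C ltac:(lra). have -> : (s + (w - s) = w)%C by ring.
move=> A. apply: Rle_trans A _. have P := Cmod_ge_0 (w - s).
have : Cmod (w - s) * (K + 1) < eps.
{ have H3 : Cmod (w - s) < eps / (K + 1) by lra. have := Rmult_lt_compat_r (K + 1) _ _ ltac:(lra) H3. rewrite /Rdiv Rmult_assoc Rinv_l; lra. }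
nra.
Qed.

Definition climv (u : nat -> C) : C := epsilon (inhabits (RtoC 0)) (clim u).

Lemma climvP u l : clim u l -> climv u = l.
Proof.
move=> H. apply: (clim_unique u) => //. apply: (epsilon_spec (inhabits (RtoC 0)) (clim u)). by exists l.
Qed.

Section GeometricTwist.
Variable th : C.
Hypothesis th1 : th <> RtoC 1.
Hypothesis thm : Cmod th = 1.

(** The Abel sum of [th + th^2 + th^3 + ...], which is the factor produced by each summation by
    parts. *)
Definition sbpc : C := (th / (1 - th))%C.

Lemma one_sub_th : (1 - th)%C <> RtoC 0.
Proof. by apply: Cminus_eq_contra => H; apply: th1. Qed.

Lemma sum_by_parts (v : nat -> C) N :
  csum (fun n => th ^ (S n) * v n)%C N =
  (sbpc * v O - sbpc * csum (fun n => th ^ (S n) * (v n - v (S n))) N - sbpc * th ^ N * v N)%C.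
Proof.
elim: N => [|N IH]; first by rewrite /= ; ring.
change (csum (fun n => th ^ (S n) * v n)%C (S N)) with (csum (fun n => th ^ (S n) * v n)%C N + th ^ (S N) * v N)%C.
change (csum (fun n => th ^ (S n) * (v n - v (S n)))%C (S N)) with (csum (fun n => th ^ (S n) * (v n - v (S n)))%C N + th ^ (S N) * (v N - v (S N)))%C.
rewrite IH /sbpc Cpow_S. field. exact: one_sub_th.
Qed.

Lemma Cmod_thn n : Cmod (th ^ n) = 1.
Proof. by rewrite Cmod_pow thm pow1. Qed.

Lemma sum_by_parts_lim (v : nat -> C) l : clim v (RtoC 0) ->
  clim (csum (fun n => th ^ (S n) * (v n - v (S n)))%C) l ->
  clim (csum (fun n => th ^ (S n) * v n)%C) (sbpc * v O - sbpc * l)%C.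
Proof.
move=> Hv Hl.
apply: (clim_ext _ _ _ (fun n => eq_sym (sum_by_parts v n))).
have T : clim (fun n => th ^ n * v n)%C (RtoC 0).
{ move=> eps He. have [N HN] := Hv eps He. exists N => n Hn. have := HN n Hn.
  have -> : (th ^ n * v n - 0 = th ^ n * (v n - 0))%C by ring. by rewrite Cmod_mult Cmod_thn Rmult_1_l. }
have := clim_plus _ _ _ _ (clim_plus _ _ _ _ (clim_const (sbpc * v O)%C) (clim_scal (- sbpc)%C _ _ Hl)) (clim_scal (- sbpc)%C _ _ T).
have -> : (sbpc * v O + - sbpc * l + - sbpc * 0 = sbpc * v O - sbpc * l)%C by ring.
apply: clim_ext => n. ring.
Qed.

(** These two are [x^(-s)] and its derivative in [s], [- ln x * x^(-s)], written as members of the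
    family [pwr] so that [fdiff_pwr_bound] covers both. *)
Definition ptpow (s : C) : R -> C := pwr s 0 0 1 0.
Definition dptpow (s : C) : R -> C := pwr s 0 0 0 (- (1))%C.

Lemma ptpowE s x : ptpow s x = cexp (- s * RtoC (ln x))%C.
Proof. rewrite /ptpow /pwr. ring. Qed.

Definition tdiff (k : nat) (s : C) : nat -> C := csum (fun n => th ^ (S n) * fdiff k (ptpow s) (INR (S n)))%C.
Definition tdiffv (k : nat) (s : C) : C := climv (tdiff k s).
Definition tddiff (k : nat) (s : C) : nat -> C := csum (fun n => th ^ (S n) * fdiff k (dptpow s) (INR (S n)))%C.
(** Boundary terms collected by [k] summations by parts of the series of [th ^ n * n^(-s)]. What
    remains is [(- sbpc) ^ k] times the twisted series of [k]-th differences, absolutely convergent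
    once [4 <= Re s + INR k]; [tcont] adds the two. *)
Fixpoint tpoly (k : nat) (s : C) : C :=
  match k with O => 0 | S j => tpoly j s + (- sbpc) ^ j * sbpc * fdiff j (ptpow s) 1 end%C.
Definition tcont (k : nat) (s : C) : C := (tpoly k s + (- sbpc) ^ k * tdiffv k s)%C.

Lemma INR_S_ge1 n : 1 <= INR (S n).
Proof. rewrite S_INR. have := pos_INR n. lra. Qed.

Lemma decay_bound e n : e <= -2 -> exp (e * ln (INR (S n))) <= 2 * (/ INR (S n) - / INR (S (S n))).
Proof.
move=> He. have H1 := INR_S_ge1 n. have L := ln_ge0 _ H1.
apply: Rle_trans (_ : exp (-2 * ln (INR (S n))) <= _).
{ apply: exp_le. nra. }
have -> : -2 * ln (INR (S n)) = - ln (INR (S n)) + - ln (INR (S n)) by ring.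
rewrite exp_plus exp_Ropp exp_ln; last lra.
rewrite (S_INR (S n)). set x := INR (S n) in H1 *.
have -> : / x - / (x + 1) = / x * / (x + 1) by field; lra.
have P : 0 < / x by apply: Rinv_0_lt_compat; lra.
have : / x <= 2 * / (x + 1).
{ have -> : 2 * / (x + 1) = / ((x + 1) / 2) by field; lra. apply: Rinv_le_contravar; lra. }
nra.
Qed.

Lemma tsum_conv k s h al be ga : 4 <= Re s + INR k -> Cmod h <= 1 ->
  forall K, (forall x, 1 <= x -> Cmod (fdiff k (pwr s h al be ga) x) <= K * exp ((2 - Re s - INR k) * ln x)) -> 0 <= K ->
  exists l, clim (csum (fun n => th ^ (S n) * fdiff k (pwr s h al be ga) (INR (S n)))%C) l /\ Cmod l <= 2 * K.
Proof.
move=> Hk Hh K HK HK0. apply: csum_abs_conv; first lra.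
move=> i. rewrite Cmod_mult Cmod_thn Rmult_1_l.
apply: Rle_trans (HK _ (INR_S_ge1 i)) _.
have := decay_bound (2 - Re s - INR k) i ltac:(lra). nra.
Qed.

Lemma tdiff_conv k s : 4 <= Re s + INR k -> clim (tdiff k s) (tdiffv k s).
Proof.
move=> Hk. have [K [HK0 HK]] := fdiff_pwr_bound k (Cmod s) (Cmod_ge_0 s).
have H0 : Cmod (RtoC 0) <= 1 by rewrite Cmod_0; lra.
have [l [Hl _]] := tsum_conv k s 0 0 1 0 Hk H0 _ (fun x Hx => HK s 0 0 1 0 x (Rle_refl _) H0 Hx)%C
  ltac:(rewrite Cmod_0 Cmod_1; nra).
by rewrite /tdiffv (climvP _ _ Hl).
Qed.

Lemma ptpow_to0 s : 0 < Re s -> clim (fun n => ptpow s (INR (S n))) (RtoC 0).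
Proof.
move=> Hs eps He.
have [N HN] := INR_unbounded (exp (- ln eps / Re s)).
exists N => n Hn.
have -> : (ptpow s (INR (S n)) - 0 = ptpow s (INR (S n)))%C by ring.
rewrite ptpowE Cmod_cexp re_scal_r re_opp.
have P := exp_pos (- ln eps / Re s).
have Hx : exp (- ln eps / Re s) < INR (S n) by rewrite S_INR; have := le_INR _ _ Hn; lra.
have := ln_increasing _ _ P Hx. rewrite ln_exp => HL.
rewrite -[X in _ < X](exp_ln eps) //. apply: exp_increasing.
have := Rmult_lt_compat_r _ _ _ Hs HL. rewrite /Rdiv Rmult_assoc Rinv_l; lra.
Qed.

Lemma clim_shift u l : clim u l -> clim (fun n => u (S n)) l.
Proof. move=> H eps He. have [N HN] := H eps He. exists N => n Hn; apply: HN; lia. Qed.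

Lemma fdiff_ptpow_to0 k s : 0 < Re s -> clim (fun n => fdiff k (ptpow s) (INR (S n))) (RtoC 0).
Proof.
move=> Hs; elim: k => [|k IH]; first exact: ptpow_to0.
have := clim_plus _ _ _ _ IH (clim_scal (- (1))%C _ _ (clim_shift _ _ IH)).
have -> : (0 + - (1) * 0 = 0)%C by ring.
apply: clim_ext => n. rewrite fdiffS -S_INR. ring.
Qed.

(** Counterpart of [fdiff_ptpow_to0] for arbitrary [Re s], when the order of the difference is high
    enough. This version compares neighbouring levels of [tcont]; the other one descends to the
    original series. *)
Lemma fdiff_decay_to0 k s : 4 <= Re s + INR k -> clim (fun n => fdiff k (ptpow s) (INR (S n))) (RtoC 0).
Proof.
move=> Hk.
have [K [HK0 HK]] := fdiff_pwr_bound k (Cmod s) (Cmod_ge_0 s).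
move=> eps He.
have [N HN] := INR_unbounded (2 * K / eps).
exists N => n Hn.
have -> : (fdiff k (ptpow s) (INR (S n)) - 0 = fdiff k (ptpow s) (INR (S n)))%C by ring.
have H0 : Cmod (RtoC 0) <= 1 by rewrite Cmod_0; lra.
have := HK s 0%C 0%C 1%C 0%C _ (Rle_refl _) H0 (INR_S_ge1 n).
have -> : Cmod 0 * Cmod 0 ^ 2 + Cmod 1 + Cmod 0 = 1 by rewrite Cmod_0 Cmod_1; ring.
move=> B. apply: Rle_lt_trans B _.
have D := decay_bound (2 - Re s - INR k) n ltac:(lra).
have H1 := INR_S_ge1 n.
have P1 : 0 < / INR (S (S n)) by apply: Rinv_0_lt_compat; have := INR_S_ge1 (S n); lra.
have Hx : 2 * K / eps < INR (S n) by rewrite S_INR; have := le_INR _ _ Hn; lra.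
have : 2 * K * / INR (S n) < eps.
{ apply/Rlt_div_l; first lra. have := Rmult_lt_compat_r _ _ _ He Hx. rewrite /Rdiv Rmult_assoc Rinv_l; lra. }
nra.
Qed.

Lemma tdiff_step k s l : clim (fun n => fdiff k (ptpow s) (INR (S n))) (RtoC 0) ->
  clim (tdiff (S k) s) l -> clim (tdiff k s) (sbpc * fdiff k (ptpow s) 1 - sbpc * l)%C.
Proof.
move=> H0 Hl.
have := sum_by_parts_lim (fun n => fdiff k (ptpow s) (INR (S n))) l H0.
rewrite INR_1 /tdiff. apply.
apply: (clim_ext _ _ _ _ Hl) => n; apply: csum_ext => i _.
by rewrite fdiffS -S_INR.
Qed.

Lemma tcont_step k s : 4 <= Re s + INR k -> tcont (S k) s = tcont k s.
Proof.
move=> Hk.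
have Hk1 : 4 <= Re s + INR (S k) by rewrite S_INR; lra.
have := tdiff_step k s _ (fdiff_decay_to0 k s Hk) (tdiff_conv (S k) s Hk1).
move=> H. have {H} E := clim_unique _ _ _ (tdiff_conv k s Hk) H.
rewrite /tcont E /=. ring.
Qed.

Lemma tcont_stable k j s : 4 <= Re s + INR k -> tcont (k + j) s = tcont k s.
Proof.
move=> Hk; elim: j => [|j IH]; first by rewrite Nat.add_0_r.
rewrite Nat.add_succ_r tcont_step // plus_INR. have := pos_INR j. lra.
Qed.

(** The 5 exceeds the 4 needed for convergence by one unit, so that the level chosen at [s] serves
    the whole disc of radius 1 around [s], on which the derivative is taken. *)
Definition klevel (s : C) : nat := Z.to_nat (up (5 - Re s)).

Lemma klevelP s : 5 <= Re s + INR (klevel s).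
Proof.
have [A _] := archimed (5 - Re s).
have : IZR (up (5 - Re s)) <= INR (klevel s).
{ rewrite INR_IZR_INZ. apply: IZR_le. rewrite /klevel. lia. }
lra.
Qed.

Definition twist_cont (s : C) : C := tcont (klevel s) s.

Lemma twist_contE k s : 4 <= Re s + INR k -> twist_cont s = tcont k s.
Proof.
move=> Hk. have Hk' := klevelP s. rewrite /twist_cont.
case: (Nat.le_ge_cases (klevel s) k) => H.
- have -> : (k = klevel s + (k - klevel s))%nat by lia. rewrite tcont_stable //. lra.
- have -> : (klevel s = k + (klevel s - k))%nat by lia. by rewrite tcont_stable.
Qed.

(** Descending from an absolutely convergent level gives the conditional convergence of the original
    series on the whole half-plane [0 < Re s], hence at 1/2. *)
Lemma tdiff_down k s l : 0 < Re s -> clim (tdiff k s) l -> clim (tdiff 0 s) (tpoly k s + (- sbpc) ^ k * l)%C.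
Proof.
move=> Hs; elim: k l => [|k IH] l Hl.
- have -> // : (tpoly 0 s + (- sbpc) ^ 0 * l = l)%C by rewrite /=; ring.
- have := IH _ (tdiff_step k s l (fdiff_ptpow_to0 k s Hs) Hl).
  have -> // : (tpoly k s + (- sbpc) ^ k * (sbpc * fdiff k (ptpow s) 1 - sbpc * l) = tpoly (S k) s + (- sbpc) ^ S k * l)%C.
  rewrite /=. ring.
Qed.

Lemma twist_cont_series s : 0 < Re s ->
  clim (csum (fun n => th ^ (S n) * cpow_neg (S n) s)%C) (twist_cont s).
Proof.
move=> Hs. have Hk := klevelP s.
have := tdiff_down (klevel s) s _ Hs (tdiff_conv (klevel s) s ltac:(lra)).
apply: clim_ext => n; apply: csum_ext => i _. by rewrite [fdiff 0 _ _]/= ptpowE cpow_neg_cexp.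
Qed.

Lemma ptpow_taylor s h x :
  (ptpow (s + h) x = ptpow s x + h * dptpow s x + pwr s h 1 0 0 x)%C.
Proof.
rewrite ptpowE /ptpow /dptpow /pwr.
have -> : (- (s + h) * ln x = - s * ln x + - h * ln x)%C by ring.
rewrite cexp_add. ring.
Qed.

Lemma fdiff_taylor k s h x :
  fdiff k (ptpow (s + h)) x = (fdiff k (ptpow s) x + h * fdiff k (dptpow s) x + fdiff k (pwr s h 1 0 0) x)%C.
Proof.
rewrite (fdiff_ext k _ (fun t => (ptpow s t + h * dptpow s t) + pwr s h 1 0 0 t)%C); last exact: ptpow_taylor.
by rewrite !fdiff_plus fdiff_scal.
Qed.

Lemma cderiv_fdiff_at1 k s : exists l, cderiv (fun s => fdiff k (ptpow s) 1) s l.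
Proof.
have [K [HK0 HK]] := fdiff_pwr_bound k (Cmod s) (Cmod_ge_0 s).
exists (fdiff k (dptpow s) 1). apply: (cderiv_quadratic _ _ _ K) => // h Hh.
rewrite fdiff_taylor.
have -> : (fdiff k (ptpow s) 1 + h * fdiff k (dptpow s) 1 + fdiff k (pwr s h 1 0 0) 1 - fdiff k (ptpow s) 1 - h * fdiff k (dptpow s) 1 = fdiff k (pwr s h 1 0 0) 1)%C by ring.
have := HK s h 1%C 0%C 0%C 1 (Rle_refl _) Hh (Rle_refl _).
rewrite ln_1 Rmult_0_r exp_0 Cmod_1 Cmod_0. lra.
Qed.

Lemma cderiv_tpoly k s : exists l, cderiv (tpoly k) s l.
Proof.
elim: k => [|k [l IH]]; first by exists (RtoC 0); apply: cderiv_const.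
have [l' Hl'] := cderiv_fdiff_at1 k s.
eexists. exact: (cderiv_plus _ _ _ _ _ IH (cderiv_scal ((- sbpc) ^ k * sbpc)%C _ _ _ Hl')).
Qed.

(** Taylor expansion in [s] term by term: the remainders lie in the same family [pwr], hence sum
    absolutely to [O(Cmod h ^ 2)], and no theorem on uniform limits of holomorphic functions is
    required. *)
Lemma tdiffv_taylor k s : 5 <= Re s + INR k -> exists l K, 0 <= K /\ forall h, Cmod h <= 1 ->
  Cmod (tdiffv k (s + h) - tdiffv k s - h * l)%C <= K * Cmod h ^ 2.
Proof.
move=> Hk.
have [K [HK0 HK]] := fdiff_pwr_bound k (Cmod s) (Cmod_ge_0 s).
have H0 : Cmod (RtoC 0) <= 1 by rewrite Cmod_0; lra.
have Hk4 : 4 <= Re s + INR k by lra.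
have [l [Hl _]] : exists l, clim (tddiff k s) l /\ Cmod l <= 2 * K.
{ apply: (tsum_conv k s 0 0 0 (- (1))%C Hk4 H0 K) => //.
  move=> x Hx. have := HK s 0%C 0%C 0%C (- (1))%C x (Rle_refl _) H0 Hx.
  rewrite Cmod_opp Cmod_0 Cmod_1. lra. }
exists l, (2 * K); split; first lra.
move=> h Hh.
have [e [He1 He2]] : exists e, clim (csum (fun n => th ^ (S n) * fdiff k (pwr s h 1 0 0) (INR (S n)))%C) e /\ Cmod e <= 2 * (K * Cmod h ^ 2).
{ apply: (tsum_conv k s h 1 0 0 Hk4 Hh).
  - move=> x Hx. have := HK s h 1%C 0%C 0%C x (Rle_refl _) Hh Hx. rewrite Cmod_0 Cmod_1 Rmult_1_l !Rplus_0_r. done.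
  - have := pow2_ge_0 (Cmod h). nra. }
have Hk4' : 4 <= Re (s + h) + INR k.
{ rewrite re_plus. have := re_le_Cmod h. move/Rabs_le_between. lra. }
have E : tdiffv k (s + h) = (tdiffv k s + h * l + e)%C.
{ apply: (clim_unique (tdiff k (s + h)%C)); first exact: tdiff_conv.
  have := clim_plus _ _ _ _ (clim_plus _ _ _ _ (tdiff_conv k s Hk4) (clim_scal h _ _ Hl)) He1.
  apply: clim_ext => n. rewrite /tdiff /tddiff -csum_scal -!csum_plus. apply: csum_ext => i _.
  rewrite fdiff_taylor. ring. }
rewrite E. have -> : (tdiffv k s + h * l + e - tdiffv k s - h * l = e)%C by ring.
lra.
Qed.

Lemma twist_cont_cderiv s : exists l, cderiv twist_cont s l.
Proof.
pose k := klevel s. have Hk := klevelP s.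
have [l [K [HK0 HK]]] := tdiffv_taylor k s Hk.
have D1 : cderiv (tdiffv k) s l := cderiv_quadratic _ _ _ _ HK0 HK.
have [l' D2] := cderiv_tpoly k s.
have D := cderiv_plus _ _ _ _ _ D2 (cderiv_scal ((- sbpc) ^ k)%C _ _ _ D1).
eexists => eps He. have [d [Hd Hd']] := D eps He.
exists (Rmin 1 d); split; first by apply: Rmin_pos; lra.
move=> w Hw. have M1 := Rmin_l 1 d; have M2 := Rmin_r 1 d.
have Hws : 4 <= Re w + INR k.
{ have := re_le_Cmod (w - s). rewrite /Cminus re_plus re_opp. move=> /Rabs_le_between. rewrite -/(Cminus w s) /k. lra. }
rewrite (twist_contE k w Hws) (twist_contE k s); last by rewrite /k; lra.
apply: Hd'. lra.
Qed.

End GeometricTwist.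

End Analysis.

(** * Primitive roots modulo a prime *)

Module PrimitiveRoot.
Import all_boot all_algebra all_fingroup zify cyclic.
Set Implicit Arguments.
Unset Strict Implicit.
Unset Printing Implicit Defensive.
Import GRing.Theory.

Lemma primitive_root q : prime.prime q -> exists g, coprime g q /\
  forall a, coprime a q -> exists k, (k < q.-1)%N /\ g ^ k = a %[mod q].
Proof.
move=> pr_q. have q1 := prime_gt1 pr_q.
have [u Hu] := cyclicP (field_unit_group_cyclic [set: {unit 'F_q}]%G).
have ord_u : #[u]%g = q.-1.
{ rewrite orderE -Hu /= card_finField_unit card_Fp //. }
pose g : nat := val u.
have gE : (g%:R = val u :> 'F_q)%R by rewrite /g natr_Zp.
have valFp : forall n, nat_of_ord (n%:R : 'F_q)%R = (n %% q)%N by move=> n; rewrite val_Fp_nat.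
have unitP : forall n, ((n%:R : 'F_q) \is a GRing.unit)%R = coprime n q.
{ move=> n. by rewrite unitfE -val_eqE /= valFp coprime_sym prime_coprime. }
exists g; split; first by rewrite -unitP gE (valP u).
move=> a Ha. rewrite -unitP in Ha.
pose x : {unit 'F_q} := FinRing.Unit Ha.
have : x \in <[u]>%g by rewrite -Hu inE.
move=> /cyclePmin[k Hk Ex]. exists k; split; first by rewrite -ord_u.
have : (val x = val (u ^+ k)%g) by rewrite Ex.
rewrite FinRing.val_unitX /= -gE -natrX => /(congr1 (@nat_of_ord _)).
by rewrite !valFp.
Qed.

Lemma prime_Z_nat q : Znumtheory.prime (BinInt.Z.of_nat q) -> prime.prime q.
Proof.
move=> [H1 H2]. apply/primeP. have q1 : (1 < q)%N by lia. split=> // d /dvdnP[k Ek].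
apply/orP. case: (ltngtP d 1) => [|d1|->]; [|right|by left].
- move=> d0. have {}d0 : d = 0%N by lia. subst d. rewrite muln0 in Ek. lia.
- case: (ltngtP d q) => // [dq|dq].
  + have := H2 (BinInt.Z.of_nat d) ltac:(lia). case=> _ _ H3.
    have Dq : BinInt.Z.divide (BinInt.Z.of_nat d) (BinInt.Z.of_nat q) by exists (BinInt.Z.of_nat k); rewrite Ek; lia.
    have := BinInt.Z.divide_1_r_nonneg (BinInt.Z.of_nat d) ltac:(lia) (H3 _ (BinInt.Z.divide_refl _) Dq). lia.
  + have : (d <= q)%N by apply: dvdn_leq; [lia|apply/dvdnP; exists k]. lia.
Qed.

End PrimitiveRoot.

Module DirichletMoments.
Import all_boot zify cyclic.
Import Analysis PrimitiveRoot.
Set Implicit Arguments.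
Unset Strict Implicit.
Unset Printing Implicit Defensive.
Open Scope R_scope.
Delimit Scope R_scope with R.
#[local] Arguments INR : simpl never.

(** * Finite sums *)

Lemma CplusA : associative Cplus. Proof. exact: Cplus_assoc. Qed.
Lemma RplusA : associative Rplus. Proof. by move=> x y z; rewrite Rplus_assoc. Qed.
Lemma RmultA : associative Rmult. Proof. by move=> x y z; rewrite Rmult_assoc. Qed.
HB.instance Definition _ := Monoid.isComLaw.Build C (RtoC 0) Cplus CplusA Cplus_comm Cplus_0_l.
HB.instance Definition _ := Monoid.isComLaw.Build C (RtoC 1) Cmult Cmult_assoc Cmult_comm Cmult_1_l.
HB.instance Definition _ := Monoid.isMulLaw.Build C (RtoC 0) Cmult Cmult_0_l Cmult_0_r.
HB.instance Definition _ := Monoid.isAddLaw.Build C Cmult Cplus Cmult_plus_distr_r Cmult_plus_distr_l.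
HB.instance Definition _ := Monoid.isComLaw.Build R 0 Rplus RplusA Rplus_comm Rplus_0_l.
HB.instance Definition _ := Monoid.isComLaw.Build R 1 Rmult RmultA Rmult_comm Rmult_1_l.
HB.instance Definition _ := Monoid.isMulLaw.Build R 0 Rmult Rmult_0_l Rmult_0_r.
HB.instance Definition _ := Monoid.isAddLaw.Build R Rmult Rplus Rmult_plus_distr_r Rmult_plus_distr_l.

Reserved Notation "\csum_ ( i < n ) F" (at level 41, F at level 41, i, n at level 50, format "\csum_ ( i  <  n )  F").
Reserved Notation "\csum_ ( m <= i < n ) F" (at level 41, F at level 41, i, m, n at level 50).
Reserved Notation "\csum_ ( i < n | P ) F" (at level 41, F at level 41, i, n at level 50).
Reserved Notation "\csum_ ( i : t | P ) F" (at level 41, F at level 41, i at level 50).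
Reserved Notation "\csum_ ( i | P ) F" (at level 41, F at level 41, i at level 50).
Reserved Notation "\rsum_ ( i < n ) F" (at level 41, F at level 41, i, n at level 50, format "\rsum_ ( i  <  n )  F").
Reserved Notation "\rsum_ ( m <= i < n ) F" (at level 41, F at level 41, i, m, n at level 50).
Reserved Notation "\rsum_ ( i < n | P ) F" (at level 41, F at level 41, i, n at level 50).
Reserved Notation "\rsum_ ( i : t | P ) F" (at level 41, F at level 41, i at level 50).
Reserved Notation "\rsum_ ( i | P ) F" (at level 41, F at level 41, i at level 50).
Notation "\csum_ ( i < n ) F" := (\big[Cplus/RtoC 0%R]_(i < n) F%C) : R_scope.
Notation "\csum_ ( m <= i < n ) F" := (\big[Cplus/RtoC 0%R]_(m <= i < n) F%C) : R_scope.
Notation "\csum_ ( i < n | P ) F" := (\big[Cplus/RtoC 0%R]_(i < n | P%B) F%C) : R_scope.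
Notation "\csum_ ( i : t | P ) F" := (\big[Cplus/RtoC 0%R]_(i : t | P%B) F%C) (only parsing) : R_scope.
Notation "\csum_ ( i | P ) F" := (\big[Cplus/RtoC 0%R]_(i | P%B) F%C) : R_scope.
Notation "\rsum_ ( i < n ) F" := (\big[Rplus/0%R]_(i < n) F%R) : R_scope.
Notation "\rsum_ ( m <= i < n ) F" := (\big[Rplus/0%R]_(m <= i < n) F%R) : R_scope.
Notation "\rsum_ ( i < n | P ) F" := (\big[Rplus/0%R]_(i < n | P%B) F%R) : R_scope.
Notation "\rsum_ ( i : t | P ) F" := (\big[Rplus/0%R]_(i : t | P%B) F%R) (only parsing) : R_scope.
Notation "\rsum_ ( i | P ) F" := (\big[Rplus/0%R]_(i | P%B) F%R) : R_scope.

Section BigSums.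
Variables (I : Type) (r : seq I) (P : pred I).

Lemma Cmod_csum (F : I -> C) :
  Cmod (\big[Cplus/RtoC 0]_(i <- r | P i) F i) <= \big[Rplus/0]_(i <- r | P i) Cmod (F i).
Proof.
elim/big_rec2: _ => [|i x y _ H]; first by rewrite Cmod_0; lra.
apply: Rle_trans (Cmod_triangle _ _) _. lra.
Qed.

Lemma rsum_le (F G : I -> R) : (forall i, P i -> F i <= G i) ->
  \big[Rplus/0]_(i <- r | P i) F i <= \big[Rplus/0]_(i <- r | P i) G i.
Proof.
move=> H; elim/big_rec2: _ => [|i x y Pi Hxy]; first lra. by have := H i Pi; lra.
Qed.

Lemma rsum_ge0 (F : I -> R) : (forall i, P i -> 0 <= F i) -> 0 <= \big[Rplus/0]_(i <- r | P i) F i.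
Proof. by move=> H; elim/big_rec: _ => [|i x Pi Hx]; [lra|have := H i Pi; lra]. Qed.

Lemma csum_conj (F : I -> C) :
  Cconj (\big[Cplus/RtoC 0]_(i <- r | P i) F i) = \big[Cplus/RtoC 0]_(i <- r | P i) Cconj (F i).
Proof.
by apply: big_morph => [x y|]; [exact: Cplus_conj|rewrite /Cconj /= Ropp_0].
Qed.

Lemma csum_RtoC (F : I -> R) :
  RtoC (\big[Rplus/0]_(i <- r | P i) F i) = \big[Cplus/RtoC 0]_(i <- r | P i) RtoC (F i).
Proof. by apply: big_morph => [x y|]; [exact: RtoC_plus|]. Qed.

Lemma csum_minus (F G : I -> C) :
  \big[Cplus/RtoC 0]_(i <- r | P i) (F i - G i)%C =
  (\big[Cplus/RtoC 0]_(i <- r | P i) F i - \big[Cplus/RtoC 0]_(i <- r | P i) G i)%C.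
Proof.
elim/big_rec3: _ => [|i x y z _ ->]; ring.
Qed.

End BigSums.

Lemma csum_big f n : csum f n = \csum_(i < n) f i.
Proof. by elim: n => [|n IH] /=; rewrite ?big_ord0 // big_ord_recr /= IH. Qed.

Lemma rsum_const n c : \rsum_(i < n) c = INR n * c.
Proof.
elim: n => [|n IH]; first by rewrite big_ord0 INR_0; ring.
rewrite big_ord_recr IH S_INR /=; ring.
Qed.

Lemma csum_const n c : \csum_(i < n) c = (RtoC (INR n) * c)%C.
Proof.
elim: n => [|n IH]; first by rewrite big_ord0 INR_0; ring.
rewrite big_ord_recr IH S_INR RtoC_plus /=; ring.
Qed.

Lemma rsum_nat_const (m n : nat) (c : R) : (m <= n)%N -> \rsum_(m <= i < n) c = INR (n - m)%N * c.
Proof. by move=> H; rewrite -[m in LHS]add0n big_addn big_mkord rsum_const. Qed.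

Lemma rsum_sub_le (I : finType) (A B : pred I) (F : I -> R) : (forall i, 0 <= F i) ->
  (forall i, A i -> B i) -> \rsum_(i | A i) F i <= \rsum_(i | B i) F i.
Proof.
move=> F0 AB. rewrite [X in _ <= X](bigID A) /=.
have -> : \rsum_(i | B i && A i) F i = \rsum_(i | A i) F i.
{ apply: eq_bigl => i. by case E : (A i); rewrite ?andbF // AB. }
have := @rsum_ge0 _ (index_enum I) (fun i => B i && ~~ A i) F (fun i _ => F0 i). lra.
Qed.

Lemma cauchy_schwarz (I : finType) (P : pred I) (a b : I -> R) :
  (forall i, 0 <= a i) -> (forall i, 0 <= b i) ->
  (\rsum_(i | P i) (a i * b i)) ^ 2 <= (\rsum_(i | P i) a i ^ 2) * (\rsum_(i | P i) b i ^ 2).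
Proof.
move=> a0 b0.
set A := \rsum_(i | P i) a i ^ 2; set B := \rsum_(i | P i) b i ^ 2; set D := \rsum_(i | P i) (a i * b i).
have Q : forall x y, 0 <= x ^ 2 * A + y ^ 2 * B - 2 * x * y * D.
{ move=> x y.
  have -> : x ^ 2 * A + y ^ 2 * B - 2 * x * y * D = \rsum_(i | P i) (x * a i - y * b i) ^ 2.
  { rewrite /A /B /D.
    elim: (index_enum I) => [|i r IH]; first by rewrite !big_nil; ring.
    rewrite !big_cons; case: (P i) => //. rewrite -IH /=. ring. }
  apply: rsum_ge0 => i _. exact: pow2_ge_0. }
have A0 : 0 <= A by apply: rsum_ge0 => i _; exact: pow2_ge_0.
have B0 : 0 <= B by apply: rsum_ge0 => i _; exact: pow2_ge_0.
have D0 : 0 <= D by apply: rsum_ge0 => i _; exact: Rmult_le_pos.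
(* At [(D, A)] the quadratic form equals [A * (A * B - D ^ 2)]. When [A] vanishes, its value at
   [(B + 1, D)] is [- (B + 2) * D ^ 2], which forces [D = 0]. *)
case: (Rle_lt_or_eq_dec _ _ A0) => HA.
- have := Q D A. nra.
- have Q1 := Q (B + 1) D. have : 0 <= (B+1)^2 * A + D^2 * B - 2 * (B+1) * D * D by []. rewrite -HA. nra.
Qed.

Lemma Nat_mod_modn a b : Nat.modulo a b.+1 = (a %% b.+1)%N.
Proof.
symmetry; apply: (Nat.mod_unique _ _ (a %/ b.+1)%N).
- by apply/ltP; rewrite ltn_mod.
- have := divn_eq a b.+1. rewrite mulnC => {1}->. by [].
Qed.

Lemma Nat_divideP d n : Nat.divide d n <-> (d %| n)%N.
Proof.
split.
- by move=> [k ->]; exact: dvdn_mull.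
- by move=> /dvdnP[k ->]; exists k.
Qed.

Lemma Nat_gcd_gcdn a b : Nat.gcd a b = gcdn a b.
Proof.
apply: Nat.gcd_unique.
- by apply/Nat_divideP; exact: dvdn_gcdl.
- by apply/Nat_divideP; exact: dvdn_gcdr.
- move=> q /Nat_divideP H1 /Nat_divideP H2; apply/Nat_divideP. by rewrite dvdn_gcd H1.
Qed.

Lemma inv_le_ln_diff x : 1 <= x -> / (x + 1) <= ln (x + 1) - ln x.
Proof.
move=> Hx.
have P : 0 < / (x + 1) by apply: Rinv_0_lt_compat; lra.
have -> : ln (x + 1) - ln x = - ln (x / (x + 1)).
{ rewrite ln_div; lra. }
have Q : 0 < x / (x + 1) by apply: Rdiv_lt_0_compat; lra.
have H := exp_ineq1_le (- / (x + 1)).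
have E : x / (x + 1) = 1 + - / (x + 1) by field; lra.
rewrite -E in H. have := ln_le _ _ Q H. rewrite ln_exp. lra.
Qed.

Lemma harmonic_bound n : (0 < n)%N -> \rsum_(1 <= a < n.+1) (/ INR a) <= 1 + ln (INR n).
Proof.
elim: n => [//|[_ _|n IH _]].
- rewrite big_nat1 INR_1 ln_1 Rinv_1. lra.
- rewrite big_nat_recr //. have {}IH := IH isT.
  have P : 1 <= INR n.+1 by exact: (INR_S_ge1 n).
  have := inv_le_ln_diff P. rewrite -S_INR /=. lra.
Qed.

(** * Roots of unity and Gauss sums *)

Definition er (Q a : nat) : C := cexp (Ci * RtoC (2 * PI * (INR a / INR Q))).

Lemma INR_gt0 n : (0 < n)%N -> 0 < INR n.
Proof. by move=> H; apply: lt_0_INR; apply/ltP. Qed.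

Lemma INR_leq m n : (m <= n)%N -> INR m <= INR n.
Proof. by move=> H; apply: le_INR; apply/leP. Qed.

Lemma INR_addn m n : INR (m + n)%N = INR m + INR n.
Proof. exact: plus_INR. Qed.

Lemma INR_muln m n : INR (m * n)%N = INR m * INR n.
Proof. exact: mult_INR. Qed.

Lemma INR_subn m n : (n <= m)%N -> INR (m - n)%N = INR m - INR n.
Proof. by move=> H; apply: minus_INR; apply/leP. Qed.

Section RootsOfUnity.
Variable Q : nat.
Hypothesis Q0 : (0 < Q)%N.

Lemma er_add a b : er Q (a + b) = (er Q a * er Q b)%C.
Proof.
rewrite /er -cexp_add; congr cexp. rewrite INR_addn -Cmult_plus_distr_l -RtoC_plus.
congr (_ * RtoC _)%C. have := INR_gt0 Q0. move=> ?; field; lra.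
Qed.

Lemma er0 : er Q 0 = RtoC 1.
Proof.
rewrite /er INR_0. have -> : 2 * PI * (0 / INR Q) = 0 by rewrite /Rdiv; ring.
by rewrite Cmult_0_r cexp_0.
Qed.

Lemma erQ : er Q Q = RtoC 1.
Proof.
rewrite /er. have H := INR_gt0 Q0. have -> : 2 * PI * (INR Q / INR Q) = 2 * PI by field; lra.
apply: Ceq; rewrite /cexp /Ci /Re /Im /=; rewrite !Rmult_0_l Rminus_0_l.
- have -> : - (1 * 0) = 0 by ring. rewrite exp_0 Rplus_0_l ?Rmult_1_l cos_2PI; ring.
- have -> : - (1 * 0) = 0 by ring. rewrite exp_0 Rplus_0_l ?Rmult_1_l sin_2PI; ring.
Qed.

Lemma er_pow a n : er Q (a * n) = (er Q a ^ n)%C.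
Proof. by elim: n => [|n IH]; rewrite ?muln0 ?er0 // mulnS er_add IH Cpow_S. Qed.

Lemma er_mulQ a : er Q (a * Q) = RtoC 1.
Proof. by rewrite mulnC er_pow erQ Cpow_1_l. Qed.

Lemma er_mod a : er Q (a %% Q) = er Q a.
Proof. by rewrite {2}(divn_eq a Q) er_add er_mulQ Cmult_1_l. Qed.

Lemma Cmod_er a : Cmod (er Q a) = 1.
Proof. rewrite /er Cmod_cexp -exp_0; congr exp. rewrite /Ci /Re /=; ring. Qed.

Lemma er_conj a : (er Q a * Cconj (er Q a) = 1)%C.
Proof. by rewrite -Cmod2_conj Cmod_er; congr RtoC; ring. Qed.

(** From the Taylor polynomial of degree 7. The slope 2/5 is small enough for the interval to cover
    [[0, PI / 2]] and large enough that [2 / 5 * PI >= 1], which is what [er_gap] uses. *)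
Lemma sin_ge x : 0 <= x <= 2 -> 2 / 5 * x <= sin x.
Proof.
move=> Hx. have H3 := PI2_3_2. have L : 0 <= x <= PI by lra.
have [A _] := SIN x (proj1 L) (proj2 L). apply: Rle_trans A.
rewrite /sin_lb /sin_approx /= /sin_term /=.
have -> : 2 / 5 * x = x * (2/5) by ring.
match goal with |- _ <= ?E => have -> : E = x * (1 - x^2/6 + x^4/120 - x^6/5040) by rewrite /INR /=; field end.
apply: Rmult_le_compat_l; first lra.
have P : 0 <= x ^ 2 <= 4 by nra.
have -> : x ^ 4 = x ^ 2 * x ^ 2 by ring. have -> : x ^ 6 = x ^ 2 * x ^ 2 * x ^ 2 by ring.
nra.
Qed.

Lemma Cmod_1_sub_er a : Cmod (1 - er Q a) = 2 * Rabs (sin (PI * (INR a / INR Q))).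
Proof.
rewrite /er. set t := PI * (INR a / INR Q).
have -> : 2 * PI * (INR a / INR Q) = 2 * t by rewrite /t; ring.
have -> : 2 * Rabs (sin t) = Rabs (2 * sin t) by rewrite Rabs_mult (Rabs_pos_eq 2) //; lra.
rewrite -sqrt_Rsqr_abs /Cmod; congr sqrt.
rewrite /cexp /Ci /Re /Im /= !Rmult_0_l Rminus_0_l.
have -> : - (1 * 0) = 0 by ring. rewrite exp_0 Rplus_0_l ?Rmult_1_l cos_2a_sin sin_2a /Rsqr.
have := sin2_cos2 t. rewrite /Rsqr. set s := sin t; set c := cos t => E.
have -> : (1 + - (1 - 2 * s * s)) * ((1 + - (1 - 2 * s * s)) * 1) + (0 + - (2 * s * c)) * ((0 + - (2 * s * c)) * 1) = 4 * s * s * (s * s + c * c) by ring.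
rewrite E. ring.
Qed.

(** The distance from 1 is at least of the order of [min(a, Q - a) / Q]. Adding the two reciprocals
    instead of taking the larger one turns later sums over [a] into two harmonic sums. *)
Lemma er_gap a : (0 < a < Q)%N -> 2 <= Cmod (1 - er Q a) * (INR Q / INR a + INR Q / INR (Q - a)%N).
Proof.
move=> /andP[a0 aQ]. rewrite Cmod_1_sub_er.
have HQ := INR_gt0 Q0. have Ha := INR_gt0 a0.
have Hb : 0 < INR (Q - a)%N by apply: INR_gt0; rewrite subn_gt0.
have Eb : INR (Q - a)%N = INR Q - INR a by apply: INR_subn; exact: ltnW.
have P3 := PI2_3_2. have P4 := PI_4.
have key : forall x, 0 < x -> x < INR Q -> 2 * x <= INR Q -> 1 <= sin (PI * (x / INR Q)) * (INR Q / x).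
{ move=> x Hx HxQ H2.
  have Hf : 0 < x / INR Q by apply: Rdiv_lt_0_compat.
  have Hf2 : x / INR Q <= / 2 by apply/Rle_div_l; lra.
  have S := @sin_ge (PI * (x / INR Q)) ltac:(nra).
  have : 1 <= (2 / 5 * (PI * (x / INR Q))) * (INR Q / x).
  { have -> : (2 / 5 * (PI * (x / INR Q))) * (INR Q / x) = 2 / 5 * PI by field; lra. lra. }
  have : 0 < INR Q / x by apply: Rdiv_lt_0_compat. nra. }
have Pa : 0 < INR Q / INR a by apply: Rdiv_lt_0_compat.
have Pb : 0 < INR Q / INR (Q - a)%N by apply: Rdiv_lt_0_compat.
set s := Rabs _.
have [H|H] : 1 <= s * (INR Q / INR a) \/ 1 <= s * (INR Q / INR (Q - a)%N).
{ case: (Rle_lt_dec (2 * INR a) (INR Q)) => H.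
  - left. have := key (INR a) Ha ltac:(lra) H. have := Rle_abs (sin (PI * (INR a / INR Q))). rewrite /s. nra.
  - right. have := key (INR (Q - a)%N) Hb ltac:(lra) ltac:(lra).
    have -> : PI * (INR (Q - a)%N / INR Q) = PI - PI * (INR a / INR Q) by rewrite Eb; field; lra.
    rewrite sin_PI_x. have := Rle_abs (sin (PI * (INR a / INR Q))). rewrite /s. nra. }
all: have : 0 <= s by exact: Rabs_pos.
all: nra.
Qed.

Lemma geom_sum (z : C) n : ((1 - z) * (\csum_(i < n) (z ^ i))%R = 1 - z ^ n)%C.
Proof.
elim: n => [|n IH]; first by rewrite big_ord0 /=; ring.
rewrite big_ord_recr /= Cmult_plus_distr_l IH. ring.
Qed.

Lemma er_interval_bound a M N : (0 < a < Q)%N ->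
  Cmod (\csum_(M <= n < N) er Q (a * n)) <= INR Q / INR a + INR Q / INR (Q - a)%N.
Proof.
move=> Ha.
have G := er_gap Ha.
have P : 0 < INR Q / INR a + INR Q / INR (Q - a)%N.
{ case/andP: Ha => a0 aQ. apply: Rplus_lt_0_compat; apply: Rdiv_lt_0_compat; apply: INR_gt0 => //. by rewrite subn_gt0. }
have D : 0 < Cmod (1 - er Q a).
{ apply: Rnot_le_lt => H. have := Cmod_ge_0 (1 - er Q a). nra. }
have : Cmod (1 - er Q a) * Cmod (\csum_(M <= n < N) er Q (a * n)) <= 2.
{ rewrite -Cmod_mult.
  have -> : ((1 - er Q a) * (\csum_(M <= n < N) er Q (a * n))%R)%C = (er Q a ^ M * ((1 - er Q a) * (\csum_(i < N - M) er Q a ^ i)%R))%C.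
  { rewrite Cmult_assoc (Cmult_comm (_ ^ _)) -Cmult_assoc. congr Cmult.
    rewrite -[X in \csum_(X <= _ < _) _]add0n big_addn big_mkord big_distrr /=.
    apply: eq_bigr => i _. by rewrite er_pow addnC Cpow_add_r. }
  rewrite geom_sum Cmod_mult Cmod_pow Cmod_er pow1 Rmult_1_l.
  apply: Rle_trans (Cmod_triangle _ _) _. rewrite Cmod_opp Cmod_pow Cmod_er pow1 Cmod_1. lra. }
move=> H. nra.
Qed.

Lemma er_neq1 a : (0 < a < Q)%N -> er Q a <> RtoC 1.
Proof.
move=> Ha E. have := er_gap Ha. rewrite E. have -> : (1 - 1 = 0)%C by ring. rewrite Cmod_0. lra.
Qed.

Lemma er_full_sum a : \csum_(n < Q) er Q (a * n) = RtoC (if (Q %| a)%N then INR Q else 0).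
Proof.
case: ifP => H.
- rewrite -[RHS]Cmult_1_r -csum_const. apply: eq_bigr => i _.
  case/dvdnP: H => k ->. by rewrite -mulnA (mulnC Q) mulnA er_mulQ.
- have Hr : (0 < a %% Q < Q)%N by rewrite lt0n ltn_mod Q0 andbT; move: H; rewrite /dvdn => ->.
  have N1 := er_neq1 Hr. rewrite er_mod in N1.
  have := geom_sum (er Q a) Q. rewrite -er_pow er_mulQ.
  have -> : \csum_(i < Q) (er Q a ^ i) = \csum_(n < Q) er Q (a * n) by apply: eq_bigr => i _; rewrite er_pow.
  have -> : (1 - 1 = 0)%C by ring. move=> E.
  apply: NNPP => Hn. apply: (Cmult_neq_0 _ _ _ Hn E). apply: Cminus_eq_contra => H1; exact: N1.
Qed.

Lemma er_conjE a : Cconj (er Q a) = (/ er Q a)%C.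
Proof.
have H := er_conj a. have N : er Q a <> RtoC 0 by apply/Cmod_gt_0; rewrite Cmod_er; lra.
by rewrite -[LHS]Cmult_1_l -(Cinv_l _ N) -Cmult_assoc H Cmult_1_r.
Qed.

Lemma er_eq a b : a = b %[mod Q] -> er Q a = er Q b.
Proof. by move=> H; rewrite -er_mod H er_mod. Qed.

(* The difference [a - b] is encoded as [a + (Q - 1) b]. *)
Lemma er_orth a b :
  \csum_(n < Q) (er Q (a * n) * Cconj (er Q (b * n))) = RtoC (if a == b %[mod Q] then INR Q else 0).
Proof.
have -> : \csum_(n < Q) (er Q (a * n) * Cconj (er Q (b * n))) = \csum_(n < Q) er Q ((a + Q.-1 * b) * n).
{ apply: eq_bigr => n _. rewrite mulnDl er_add. congr Cmult.
  have E : (er Q (b * n) * er Q (Q.-1 * b * n) = 1)%C.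
  { rewrite -er_add -mulnA -mulSn prednK // mulnC. exact: er_mulQ. }
  rewrite er_conjE -[RHS]Cmult_1_l -(Cinv_l (er Q (b * n))); last by apply/Cmod_gt_0; rewrite Cmod_er; lra.
  by rewrite -Cmult_assoc E Cmult_1_r. }
rewrite er_full_sum. congr RtoC. congr (if _ then _ else _).
have -> : (Q %| a + Q.-1 * b)%N = (a + Q.-1 * b == 0 %[mod Q]) by rewrite /dvdn mod0n.
rewrite -(eqn_modDr b (a + _)) -addnA -mulSnr prednK // add0n.
by rewrite -modnDmr mulnC modnMl addn0.
Qed.

End RootsOfUnity.

Lemma big_mulmod (T : Type) (idx : T) (op : Monoid.com_law idx) (Q b : nat) (F : nat -> T) :
  coprime b Q -> \big[op/idx]_(a < Q) F ((b * a) %% Q)%N = \big[op/idx]_(a < Q) F a.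
Proof.
case: Q => [|Q] H; first by rewrite !big_ord0.
pose h (a : 'I_Q.+1) : 'I_Q.+1 := Ordinal (ltn_pmod (b * a) (ltn0Sn Q)).
have hinj : injective h.
{ move=> x y /(congr1 val) /= /eqP.
  have lem : forall u v : nat, (u <= v)%N -> b * u == b * v %[mod Q.+1] -> u == v %[mod Q.+1].
  { move=> u v uv. rewrite eq_sym eqn_mod_dvd ?leq_mul2l ?uv ?orbT // -mulnBr Gauss_dvdr 1?coprime_sym // => D.
    by rewrite eq_sym eqn_mod_dvd. }
  move=> E. apply: val_inj. rewrite -[LHS](modn_small (ltn_ord x)) -[RHS](modn_small (ltn_ord y)).
  case: (leqP x y) => L.
  - apply/eqP; exact: lem.
  - by apply/esym/eqP; apply: lem; [exact: ltnW|rewrite eq_sym]. }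
rewrite [RHS](reindex_inj hinj) /=. by apply: eq_bigr.
Qed.

Lemma coprime_modn_unit a b Q : a = b %[mod Q] -> coprime a Q = coprime b Q.
Proof. by move=> E; rewrite -coprime_modl E coprime_modl. Qed.

Section DirichletCharacter.
Variables (Q : nat) (f : nat -> C).
Hypothesis Hf : is_dirichlet_char Q f.

Lemma char_Q_gt0 : (0 < Q)%N.
Proof. by case: Hf => /ltP. Qed.

Lemma char_mul m n : f (m * n)%N = (f m * f n)%C.
Proof. by case: Hf => _ [_ [H _]]; exact: H. Qed.

Lemma char_addQ m k : f (m + k * Q)%N = f m.
Proof.
case: Hf => _ [H _]. elim: k => [|k IH]; first by rewrite addn0.
by rewrite mulSn addnCA addnC H.
Qed.

Lemma char_mod n : f (n %% Q)%N = f n.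
Proof. by rewrite {2}(divn_eq n Q) addnC char_addQ. Qed.

Lemma char_eqmod m n : m = n %[mod Q] -> f m = f n.
Proof. by move=> E; rewrite -char_mod E char_mod. Qed.

Lemma char1 : f 1 = RtoC 1.
Proof. by case: Hf => _ [_ [_ [H _]]]. Qed.

Lemma char_eq0 n : ~~ coprime n Q -> f n = RtoC 0.
Proof.
case: Hf => _ [_ [_ [_ H]]] Hn. apply/H. rewrite Nat_gcd_gcdn => E. by rewrite /coprime E eqxx in Hn.
Qed.

Lemma char_neq0 n : coprime n Q -> f n <> RtoC 0.
Proof.
case: Hf => _ [_ [_ [_ H]]] /eqP Hn /H. by rewrite Nat_gcd_gcdn.
Qed.

Lemma char_exp n k : f (n ^ k)%N = (f n ^ k)%C.
Proof. by elim: k => [|k IH]; rewrite ?char1 // expnS char_mul IH Cpow_S. Qed.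

Lemma char_norm1 n : coprime n Q -> Cmod (f n) = 1.
Proof.
move=> Hn.
have E : f (n ^ totient Q)%N = RtoC 1.
{ rewrite -char1. apply: char_eqmod. exact: Euler_exp_totient. }
rewrite char_exp in E. have {}E : Cmod (f n) ^ totient Q = 1 by rewrite -Cmod_pow E Cmod_1.
have T : (0 < totient Q)%N by rewrite totient_gt0 char_Q_gt0.
have P := Cmod_ge_0 (f n).
case: (totient Q) T E => // k _ E.
case: (Rtotal_order (Cmod (f n)) 1) => [H|[//|H]].
- have := pow_lt_1_compat (Cmod (f n)) k.+1 ltac:(lra) ltac:(lia). lra.
- have := Rlt_pow_R1 (Cmod (f n)) k.+1 H ltac:(lia). lra.
Qed.

Lemma char_norm_le1 n : Cmod (f n) <= 1.
Proof.
case: (boolP (coprime n Q)) => H; first by rewrite char_norm1 //; lra.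
rewrite char_eq0 // Cmod_0. lra.
Qed.

Lemma char_conj_mul n : coprime n Q -> (f n * Cconj (f n) = 1)%C.
Proof. by move=> H; rewrite -Cmod2_conj char_norm1 //; congr RtoC; ring. Qed.

(** The character is conjugated so that Fourier inversion returns [f] itself rather than its
    conjugate. *)
Definition gauss_sum (n : nat) : C := \csum_(a < Q) (Cconj (f a) * er Q (a * n)).

Lemma gauss_sum_unit b n : coprime b Q -> gauss_sum (b * n) = (f b * gauss_sum n)%C.
Proof.
move=> Hb. have Q0 := char_Q_gt0.
have -> : gauss_sum n = \csum_(a < Q) (Cconj (f (b * a)%N) * er Q ((b * a) * n)).
{ rewrite /gauss_sum -(big_mulmod _ (fun a => Cconj (f a) * er Q (a * n))%C Hb).
  apply: eq_bigr => a _. rewrite char_mod. congr Cmult. apply: (er_eq Q0). by rewrite modnMml. }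
rewrite big_distrr /=. apply: eq_bigr => a _.
rewrite char_mul Cmult_conj.
have -> : (f b * (Cconj (f b) * Cconj (f a) * er Q (b * a * n)) = (f b * Cconj (f b)) * (Cconj (f a) * er Q (b * a * n)))%C by ring.
rewrite char_conj_mul // Cmult_1_l. congr (_ * er Q _)%C. by rewrite mulnCA mulnA.
Qed.

Hypothesis Hprim : is_primitive_char Q f.

(** For [n] not prime to [Q], primitivity at the modulus [Q / gcd(n, Q)] gives a unit [b] with
    [f b <> 1] and [b n = n] modulo [Q]. Then the sum at [n] equals [f b] times itself and vanishes,
    as [f n] does. *)
Lemma gauss_sum_prim n : gauss_sum n = (f n * gauss_sum 1)%C.
Proof.
case: (boolP (coprime n Q)) => Hn; first by rewrite -gauss_sum_unit // muln1.
have Q0 := char_Q_gt0.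
rewrite char_eq0 // Cmult_0_l.
set g := gcdn n Q. have g0 : (0 < g)%N by rewrite gcdn_gt0 Q0 orbT.
have gQ : (g %| Q)%N by exact: dvdn_gcdr.
have g1 : (1 < g)%N by rewrite /coprime -/g in Hn; lia.
have [_ /(_ (Q %/ g)%N)] := Hprim.
have dlt : (Q %/ g < Q)%N by rewrite ltn_Pdiv.
have d0 : (0 < Q %/ g)%N by rewrite divn_gt0 // dvdn_leq.
case.
- apply/Nat_divideP. by apply/dvdnP; exists g; rewrite mulnC divnK.
- exact/ltP.
move=> b [cb [b1 fb]].
have {}cb : coprime b Q by apply/eqP; rewrite -Nat_gcd_gcdn.
have E : gauss_sum (b * n) = gauss_sum n.
{ apply: eq_bigr => a _. congr Cmult. apply: (er_eq Q0).
  rewrite -modnMmr -[RHS]modnMmr. congr modn. congr muln.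
  apply/eqP. have [k Hk] : exists k, (n = k * g)%N by apply/dvdnP; exact: dvdn_gcdl.
  have Hb : b = 1 %[mod Q %/ g].
  { move: b1. rewrite -(prednK d0) !Nat_mod_modn. by []. }
  have b0 : (0 < b)%N.
  { case: (posnP b) => // E0. case: fb. move: cb. rewrite E0 /coprime gcd0n => /eqP EQ.
    by rewrite -char1; apply: char_eqmod; rewrite EQ !modn1. }
  rewrite -[X in _ == X %[mod _]]mul1n eqn_mod_dvd ?leq_mul2r ?b0 ?orbT // -mulnBl Hk.
  have : (Q %/ g %| b - 1)%N by rewrite -eqn_mod_dvd //; apply/eqP.
  case/dvdnP => j ->. apply/dvdnP; exists (j * k)%N.
  have EQ : (Q = Q %/ g * g)%N by rewrite divnK.
  rewrite {2}EQ. lia. }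
rewrite gauss_sum_unit // in E.
apply: NNPP => Hne. apply: fb.
have : ((f b - 1) * gauss_sum n = 0)%C by rewrite Cmult_plus_distr_r E; ring.
move=> H0. apply: NNPP => Hb1. apply: (Cmult_neq_0 _ _ _ Hne H0). exact: Cminus_eq_contra.
Qed.

(** The mean square over all frequencies is evaluated twice, by [gauss_sum_prim] and by
    orthogonality; the common positive factor [W] is then cancelled. *)
Lemma gauss_sum_norm : Cmod (gauss_sum 1) ^ 2 = INR Q.
Proof.
have Q0 := char_Q_gt0.
pose W := \rsum_(a < Q) Cmod (f a) ^ 2.
have HW : 0 < W.
{ have H1 : (1 %% Q < Q)%N by rewrite ltn_mod.
  rewrite /W (bigD1 (Ordinal H1)) //. apply: Rplus_lt_le_0_compat.
  - rewrite [nat_of_ord _]/= char_mod char1 Cmod_1. lra.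
  - by apply: rsum_ge0 => i _; exact: pow2_ge_0. }
have E1 : \csum_(n < Q) (gauss_sum n * Cconj (gauss_sum n)) = RtoC (W * Cmod (gauss_sum 1) ^ 2).
{ rewrite RtoC_mult /W csum_RtoC big_distrl /=. apply: eq_bigr => n _.
  rewrite gauss_sum_prim Cmult_conj !Cmod2_conj. ring. }
have E2 : \csum_(n < Q) (gauss_sum n * Cconj (gauss_sum n)) = RtoC (W * INR Q).
{ rewrite RtoC_mult /W csum_RtoC big_distrl /=.
  under eq_bigr => n _ do rewrite /gauss_sum csum_conj big_distrlr /=.
  rewrite exchange_big /=. apply: eq_bigr => a _.
  rewrite exchange_big /= (bigD1 a) //= [X in (_ + X)%C]big1 => [|b /negbTE ab].
  - rewrite Cplus_0_r Cmod2_conj.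
    under eq_bigr => n _ do rewrite Cmult_conj Cconj_conj.
    transitivity (Cconj (f a) * f a * \csum_(n < Q) (er Q (a * n) * Cconj (er Q (a * n))))%C.
    + rewrite big_distrr /=. apply: eq_bigr => n _. ring.
    + rewrite (er_orth Q0) eqxx. ring.
  - transitivity (Cconj (f a) * f b * \csum_(n < Q) (er Q (a * n) * Cconj (er Q (b * n))))%C.
    + rewrite big_distrr /=. apply: eq_bigr => n _. rewrite Cmult_conj Cconj_conj. ring.
    + rewrite (er_orth Q0). case: eqP => [E|_]; last by rewrite Cmult_0_r.
      by move: ab; rewrite !modn_small // in E; rewrite -val_eqE /= E eqxx. }
have := etrans (esym E1) E2 => /RtoC_inj E. nra.
Qed.

Definition gauss_coef : C := (/ gauss_sum 1)%C.

Lemma gauss_sum_neq0 : gauss_sum 1 <> RtoC 0.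
Proof.
move=> E. have := gauss_sum_norm. rewrite E Cmod_0. have := INR_gt0 char_Q_gt0. lra.
Qed.

Lemma gauss_coef_norm : Cmod gauss_coef = / sqrt (INR Q).
Proof.
rewrite /gauss_coef Cmod_inv; last exact: gauss_sum_neq0.
by rewrite -gauss_sum_norm sqrt_pow2 //; exact: Cmod_ge_0.
Qed.

Lemma char_fourier n : f n = (gauss_coef * \csum_(a < Q) (Cconj (f a) * er Q (a * n)))%C.
Proof.
rewrite -/(gauss_sum n) gauss_sum_prim /gauss_coef. field. exact: gauss_sum_neq0.
Qed.

End DirichletCharacter.

(** * The Pólya-Vinogradov inequality and central values *)

Lemma big_modn_periods (T : Type) (idx : T) (op : Monoid.com_law idx) (q l : nat) (F : nat -> T) :
  \big[op/idx]_(a < q * l) F (a %% l)%N = \big[op/idx]_(k < q) \big[op/idx]_(b < l) F b.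
Proof.
elim: q => [|q IH]; first by rewrite mul0n !big_ord0.
rewrite mulSn big_split_ord big_ord_recl -IH /=. congr (op _ _).
- by apply: eq_bigr => i _; rewrite modn_small.
- by apply: eq_bigr => i _; rewrite modnDl.
Qed.

(** The bound of [er_interval_bound] for the frequency [b]. The value 0 at [b = 0] is a convention
    that is safe because such frequencies carry coefficient 0. *)
Definition gapw (l b : nat) : R := if b == 0%N then 0 else INR l / INR b + INR l / INR (l - b)%N.

Lemma harmonic_lt_bound l : (0 < l)%N -> \rsum_(1 <= b < l) (/ INR b) <= 1 + ln (INR l).
Proof.
case: l => // l _; case: l => [|l].
- rewrite big_geq // INR_1 ln_1. lra.
- apply: Rle_trans (harmonic_bound (ltn0Sn l)) _. apply: Rplus_le_compat_l.
  apply: ln_le; [exact: INR_gt0|exact: INR_leq].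
Qed.

Lemma sum_gapw l : (0 < l)%N -> \rsum_(b < l) gapw l b <= 2 * INR l * (1 + ln (INR l)).
Proof.
move=> l0. rewrite -(big_mkord xpredT (gapw l)) big_ltn // {1}/gapw /= Rplus_0_l.
have -> : \rsum_(1 <= b < l) gapw l b = \rsum_(1 <= b < l) (INR l * / INR b) + \rsum_(1 <= b < l) (INR l * / INR (l - b)%N).
{ rewrite -big_split /=. rewrite !big_nat. apply: eq_bigr => b /andP[b0 _]. by rewrite /gapw; case: b b0. }
have -> : \rsum_(1 <= b < l) (INR l * / INR (l - b)%N) = \rsum_(1 <= b < l) (INR l * / INR b).
{ rewrite big_nat_rev /=. rewrite !big_nat. apply: eq_bigr => b /andP[b0 bl]. congr (_ * / INR _). lia. }
rewrite -big_distrr /=. have := harmonic_lt_bound l0. have := pos_INR l. nra.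
Qed.

Lemma er_dilate q l x : (0 < q)%N -> (0 < l)%N -> er (q * l) (q * x) = er l x.
Proof.
move=> q0 l0. rewrite /er. congr (cexp (Ci * RtoC (2 * PI * _))). rewrite !INR_muln.
have := INR_gt0 q0. have := INR_gt0 l0. move=> ? ?. field. lra.
Qed.

Section PolyaVinogradov.
Variables (l : nat) (f : nat -> C).
Hypothesis Hf : is_primitive_char l f.
Hypothesis l1 : (1 < l)%N.

Let l0 : (0 < l)%N. Proof. exact: ltnW. Qed.
Let Hd : is_dirichlet_char l f. Proof. by case: Hf. Qed.

Lemma char_prog_fourier_bound q y M N :
  Cmod (\csum_(M <= k < N) f (y + q * k)%N) <=
  / sqrt (INR l) * \rsum_(a < l) (Cmod (f a) * Cmod (\csum_(M <= k < N) er l (a * q * k))).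
Proof.
have -> : \csum_(M <= k < N) f (y + q * k)%N =
  (gauss_coef l f * \csum_(a < l) (Cconj (f a) * er l (a * y) * \csum_(M <= k < N) er l (a * q * k)))%C.
{ under eq_bigr => k _ do rewrite (char_fourier Hd Hf).
  rewrite -big_distrr /= exchange_big /=. congr Cmult. apply: eq_bigr => a _.
  rewrite big_distrr /=. apply: eq_bigr => k _.
  rewrite mulnDr er_add // -mulnA. ring. }
rewrite Cmod_mult (gauss_coef_norm Hd Hf). apply: Rmult_le_compat_l.
{ apply: Rlt_le; apply: Rinv_0_lt_compat; apply: sqrt_lt_R0. exact: INR_gt0. }
apply: Rle_trans (Cmod_csum _ _ _) _. apply: rsum_le => a _.
rewrite !Cmod_mult Cmod_conj Cmod_er Rmult_1_r. lra.
Qed.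

Let fin_bound X : X <= 2 * INR l * (1 + ln (INR l)) -> / sqrt (INR l) * X <= 2 * sqrt (INR l) * (1 + ln (INR l)).
Proof.
move=> H. have P := INR_gt0 l0. have S := sqrt_lt_R0 _ P. have E := sqrt_sqrt (INR l) ltac:(lra).
apply: (Rmult_le_reg_l (sqrt (INR l))) => //.
rewrite -Rmult_assoc Rinv_r; last lra. rewrite Rmult_1_l.
have -> : sqrt (INR l) * (2 * sqrt (INR l) * (1 + ln (INR l))) = 2 * (sqrt (INR l) * sqrt (INR l)) * (1 + ln (INR l)) by ring.
by rewrite E.
Qed.

(** Multiplication by [q] permutes the frequencies modulo [l], so the geometric sums have the same
    total bound as for consecutive integers. *)
Lemma polya_vinogradov_coprime q y M N : coprime q l ->
  Cmod (\csum_(M <= k < N) f (y + q * k)%N) <= 2 * sqrt (INR l) * (1 + ln (INR l)).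
Proof.
move=> Hq. apply: Rle_trans (char_prog_fourier_bound _ _ _ _) _. apply: fin_bound.
apply: Rle_trans (sum_gapw l0). rewrite -(big_mulmod _ (gapw l) Hq).
apply: rsum_le => a _.
case E : ((q * a) %% l == 0)%N.
- have a0 : (a : nat) = 0%N.
  { move: E; rewrite -/(dvdn l _) Gauss_dvdr 1?coprime_sym // => /dvdn_leq D.
    case: (posnP a) => // /D. by rewrite leqNgt ltn_ord. }
  rewrite /gapw E a0 (char_eq0 Hd) ?Cmod_0 ?Rmult_0_l; first lra.
  rewrite /coprime gcd0n. lia.
- have Hr : (0 < (q * a) %% l < l)%N by rewrite lt0n E ltn_mod.
  have B := er_interval_bound l0 M N Hr.
  have -> : \csum_(M <= k < N) er l (a * q * k) = \csum_(M <= k < N) er l ((q * a) %% l * k).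
  { apply: eq_bigr => k _. apply: (er_eq l0). by rewrite modnMml (mulnC q). }
  rewrite /gapw E. have := char_norm_le1 Hd a. have := Cmod_ge_0 (f a).
  have := Cmod_ge_0 (\csum_(M <= k < N) er l ((q * a) %% l * k)). nra.
Qed.

(** Here the frequency [a] matters only modulo [l'], and every residue occurs [q] times, so the
    total is again at most [2 * l * (1 + ln l)]. Frequencies divisible by [l'] are not prime to [l]
    and have coefficient 0. *)
Lemma polya_vinogradov_dvd q l' y M N : (l = q * l')%N -> (1 < l')%N ->
  Cmod (\csum_(M <= k < N) f (y + q * k)%N) <= 2 * sqrt (INR l) * (1 + ln (INR l)).
Proof.
move=> El l'1. have l'0 : (0 < l')%N by exact: ltnW.
have q0 : (0 < q)%N by case: (posnP q) El l0 => // ->; rewrite mul0n => ->.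
apply: Rle_trans (char_prog_fourier_bound _ _ _ _) _. apply: fin_bound.
apply: Rle_trans (_ : \rsum_(a < q * l') gapw l' (a %% l')%N <= _).
- rewrite -El. apply: rsum_le => a _.
  have -> : \csum_(M <= k < N) er l (a * q * k) = \csum_(M <= k < N) er l' (a %% l' * k).
  { apply: eq_bigr => k _. rewrite [in LHS](_ : er l _ = er (q * l') (q * (a * k))); last by rewrite -El (mulnC a) mulnA.
    rewrite er_dilate //. apply: (er_eq l'0). by rewrite modnMml. }
  case E : (a %% l' == 0)%N.
  + rewrite /gapw E (char_eq0 Hd) ?Cmod_0 ?Rmult_0_l; first lra.
    apply/negP => /eqP G. have : (l' %| gcdn a l)%N by rewrite dvdn_gcd /dvdn E El modnMl eqxx.
    rewrite G dvdn1. lia.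
  + have Hr : (0 < a %% l' < l')%N by rewrite lt0n E ltn_mod.
    have B := er_interval_bound l'0 M N Hr.
    rewrite /gapw E. have := char_norm_le1 Hd a. have := Cmod_ge_0 (f a).
    have := Cmod_ge_0 (\csum_(M <= k < N) er l' (a %% l' * k)). nra.
- rewrite big_modn_periods rsum_const. have S := sum_gapw l'0.
  have Q := pos_INR q.
  have L : ln (INR l') <= ln (INR l).
  { apply: ln_le; first exact: INR_gt0. apply: INR_leq. by rewrite El leq_pmull. }
  have P := pos_INR l'.
  rewrite {1}El INR_muln.
  apply: Rle_trans (Rmult_le_compat_l _ _ _ Q S) _.
  have : INR q * INR l' * ln (INR l') <= INR q * INR l' * ln (INR l) by apply: Rmult_le_compat_l => //; exact: Rmult_le_pos.
  nra.
Qed.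

End PolyaVinogradov.

Lemma is_series_clim (a : nat -> C) (l : C) :
  @is_series C_AbsRing C_NormedModule a l <-> clim (csum a) l.
Proof.
have E : forall n, @sum_n C_AbelianMonoid a n = csum a n.+1.
{ elim=> [|n IH]; first by rewrite sum_O /= Cplus_0_l.
  by rewrite sum_Sn IH. }
split.
- move=> H eps He.
  have He2 : 0 < eps / 2 by lra.
  have Lo : @locally C_NormedModule l (@ball C_NormedModule l (eps / 2)) by exists (mkposreal _ He2).
  have [N HN] := H _ Lo.
  exists N.+1 => n Hn. case: n Hn => [|n] Hn; first lia.
  have [A B] := HN n ltac:(lia).
  have E2 : sum_n a n = csum a n.+1 := E n. rewrite E2 in A B.
  apply: Rle_lt_trans (Cmod_le_abs _) _.
  rewrite /ball /= /AbsRing_ball /abs /minus /plus /opp /= in A B.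
  rewrite /Re /Im /=. rewrite /= in A B. lra.
- move=> H P [e He].
  have [N HN] := H e (cond_pos e).
  exists N => n Hn. apply: He. apply: C_NormedModule_mixin_compat1.
  have := HN n.+1 ltac:(lia). by rewrite -E.
Qed.

Lemma cderiv_csum (I : Type) (r : seq I) (F : I -> C -> C) z :
  (forall i, exists l, cderiv (F i) z l) ->
  exists l, cderiv (fun s => \big[Cplus/RtoC 0]_(i <- r) F i s) z l.
Proof.
move=> H; elim: r => [|i r [l IH]].
- exists (RtoC 0). apply: (cderiv_ext (fun _ => RtoC 0)); first by move=> w; rewrite big_nil.
  exact: cderiv_const.
- have [l' Hl'] := H i. exists (l' + l)%C.
  apply: (cderiv_ext (fun s => F i s + \big[Cplus/RtoC 0]_(i <- r) F i s)%C); first by move=> w; rewrite big_cons.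
  exact: cderiv_plus.
Qed.

Lemma clim_csum (I : Type) (r : seq I) (u : I -> nat -> C) (l : I -> C) :
  (forall i, clim (u i) (l i)) ->
  clim (fun n => \big[Cplus/RtoC 0]_(i <- r) u i n) (\big[Cplus/RtoC 0]_(i <- r) l i).
Proof.
move=> H; elim: r => [|i r IH].
- rewrite big_nil. apply: (clim_ext (fun _ => RtoC 0)); first by move=> n; rewrite big_nil.
  exact: clim_const.
- rewrite big_cons. apply: (clim_ext (fun n => u i n + \big[Cplus/RtoC 0]_(i <- r) u i n)%C); first by move=> n; rewrite big_cons.
  exact: clim_plus.
Qed.

Section LValue.
Variables (Q : nat) (f : nat -> C).
Hypothesis Hf : is_primitive_char Q f.
Hypothesis Q1 : (1 < Q)%N.

Let Hd : is_dirichlet_char Q f. Proof. by case: Hf. Qed.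
Let Q0 : (0 < Q)%N. Proof. exact: ltnW. Qed.

(** Gauss inversion of the continued additive twists. The frequency [a = 0] would mean [th = 1],
    where the twist is the zeta series with its pole; its weight is [Cconj (f 0) = 0], so 0 stands
    in for it. *)
Definition dirichlet_cont (s : C) : C :=
  (gauss_coef Q f * \csum_(a < Q) (Cconj (f a) * (if nat_of_ord a == 0%N then RtoC 0 else twist_cont (er Q a) s)))%C.

Let f0 : f 0 = RtoC 0.
Proof. apply: (char_eq0 Hd). rewrite /coprime gcd0n. lia. Qed.

Lemma dirichlet_cont_cderiv z : exists l, cderiv dirichlet_cont z l.
Proof.
have [l Hl] : exists l, cderiv (fun s => \csum_(a < Q) (Cconj (f a) * (if nat_of_ord a == 0%N then RtoC 0 else twist_cont (er Q a) s))) z l.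
{ apply: (cderiv_csum _ (F := fun (a : 'I_Q) s => (Cconj (f a) * (if nat_of_ord a == 0%N then RtoC 0 else twist_cont (er Q a) s))%C)) => a.
  case: eqP => [_|/eqP a0].
  - eexists. apply: cderiv_scal. exact: cderiv_const.
  - have Ha : (0 < a < Q)%N by rewrite lt0n a0 ltn_ord.
    have [l Hl] := twist_cont_cderiv _ (er_neq1 Q0 Ha) (Cmod_er Q a) z.
    eexists. apply: cderiv_scal. exact: Hl. }
eexists. apply: cderiv_scal. exact: Hl.
Qed.

Lemma dirichlet_cont_series s : 0 < Re s ->
  clim (csum (fun n => f n.+1 * cpow_neg n.+1 s)%C) (dirichlet_cont s).
Proof.
move=> Hs.
have := clim_scal (gauss_coef Q f) _ _ (@clim_csum _ (index_enum 'I_Q)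
   (fun a n => Cconj (f a) * csum (fun n => if nat_of_ord a == 0%N then RtoC 0 else er Q a ^ n.+1 * cpow_neg n.+1 s) n)%C
   (fun a => Cconj (f a) * (if nat_of_ord a == 0%N then RtoC 0 else twist_cont (er Q a) s))%C _).
move=> H. apply: clim_ext (H _) => [n|a].
- rewrite !csum_big big_distrr /=.
  under eq_bigr => a _ do rewrite csum_big !big_distrr /=.
  rewrite exchange_big /=. apply: eq_bigr => k _.
  rewrite (char_fourier Hd Hf) -Cmult_assoc big_distrl /= big_distrr /=.
  apply: eq_bigr => a _. case: eqP => [E|_].
  + have Z : Cconj (RtoC 0) = RtoC 0 by rewrite /Cconj /= Ropp_0.
    by rewrite E f0 Z !Cmult_0_l !Cmult_0_r.
  + rewrite er_pow // Cpow_S. by rewrite !Cmult_assoc.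
- apply: clim_scal. case: eqP => [_|/eqP a0].
  + apply: (clim_ext (fun _ => RtoC 0)); last exact: clim_const.
    by elim=> [|n IH] //=; rewrite -IH; ring.
  + have Ha : (0 < a < Q)%N by rewrite lt0n a0 ltn_ord.
    exact: (twist_cont_series _ (er_neq1 Q0 Ha) (Cmod_er Q a) s Hs).
Qed.

Lemma L_continuation_dirichlet : L_continuation f dirichlet_cont.
Proof.
split.
- move=> z _. have [l Hl] := dirichlet_cont_cderiv z. exists l. by apply/cderiv_is_derive.
- move=> s Hs. apply/is_series_clim. apply: dirichlet_cont_series. lra.
Qed.

Lemma cpow_neg_half n : cpow_neg n.+1 (RtoC (/ 2)) = RtoC (/ sqrt (INR n.+1)).
Proof.
have P : 0 < INR n.+1 by exact: INR_gt0.
rewrite /cpow_neg re_RtoC im_RtoC Ropp_0 Rmult_0_l cos_0 sin_0 Rmult_1_r Rmult_0_r.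
rewrite /RtoC. congr pair.
have -> : - / 2 * ln (INR n.+1) = - (/ 2 * ln (INR n.+1)) by ring.
rewrite exp_Ropp. congr (/ _).
have := Rpower_sqrt _ P. by rewrite /Rpower.
Qed.

Lemma Lval_half : clim (csum (fun n => f n.+1 * RtoC (/ sqrt (INR n.+1)))%C) (Lval f (RtoC (/ 2))).
Proof.
have S := epsilon_spec (inhabits (fun _ : C => RtoC 0)) (L_continuation f) (ex_intro _ _ L_continuation_dirichlet).
rewrite /Lval. set F := epsilon _ _ in S *.
have -> : F (RtoC (/ 2)) = dirichlet_cont (RtoC (/ 2)).
{ apply: continuation_unique.
  - move=> z Hz. have [l Hl] := proj1 S z Hz. exists l. by apply/cderiv_is_derive.
  - move=> z _. exact: dirichlet_cont_cderiv.
  - move=> z Hz. have A := proj2 S z Hz. move/is_series_clim: A => A.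
    apply: (clim_unique _ _ _ A). apply: dirichlet_cont_series. lra. }
have := dirichlet_cont_series (s := RtoC (/ 2)). rewrite re_RtoC => H.
apply: clim_ext (H ltac:(lra)) => n. apply: csum_ext => i _. by rewrite cpow_neg_half.
Qed.

End LValue.

Lemma abel_sum (g : nat -> C) (v : nat -> R) n :
  \csum_(i < n) (g i * RtoC (v i)) =
  (\csum_(i < n) ((\csum_(j < i.+1) g j) * RtoC (v i - v i.+1)) + (\csum_(j < n) g j) * RtoC (v n))%C.
Proof.
elim: n => [|n IH]; first by rewrite !big_ord0; ring.
rewrite big_ord_recr [X in _ = (X + _)%C]big_ord_recr /= IH.
rewrite [\csum_(j < n.+1) g j]big_ord_recr /= !RtoC_minus. ring.
Qed.

Lemma abel_bound (g : nat -> C) (v : nat -> R) (B : R) n :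
  (forall i, v i.+1 <= v i) -> (forall i, 0 <= v i) ->
  (forall N, Cmod (\csum_(j < N) g j) <= B) ->
  Cmod (\csum_(i < n) (g i * RtoC (v i))) <= B * v 0%N.
Proof.
move=> Hv v0 HB. rewrite abel_sum.
have B0 : 0 <= B by apply: Rle_trans (HB 0%N); exact: Cmod_ge_0.
apply: Rle_trans (Cmod_triangle _ _) _.
have H1 : Cmod (\csum_(i < n) ((\csum_(j < i.+1) g j) * RtoC (v i - v i.+1))) <= B * (v 0%N - v n).
{ apply: Rle_trans (Cmod_csum _ _ _) _.
  apply: Rle_trans (_ : \rsum_(i < n) (B * (v i - v i.+1)) <= _).
  - apply: rsum_le => i _. rewrite Cmod_mult Cmod_R Rabs_pos_eq; last by have := Hv i; lra.
    apply: Rmult_le_compat_r; last exact: HB. have := Hv i; lra.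
  - apply: Req_le. elim: n => [|n IH]; first by rewrite big_ord0; ring.
    rewrite big_ord_recr /= IH. ring. }
have H2 : Cmod ((\csum_(j < n) g j) * RtoC (v n)) <= B * v n.
{ rewrite Cmod_mult Cmod_R Rabs_pos_eq //. exact: Rmult_le_compat_r. }
lra.
Qed.

Lemma sum_inv_sqrt n : \rsum_(k < n) (/ sqrt (INR k.+1)) <= 2 * sqrt (INR n).
Proof.
elim: n => [|n IH]; first by rewrite big_ord0 INR_0 sqrt_0; lra.
rewrite big_ord_recr /=.
have P := pos_INR n. have S0 := sqrt_pos (INR n).
have P1 : 0 < INR n.+1 by exact: INR_gt0. have S1 := sqrt_lt_R0 _ P1.
have E0 := sqrt_sqrt (INR n) P. have E1 := sqrt_sqrt (INR n.+1) ltac:(lra).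
have E : INR n.+1 = INR n + 1 by exact: S_INR.
have I : sqrt (INR n.+1) * / sqrt (INR n.+1) = 1 by apply: Rinv_r; lra.
apply: Rle_trans (Rplus_le_compat_r _ _ _ IH) _.
suff : / sqrt (INR n.+1) <= 2 * (sqrt (INR n.+1) - sqrt (INR n)) by lra.
apply: (Rmult_le_reg_l (sqrt (INR n.+1))) => //. rewrite I.
set a := sqrt (INR n) in S0 E0 *; set b := sqrt (INR n.+1) in S1 E1 *. have := pow2_ge_0 (b - a). nra.
Qed.

Lemma nat_near_sqrt x : 1 <= x -> exists K, (0 < K)%N /\ sqrt x <= INR K <= 2 * sqrt x.
Proof.
move=> Hx. have S1 : 1 <= sqrt x by rewrite -sqrt_1; apply: sqrt_le_1_alt.
have [H1 H2] := archimed (sqrt x).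
have Hp : (0 < up (sqrt x))%Z by apply: lt_IZR; lra.
have [K EK] := IZN (up (sqrt x)) ltac:(lia).
have E : INR K = IZR (up (sqrt x)) by rewrite INR_IZR_INZ EK.
exists K. rewrite E. split; last lra. apply/ltP. lia.
Qed.

(* Cutting the sum at [sqrt l], the head is bounded trivially and the tail by partial summation. *)
Lemma sqrt_weight_bound (g : nat -> C) (v : nat -> R) (c l : R) n : 1 <= l -> 0 <= c ->
  (forall i, v i.+1 <= v i) -> (forall i, 0 <= v i) -> (forall i, v i <= c * / sqrt (INR i.+1)) ->
  (forall i, Cmod (g i) <= 1) ->
  (forall M N, Cmod (\csum_(M <= j < N) g j) <= 2 * sqrt l * (1 + ln l)) ->
  Cmod (\csum_(i < n) (g i * RtoC (v i))) <= 5 * c * sqrt (sqrt l) * (1 + ln l).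
Proof.
move=> Hl Hc Hv v0 vc Hg HB.
have [K [K0 [HK1 HK2]]] := nat_near_sqrt Hl.
have S1 : 1 <= sqrt l by rewrite -sqrt_1; apply: sqrt_le_1_alt.
set s := sqrt l in HK1 HK2 S1 HB *.
have SS1 : 1 <= sqrt s by rewrite -sqrt_1; apply: sqrt_le_1_alt.
have ES : sqrt s * sqrt s = s by apply: sqrt_sqrt; lra.
have L0 := ln_ge0 l Hl.
have head : forall m, (m <= K)%N -> Cmod (\csum_(i < m) (g i * RtoC (v i))) <= 3 * c * sqrt s.
{ move=> m Hm. apply: Rle_trans (Cmod_csum _ _ _) _.
  apply: Rle_trans (_ : \rsum_(i < m) (c * / sqrt (INR i.+1)) <= _).
  - apply: rsum_le => i _. rewrite Cmod_mult Cmod_R Rabs_pos_eq //.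
    have := Hg i; have := vc i; have := v0 i; have := Cmod_ge_0 (g i). nra.
  - rewrite -big_distrr. apply: Rle_trans (Rmult_le_compat_l _ _ _ Hc (sum_inv_sqrt m)) _.
    have A1 : sqrt (INR m) <= sqrt (2 * s).
    { apply: sqrt_le_1_alt. have := INR_leq Hm. lra. }
    rewrite sqrt_mult in A1; [|lra|lra].
    have A2 : sqrt 2 <= 3 / 2.
    { have -> : 3 / 2 = sqrt (3 / 2 * (3 / 2)) by rewrite sqrt_square; lra. apply: sqrt_le_1_alt. lra. }
    have A3 : sqrt (INR m) <= 3 / 2 * sqrt s by nra.
    have := Rmult_le_compat_l _ _ _ Hc A3. lra. }
case: (leqP n K) => HnK.
{ have := head n HnK. have : 0 <= c * sqrt s by apply: Rmult_le_pos; lra. nra. }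
have -> : \csum_(i < n) (g i * RtoC (v i)) = (\csum_(i < K) (g i * RtoC (v i)) + \csum_(i < n - K) (g (K + i)%N * RtoC (v (K + i)%N)))%C.
{ rewrite -(big_mkord xpredT (fun i => g i * RtoC (v i))%C) (big_cat_nat _ _ (n := K)) //=; last exact: ltnW.
  rewrite big_mkord. congr Cplus. rewrite -[X in \csum_(X <= _ < _) _]add0n big_addn big_mkord.
  by apply: eq_bigr => i _; rewrite addnC. }
apply: Rle_trans (Cmod_triangle _ _) _.
have T := @abel_bound (fun i => g (K + i)%N) (fun i => v (K + i)%N) (2 * s * (1 + ln l)) (n - K)%N.
have {}T := T ltac:(by move=> i; rewrite addnS) ltac:(by []) .
have {}T : Cmod (\csum_(i < n - K) (g (K + i)%N * RtoC (v (K + i)%N))) <= 2 * s * (1 + ln l) * v (K + 0)%N.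
{ apply: T => N. have := HB K (K + N)%N.
  rewrite -[X in \csum_(X <= _ < _) _]add0n big_addn big_mkord addKn.
  by under eq_bigr => i _ do rewrite addnC. }
have H := head K (leqnn K).
have vK : v (K + 0)%N <= c * / sqrt s.
{ apply: Rle_trans (vc _) _. apply: Rmult_le_compat_l => //. apply: Rinv_le_contravar; first lra.
  apply: sqrt_le_1_alt. have := INR_leq (leqnSn (K + 0)). rewrite addn0. lra. }
have I : sqrt s * / sqrt s = 1 by apply: Rinv_r; lra.
have : 2 * s * (1 + ln l) * v (K + 0)%N <= 2 * c * sqrt s * (1 + ln l).
{ have -> : 2 * c * sqrt s * (1 + ln l) = 2 * s * (1 + ln l) * (c * / sqrt s).
  { rewrite -{2}ES. transitivity (2 * c * sqrt s * (1 + ln l) * (sqrt s * / sqrt s)); [rewrite I; ring|ring]. }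
  apply: Rmult_le_compat_l => //. apply: Rmult_le_pos; lra. }
have : 0 <= c * sqrt s by apply: Rmult_le_pos; lra.
nra.
Qed.

(** * Characters to a prime modulus *)

(** The convexity exponent 1/4, obtained without a functional equation: [sqrt_weight_bound] balances
    the trivial bound against Pólya-Vinogradov at [n] near [sqrt Q]. *)
Lemma Lval_half_bound Q f : is_primitive_char Q f -> (1 < Q)%N ->
  Cmod (Lval f (RtoC (/ 2))) <= 5 * sqrt (sqrt (INR Q)) * (1 + ln (INR Q)).
Proof.
move=> Hf Q1. apply: clim_le (Lval_half Hf Q1) _ => n. rewrite csum_big.
have Q1' : 1 <= INR Q by rewrite -INR_1; apply: INR_leq; exact: ltnW.
have := @sqrt_weight_bound (fun i => f i.+1) (fun i => / sqrt (INR i.+1)) 1 (INR Q) n Q1' ltac:(lra).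
rewrite Rmult_1_r. apply.
- move=> i. apply: Rinv_le_contravar; first by apply: sqrt_lt_R0; exact: INR_gt0.
  apply: sqrt_le_1_alt. exact: INR_leq.
- move=> i. apply: Rlt_le. apply: Rinv_0_lt_compat. apply: sqrt_lt_R0. exact: INR_gt0.
- move=> i. lra.
- move=> i. exact: (char_norm_le1 (proj1 Hf)).
- move=> M N. have := polya_vinogradov_coprime Hf Q1 1 M N (coprime1n Q).
  by under eq_bigr => k _ do rewrite mul1n add1n.
Qed.

Section CharactersModPrime.
Variables (q g : nat).
Hypothesis pr_q : prime q.
Hypothesis gq : coprime g q.
Hypothesis gP : forall a, coprime a q -> exists k, (k < q.-1)%N /\ g ^ k = a %[mod q].

Let q1 : (1 < q)%N. Proof. exact: prime_gt1. Qed.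
Let q0 : (0 < q)%N. Proof. exact: prime_gt0. Qed.
Notation n := q.-1.
Let n0 : (0 < n)%N. Proof. by rewrite -subn1 subn_gt0. Qed.

Definition gpows : seq nat := [seq (g ^ k %% q)%N | k <- iota 0 n].
(** Discrete logarithm to the base [g]. On multiples of [q] it returns the junk value [n], which
    [qchar] never consults. *)
Definition ind (a : nat) : nat := index (a %% q)%N gpows.

Lemma coprime_lt a : (0 < a < q)%N -> coprime a q.
Proof.
move=> /andP[a0 aq]. rewrite coprime_sym prime_coprime //. apply/negP => /dvdn_leq H. have := H a0. by rewrite leqNgt aq.
Qed.

Lemma mem_gpows a : coprime a q -> (a %% q)%N \in gpows.
Proof. by move=> /gP[k [Hk E]]; apply/mapP; exists k; rewrite ?mem_iota. Qed.

(** Pigeonhole: the [n] nonzero residues all occur in a list of length [n]. *)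
Lemma gpows_uniq : uniq gpows.
Proof.
apply: (@leq_size_uniq _ (iota 1 n)); rewrite ?iota_uniq // ?size_map ?size_iota //.
move=> a; rewrite mem_iota add1n => Ha.
have Haq : (0 < a < q)%N by rewrite prednK in Ha.
have := mem_gpows (coprime_lt Haq). rewrite modn_small //. by case/andP: Haq.
Qed.

Lemma gpows_perm : perm_eq (iota 1 n) gpows.
Proof.
apply: uniq_perm; rewrite ?iota_uniq ?gpows_uniq //.
have sub : {subset iota 1 n <= gpows}.
{ move=> a; rewrite mem_iota add1n => Ha.
  have Haq : (0 < a < q)%N by rewrite prednK in Ha.
  have := mem_gpows (coprime_lt Haq). rewrite modn_small //. by case/andP: Haq. }
have sz : (size gpows <= size (iota 1 n))%N by rewrite size_map !size_iota.
by case: (uniq_min_size (iota_uniq 1 n) sub sz).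
Qed.

Lemma ind_lt a : coprime a q -> (ind a < n)%N.
Proof. by move=> /mem_gpows; rewrite -index_mem size_map size_iota. Qed.

Lemma ind_spec a : coprime a q -> g ^ ind a = a %[mod q].
Proof.
move=> Ha. have := nth_index 0%N (mem_gpows Ha). rewrite -/(ind a) (nth_map 0%N) ?size_iota ?ind_lt //.
by rewrite nth_iota ?ind_lt // add0n.
Qed.

Lemma coprime_gexp k : coprime (g ^ k) q.
Proof. exact: coprimeXl. Qed.

Lemma gexp_n : g ^ n = 1 %[mod q].
Proof. by rewrite -(totient_prime pr_q); exact: Euler_exp_totient. Qed.

Lemma gexp_mod k : g ^ (k %% n) = g ^ k %[mod q].
Proof.
have E : (g ^ k = g ^ (k %% n) * (g ^ n) ^ (k %/ n))%N by rewrite -expnM -expnD addnC (mulnC n) -divn_eq.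
have E2 : (g ^ n) ^ (k %/ n) = 1 %[mod q] by rewrite -modnXm gexp_n modnXm exp1n.
by rewrite [in RHS]E -modnMmr E2 modnMmr muln1.
Qed.

Lemma ind_gexp k : ind (g ^ k) = (k %% n)%N.
Proof.
have Hk : (k %% n < n)%N by rewrite ltn_mod.
rewrite /ind -gexp_mod.
have -> : (g ^ (k %% n) %% q)%N = nth 0%N gpows (k %% n).
{ by rewrite (nth_map 0%N) ?size_iota // nth_iota // add0n. }
by rewrite index_uniq ?gpows_uniq // size_map size_iota.
Qed.

Lemma ind_eqmod a b : a = b %[mod q] -> ind a = ind b.
Proof. by rewrite /ind => ->. Qed.

Lemma indM a b : coprime a q -> coprime b q -> ind (a * b) = ind a + ind b %[mod n].
Proof.
move=> Ha Hb. rewrite -ind_gexp -[RHS]modn_mod.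
have -> : ind (a * b) = ind (g ^ (ind a + ind b)).
{ apply: ind_eqmod. rewrite expnD -modnMml -modnMmr. rewrite -(ind_spec Ha) -(ind_spec Hb).
  by rewrite modnMml modnMmr. }
by rewrite !ind_gexp !modn_mod.
Qed.

Definition qchar (j a : nat) : C := if coprime a q then er n (j * ind a) else RtoC 0.

Lemma qchar_gexp j k : qchar j (g ^ k) = er n (j * k).
Proof.
rewrite /qchar coprime_gexp ind_gexp. apply: (er_eq n0). by rewrite modnMmr.
Qed.

Lemma qchar_eqmod j a b : a = b %[mod q] -> qchar j a = qchar j b.
Proof.
by move=> E; rewrite /qchar (coprime_modn_unit E) (ind_eqmod E).
Qed.

Lemma qchar_norm j a : coprime a q -> Cmod (qchar j a) = 1.
Proof. by move=> H; rewrite /qchar H Cmod_er. Qed.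

Lemma qchar_dirichlet j : is_dirichlet_char q (qchar j).
Proof.
split; first exact/ltP. split; [|split; [|split]].
- move=> a. apply: qchar_eqmod. exact: modnDr.
- move=> a b. rewrite /qchar coprimeMl.
  case: (boolP (coprime a q)) => Ha; case: (boolP (coprime b q)) => Hb /=; rewrite ?Cmult_0_l ?Cmult_0_r //.
  rewrite -er_add //. apply: (er_eq n0). by rewrite -mulnDr -modnMmr indM // modnMmr.
- by rewrite -(expn0 g) qchar_gexp muln0 er0.
- move=> a. rewrite Nat_gcd_gcdn /qchar /coprime. case: eqP => H; split => //.
  move=> E. have := Cmod_er n (j * ind a). rewrite E Cmod_0. lra.
Qed.

Lemma qchar_inj j j' : (j < n)%N -> (j' < n)%N -> qchar j g = qchar j' g -> j = j'.
Proof.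
move=> Hj Hj'. rewrite -(expn1 g) !qchar_gexp !muln1 => E.
have := er_orth n0 j j'.
have -> : \csum_(k < n) (er n (j * k) * Cconj (er n (j' * k))) = RtoC (INR n).
{ rewrite -[RHS]Cmult_1_r -csum_const. apply: eq_bigr => k _. by rewrite (er_pow n0 j) E -er_pow // er_conj. }
move/RtoC_inj. case: eqP => [H _|_]; first by move: H; rewrite !modn_small.
have := INR_gt0 n0. lra.
Qed.

Lemma qchar_primitive j : (0 < j < n)%N -> is_primitive_char q (qchar j).
Proof.
move=> Hj. split; first exact: qchar_dirichlet.
move=> d /Nat_divideP Hd Hlt. exists g.
have d1 : d = 1%N.
{ move/primeP: pr_q => [_ /(_ d Hd) /orP[/eqP //|/eqP E]]. lia. }
split; [by rewrite Nat_gcd_gcdn; apply/eqP|split]; first by rewrite d1 !Nat_mod_modn !modn1.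
rewrite -(expn1 g) qchar_gexp muln1. exact: er_neq1.
Qed.

Lemma big_units (T : Type) (idx : T) (op : Monoid.com_law idx) (F : nat -> T) :
  (forall a b, a = b %[mod q] -> F a = F b) ->
  \big[op/idx]_(1 <= y < q) F y = \big[op/idx]_(k < n) F (g ^ k)%N.
Proof.
move=> HF. rewrite /index_iota subn1 (perm_big _ gpows_perm) /= big_map.
rewrite -[X in iota 0 X]subn0 big_mkord. apply: eq_bigr => k _. apply: HF. exact: modn_mod.
Qed.

(** If [z] differed from every [er n j], all geometric sums of the powers of [z / er n j] would
    vanish; summed over [j], only [k = 0] survives and the total is [n], not 0. *)
Lemma unit_root_er z : (z ^ n = 1)%C -> exists j, (j < n)%N /\ z = er n j.
Proof.
move=> Hz. apply: NNPP => Hno.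
have nz : forall j : 'I_n, \csum_(k < n) ((z * Cconj (er n j)) ^ k) = RtoC 0.
{ move=> j. set w := (z * Cconj (er n j))%C.
  have wn : (w ^ n = 1)%C.
  { rewrite /w Cpow_mult_l Hz Cmult_1_l -Cpow_conj -er_pow // er_mulQ //. by rewrite /Cconj /= Ropp_0. }
  have w1 : w <> RtoC 1.
  { move=> E. apply: Hno. exists j; split=> //.
    rewrite -[LHS]Cmult_1_r -(er_conj n j) (Cmult_comm (er n j)) Cmult_assoc -/w E. ring. }
  have := geom_sum w n. rewrite wn. have -> : (1 - 1 = 0)%C by ring.
  move=> G. apply: NNPP => Hs. apply: (Cmult_neq_0 _ _ _ Hs G). apply: Cminus_eq_contra => H1; exact: w1. }
have : \csum_(j < n) \csum_(k < n) ((z * Cconj (er n j)) ^ k) = RtoC (INR n).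
{ rewrite exchange_big /= (bigD1 (Ordinal n0)) //= [X in (_ + X)%C]big1 => [|k /negbTE k0].
  - rewrite csum_const /=. ring.
  - under eq_bigr => j _ do rewrite Cpow_mult_l.
    rewrite -big_distrr /=.
    have -> : \csum_(j < n) (Cconj (er n j) ^ k) = Cconj (\csum_(j < n) (er n (k * j) * Cconj (er n (0 * j)))).
    { rewrite csum_conj. apply: eq_bigr => j _. rewrite mul0n er0.
      have -> : Cconj (RtoC 1) = RtoC 1 by rewrite /Cconj /= Ropp_0.
      by rewrite Cmult_1_r mulnC er_pow // Cpow_conj. }
    rewrite er_orth // mod0n modn_small //. rewrite -val_eqE /= in k0. rewrite k0 /Cconj /= Ropp_0. exact: Cmult_0_r. }
rewrite big1; last by move=> j _; exact: nz.
move/RtoC_inj. have := INR_gt0 n0. lra.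
Qed.

Lemma qchar_all chi : is_dirichlet_char q chi -> exists j, (j < n)%N /\ forall a, chi a = qchar j a.
Proof.
move=> H.
have [j [Hj E]] : exists j, (j < n)%N /\ chi g = er n j.
{ apply: unit_root_er. rewrite -(char_exp H) -(char1 H). apply: (char_eqmod H). exact: gexp_n. }
exists j; split=> // a. case: (boolP (coprime a q)) => Ha; last by rewrite (char_eq0 H) // /qchar (negbTE Ha).
rewrite -(char_eqmod H (ind_spec Ha)) -(qchar_eqmod j (ind_spec Ha)) (char_exp H) E qchar_gexp er_pow //.
Qed.

Lemma qchar_orth a y : coprime y q ->
  \csum_(j < n) (qchar j a * Cconj (qchar j y)) = RtoC (if a == y %[mod q] then INR n else 0).
Proof.
move=> Hy. case: (boolP (coprime a q)) => Ha.
- under eq_bigr => j _ do rewrite /qchar Ha Hy !(mulnC j).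
  rewrite er_orth //. congr RtoC. congr (if _ then _ else _).
  rewrite (modn_small (ind_lt Ha)) (modn_small (ind_lt Hy)). apply/eqP/eqP => E; last by rewrite (ind_eqmod E).
  by rewrite -(ind_spec Ha) -(ind_spec Hy) E.
- case: eqP => [E|_]; first by rewrite (coprime_modn_unit E) Hy in Ha.
  rewrite big1 // => j _. by rewrite /qchar (negbTE Ha) Cmult_0_l.
Qed.

Lemma qchar_parseval (c : nat -> C) :
  \rsum_(j < n) (Cmod (\csum_(1 <= y < q) (c y * qchar j y)) ^ 2) = INR n * \rsum_(1 <= y < q) (Cmod (c y) ^ 2).
Proof.
apply: RtoC_inj. rewrite RtoC_mult !csum_RtoC big_distrr /=.
transitivity (\csum_(j < n) \csum_(1 <= y < q) \csum_(1 <= x < q) ((c y * Cconj (c x)) * (qchar j y * Cconj (qchar j x)))).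
{ apply: eq_bigr => j _. rewrite Cmod2_conj csum_conj big_distrlr /=. apply: eq_bigr => y _. apply: eq_bigr => x _.
  rewrite Cmult_conj. ring. }
rewrite exchange_big /= !big_nat. apply: eq_bigr => y Hy.
rewrite exchange_big /= (bigD1_seq y) ?iota_uniq ?mem_index_iota //= [X in (_ + X)%C]big1_seq.
- rewrite -big_distrr /= qchar_orth ?eqxx; last exact: coprime_lt. rewrite Cmod2_conj. ring.
- move=> x /andP[xy]; rewrite mem_index_iota => Hx. rewrite -big_distrr /= qchar_orth; last exact: coprime_lt.
  case/andP: Hx => x0 xq; case/andP: Hy => y0 yq.
  rewrite !modn_small //. rewrite eq_sym (negbTE xy). by rewrite Cmult_0_r.
Qed.

End CharactersModPrime.

Lemma dirichlet_char_mul l q psi chi : is_dirichlet_char l psi -> is_dirichlet_char q chi ->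
  is_dirichlet_char (lcmn l q) (fun n => psi n * chi n)%C.
Proof.
move=> Hpsi Hchi. have l0 := char_Q_gt0 Hpsi. have q0 := char_Q_gt0 Hchi.
split; first by apply/ltP; rewrite lcmn_gt0 l0.
split; [|split; [|split]].
- move=> n. rewrite plusE. congr Cmult.
  + apply: (char_eqmod Hpsi). have /dvdnP[k ->] := dvdn_lcml l q. by rewrite addnC modnMDl.
  + apply: (char_eqmod Hchi). have /dvdnP[k ->] := dvdn_lcmr l q. by rewrite addnC modnMDl.
- move=> a b. rewrite multE (char_mul Hpsi) (char_mul Hchi). ring.
- rewrite (char1 Hpsi) (char1 Hchi). ring.
- move=> n. rewrite Nat_gcd_gcdn.
  have E : coprime n (lcmn l q) = coprime n l && coprime n q.
  { apply/idP/andP => [H|[H1 H2]].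
    - by split; apply: coprime_dvdr H; rewrite ?dvdn_lcml ?dvdn_lcmr.
    - apply: (@coprime_dvdr _ (l * q)); last by rewrite coprimeMr H1.
      by rewrite dvdn_lcm dvdn_mulr ?dvdn_mull. }
  split.
  + move=> H0 /eqP. rewrite -/(coprime _ _) E => /andP[H1 H2].
    exact: (Cmult_neq_0 _ _ (char_neq0 Hpsi H1) (char_neq0 Hchi H2)).
  + move=> /eqP. rewrite -/(coprime _ _) E negb_and => /orP[H|H].
    * by rewrite (char_eq0 Hpsi H) Cmult_0_l.
    * by rewrite (char_eq0 Hchi H) Cmult_0_r.
Qed.

Lemma primitive_witness Q f d : is_primitive_char Q f -> (d %| Q)%N -> (d < Q)%N ->
  exists a, [/\ coprime a Q, a = 1 %[mod d] & f a <> RtoC 1].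
Proof.
move=> [Hd /(_ d)] H dQ dlt. have Q0 := char_Q_gt0 Hd.
have [|//|a [Ha [Ha1 Hfa]]] := H; first exact/Nat_divideP.
- exact/ltP.
- exists a; split=> //; first by apply/eqP; rewrite -Nat_gcd_gcdn.
  have d0 : (0 < d)%N by apply: dvdn_gt0 dQ.
  by move: Ha1; rewrite -(prednK d0) !Nat_mod_modn.
Qed.

Lemma primitive_intro Q f : is_dirichlet_char Q f ->
  (forall d, (d %| Q)%N -> (d < Q)%N -> exists a, [/\ coprime a Q, a = 1 %[mod d] & f a <> RtoC 1]) ->
  is_primitive_char Q f.
Proof.
move=> Hd H; split=> // d /Nat_divideP dQ /ltP dlt.
have [a [H1 H2 H3]] := H d dQ dlt. exists a; split; last split=> //.
- by rewrite Nat_gcd_gcdn; apply/eqP.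
- have d0 : (0 < d)%N by apply: dvdn_gt0 dQ; exact: char_Q_gt0 Hd.
  by rewrite -(prednK d0) !Nat_mod_modn prednK.
Qed.

Section Twists.
Variables (q g : nat).
Hypothesis pr_q : prime q.
Hypothesis gq : coprime g q.
Hypothesis gP : forall a, coprime a q -> exists k, (k < q.-1)%N /\ g ^ k = a %[mod q].
Variables (l : nat) (psi : nat -> C).
Hypothesis Hpsi : is_primitive_char l psi.
Hypothesis Hql : ~~ (q * q %| l)%N.

Let q1 : (1 < q)%N. Proof. exact: prime_gt1. Qed.
Let q0 : (0 < q)%N. Proof. exact: prime_gt0. Qed.
Notation n := q.-1.
Let n0 : (0 < n)%N. Proof. by rewrite -subn1 subn_gt0. Qed.
Let Hd : is_dirichlet_char l psi. Proof. by case: Hpsi. Qed.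
Let l0 : (0 < l)%N. Proof. exact: char_Q_gt0 Hd. Qed.

Notation X := (qchar q g).
Definition twist (j : nat) : nat -> C := fun a => (psi a * X j a)%C.
Definition tcond : nat := lcmn l q.

(** Positivity of [j] makes [X j] primitive modulo [q], as membership in the wide set demands;
    primitivity of the product is what Gauss inversion and the central value series require.
    Excluded middle turns the latter into a boolean usable in filtered sums. *)
Definition good (j : nat) : bool :=
  (0 < j)%N && (if excluded_middle_informative (is_primitive_char tcond (twist j)) then true else false).

Lemma good_gt0 j : good j -> (0 < j)%N.
Proof. by case/andP. Qed.

Lemma good_primitive j : good j -> is_primitive_char tcond (twist j).
Proof. by case/andP=> _; case: excluded_middle_informative. Qed.

Lemma tcond_gt1 : (1 < tcond)%N.
Proof. by apply: (leq_trans q1); apply: dvdn_leq (dvdn_lcmr l q); rewrite lcmn_gt0 l0. Qed.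

Lemma twist_dirichlet j : is_dirichlet_char tcond (twist j).
Proof. exact: (dirichlet_char_mul Hd (qchar_dirichlet pr_q gq gP j)). Qed.

Lemma q_dvd_or_coprime : coprime q l \/ exists l', l = (q * l')%N /\ coprime q l'.
Proof.
case: (boolP (q %| l)%N) => H; last by left; rewrite prime_coprime.
right. case/dvdnP: H => l' E. exists l'. rewrite mulnC -E; split=> //.
rewrite prime_coprime //. apply/negP => /dvdnP[k Ek]. move: Hql. rewrite E Ek -mulnA dvdn_mull //.
Qed.

(** If [q] does not divide [l], twisting by any nontrivial character stays primitive by the Chinese
    remainder theorem. If [q] divides [l] exactly once, the twist can lose primitivity only when
    [X j] cancels the [q]-component of [psi], which determines [j]. *)
Lemma bad_small : exists b, forall j, (j < n)%N -> ~~ good j -> j = 0%N \/ j = b.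
Proof.
have notgood : forall j, ~~ good j -> j = 0%N \/ ~ is_primitive_char tcond (twist j).
{ move=> j. rewrite /good negb_and -eqn0Ngt => /orP[/eqP|]; first by left.
  by case: excluded_middle_informative => // ? _; right. }
case: q_dvd_or_coprime => [cq|[l' [El cql']]].
- exists 0%N => j Hj /notgood[|Hn]; first by left.
  left. apply/eqP; apply/negPn/negP => j0. apply: Hn.
  have Elcm : tcond = (l * q)%N.
  { have := muln_lcm_gcd l q. have -> : gcdn l q = 1%N by apply/eqP; rewrite -/(coprime _ _) coprime_sym. by rewrite muln1. }
  have clq : coprime l q by rewrite coprime_sym.
  have crt : forall a b, coprime a l -> coprime b q -> exists x, [/\ x = a %[mod l], x = b %[mod q] & coprime x tcond].
  { move=> a b Ha Hb. exists (chinese l q a b).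
    have E1 := chinese_modl clq a b. have E2 := chinese_modr clq a b.
    split=> //. by rewrite Elcm coprimeMr (coprime_modn_unit E1) (coprime_modn_unit E2) Ha. }
  apply: (primitive_intro (twist_dirichlet j)) => d. rewrite Elcm => Dd Dlt.
  (* If [q] divides [d], then [d / q] is a proper divisor of [l] and [psi] provides the witness;
     otherwise [d] divides [l], and a unit equal to 1 modulo [l] and to [g] modulo [q] works. *)
  case: (boolP (q %| d)%N) => Hqd.
  + case/dvdnP: Hqd => d2 Ed. subst d.
    have d2l : (d2 %| l)%N by move: Dd; rewrite dvdn_pmul2r.
    have d2lt : (d2 < l)%N by move: Dlt; rewrite ltn_pmul2r.
    have [a [Ha Ha1 Hpa]] := primitive_witness Hpsi d2l d2lt.
    have [x [E1 E2 Hx]] := crt a 1%N Ha (coprime1n q).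
    exists x; split=> //; first by rewrite -Elcm.
    * apply/eqP. rewrite chinese_remainder; last by apply: coprime_dvdl d2l clq.
      apply/andP; split; last exact/eqP.
      apply/eqP. rewrite -Ha1. by rewrite -(modn_dvdm x d2l) E1 modn_dvdm.
    * rewrite /twist (char_eqmod Hd E1) (qchar_eqmod g j E2).
      by rewrite (char1 (qchar_dirichlet pr_q gq gP j)) Cmult_1_r.
  + have dl : (d %| l)%N.
    { move: Dd. rewrite Gauss_dvdl // coprime_sym prime_coprime //. }
    have [x [E1 E2 Hx]] := crt 1%N g (coprime1n l) gq.
    exists x; split=> //; first by rewrite -Elcm.
    * by rewrite -(modn_dvdm x dl) E1 modn_dvdm.
    * rewrite /twist (char_eqmod Hd E1) (qchar_eqmod g j E2) (char1 Hd) Cmult_1_l.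
      rewrite -(expn1 g) qchar_gexp // muln1. apply: er_neq1 => //. by rewrite lt0n j0.
- have Elcm : tcond = l.
  { rewrite /tcond El. apply/eqP. rewrite eqn_dvd dvdn_lcml andbT dvdn_lcm dvdnn. exact: dvdn_mulr. }
  have l'0 : (0 < l')%N by move: l0; rewrite El muln_gt0 => /andP[].
  have key : forall j, ~ is_primitive_char tcond (twist j) -> forall x, coprime x l -> x = 1 %[mod l'] -> twist j x = RtoC 1.
  { move=> j Hn x Hx Hx1. apply: NNPP => Hne. apply: Hn.
    apply: (primitive_intro (twist_dirichlet j)) => d. rewrite Elcm => Dd Dlt.
    case: (boolP (q %| d)%N) => Hqd.
    - have [a [Ha Ha1 Hpa]] := primitive_witness Hpsi Dd Dlt.
      exists a; split=> //. rewrite /twist.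
      have E : a = 1 %[mod q] by rewrite -(modn_dvdm a Hqd) Ha1 modn_dvdm.
      by rewrite (qchar_eqmod g j E) (char1 (qchar_dirichlet pr_q gq gP j)) Cmult_1_r.
    - have dl' : (d %| l')%N by move: Dd; rewrite El Gauss_dvdr // coprime_sym prime_coprime.
      exists x; split=> //. by rewrite -(modn_dvdm x dl') Hx1 modn_dvdm. }
  (* A test point seeing only the [q]-component: an imprimitive twist equals 1 there, so [X j g] is
     the inverse of [psi x], and [j] is fixed. *)
  pose x := chinese q l' g 1.
  have E1 := chinese_modl cql' g 1. have E2 := chinese_modr cql' g 1. rewrite -/x in E1 E2.
  have Hx : coprime x l by rewrite El coprimeMr (coprime_modn_unit E1) (coprime_modn_unit E2) gq coprime1n.
  case: (classic (exists b, (b < n)%N /\ ~ is_primitive_char tcond (twist b))) => [[b [Hb Hnb]]|Hno].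
  + exists b => j Hj /notgood[|Hn]; [by left|right].
    apply: (qchar_inj pr_q gq gP Hj Hb).
    have A := key j Hn x Hx E2. have B := key b Hnb x Hx E2.
    rewrite /twist !(qchar_eqmod g _ E1) in A B.
    have C0 := char_neq0 Hd Hx.
    have : (psi x * X j g = psi x * X b g)%C by rewrite A B.
    move=> H. rewrite -[LHS]Cmult_1_l -[RHS]Cmult_1_l -(Cinv_l _ C0) -!Cmult_assoc. by rewrite H.
  + exists 0%N => j Hj /notgood[|Hn]; [by left|]. case: Hno. by exists j.
Qed.

End Twists.

(** * Sums over residue classes *)

Lemma inv_sqrt_antitone a b : (0 < a)%N -> (a <= b)%N -> / sqrt (INR b) <= / sqrt (INR a).
Proof.
move=> a0 ab. apply: Rinv_le_contravar; first by apply: sqrt_lt_R0; exact: INR_gt0.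
apply: sqrt_le_1_alt. exact: INR_leq.
Qed.

Lemma inv_sqrt_gt0 a : (0 < a)%N -> 0 < / sqrt (INR a).
Proof. by move=> a0; apply: Rinv_0_lt_compat; apply: sqrt_lt_R0; exact: INR_gt0. Qed.

Lemma char_sum_zero Q f : is_dirichlet_char Q f -> (exists b, coprime b Q /\ f b <> RtoC 1) ->
  \csum_(a < Q) f a = RtoC 0.
Proof.
move=> Hd [b [Hb Hfb]].
have E : \csum_(a < Q) f a = (f b * \csum_(a < Q) f a)%C.
{ rewrite -[LHS](big_mulmod _ f Hb) big_distrr /=. apply: eq_bigr => a _.
  by rewrite (char_mod Hd) (char_mul Hd). }
set S := bigop _ _ _ in E *.
apply: NNPP => Hne. have E2 : (S * (1 - f b) = 0)%C.
{ have -> : (S * (1 - f b) = S - f b * S)%C by ring. rewrite -E. ring. }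
apply: (Cmult_neq_0 _ _ Hne _ E2). by apply: Cminus_eq_contra => H; apply: Hfb.
Qed.

Lemma big_prog (T : Type) (idx : T) (op : Monoid.com_law idx) (q K : nat) (F : nat -> T) :
  \big[op/idx]_(m < K * q) F m = \big[op/idx]_(y < q) \big[op/idx]_(k < K) F (y + q * k)%N.
Proof.
rewrite exchange_big /=. elim: K => [|K IH]; first by rewrite mul0n !big_ord0.
rewrite mulSn addnC big_split_ord big_ord_recr -IH /=. congr (op _ _).
by apply: eq_bigr => y _; rewrite mulnC addnC.
Qed.

Section ClassSums.
Variables (q l : nat) (psi : nat -> C).
Hypothesis pr_q : prime q.
Hypothesis Hpsi : is_primitive_char l psi.
Hypothesis Hql : ~~ (q * q %| l)%N.
Let q0 : (0 < q)%N. Proof. exact: prime_gt0. Qed.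
Let Hd : is_dirichlet_char l psi. Proof. by case: Hpsi. Qed.
Let l0 : (0 < l)%N. Proof. exact: char_Q_gt0 Hd. Qed.

Definition rho0 : R := 5 * / sqrt (INR q) * sqrt (sqrt (INR l)) * (1 + ln (INR l)).

Lemma lnl_ge0 : 0 <= ln (INR l).
Proof. apply: ln_ge0. rewrite -INR_1. exact: INR_leq. Qed.

Lemma rho0_ge : 5 * / sqrt (INR q) <= rho0.
Proof.
have P := inv_sqrt_gt0 q0. have L := lnl_ge0.
have l1 : 1 <= INR l by rewrite -INR_1; exact: INR_leq.
have S1 : 1 <= sqrt (INR l) by rewrite -sqrt_1; apply: sqrt_le_1_alt.
have S2 : 1 <= sqrt (sqrt (INR l)) by rewrite -sqrt_1; apply: sqrt_le_1_alt.
rewrite /rho0. have : 1 <= sqrt (sqrt (INR l)) * (1 + ln (INR l)) by nra.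
nra.
Qed.

Definition class_sum (K y : nat) : C := \csum_(k < K) (psi (y + q * k)%N * RtoC (/ sqrt (INR (y + q * k)))).

(* When [psi] is constant on the progression the sum over it diverges; the divergent part does
   not depend on the residue class. *)
Definition class_const (K : nat) : R := if (l %| q)%N then \rsum_(k < K.-1) / sqrt (INR (q * k.+1)) else 0.

(** The term [k = 0] is the main term. If [l] divides [q], [psi] is constant along the progression,
    and comparison with the progression of multiples of [q] telescopes to at most [1 / sqrt q].
    Otherwise the weights are at most [1 / sqrt (q k)], and the two forms of Pólya-Vinogradov feed
    [sqrt_weight_bound]. *)
Lemma class_sum_bound K y : (0 < K)%N -> (0 < y < q)%N ->
  Cmod (class_sum K y - psi y * RtoC (/ sqrt (INR y)) - RtoC (class_const K) * psi y)%C <= rho0.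
Proof.
case: K => // K _ /andP[y0 yq].
rewrite /class_sum big_ord_recl /= muln0 addn0.
set T := bigop _ _ _.
have cancel : forall a b c : C, (a + b - a - c = b - c)%C by move=> a b c; ring.
rewrite cancel.
have {T}-> : T = \csum_(k < K) (psi (y + q * k.+1)%N * RtoC (/ sqrt (INR (y + q * k.+1)))) by [].
rewrite /class_const. case: ifP => Hlq.
- apply: Rle_trans rho0_ge.
  have -> : (\csum_(k < K) (psi (y + q * k.+1)%N * RtoC (/ sqrt (INR (y + q * k.+1)))) - RtoC (\rsum_(k < K.+1.-1) / sqrt (INR (q * k.+1))) * psi y = psi y * RtoC (- \rsum_(k < K) (/ sqrt (INR (q * k.+1)) - / sqrt (INR (y + q * k.+1)))))%C.
  { rewrite RtoC_opp !csum_RtoC /=.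
    have -> : \csum_(k < K) (psi (y + q * k.+1)%N * RtoC (/ sqrt (INR (y + q * k.+1)))) = (psi y * \csum_(k < K) RtoC (/ sqrt (INR (y + q * k.+1))))%C.
    { rewrite big_distrr /=. apply: eq_bigr => k _. congr Cmult. apply: (char_eqmod Hd).
      case/dvdnP: Hlq => c ->. by rewrite addnC mulnAC modnMDl. }
    have -> : \csum_(k < K) RtoC (/ sqrt (INR (q * k.+1)) - / sqrt (INR (y + q * k.+1))) = (\csum_(k < K) RtoC (/ sqrt (INR (q * k.+1))) - \csum_(k < K) RtoC (/ sqrt (INR (y + q * k.+1))))%C.
    { rewrite -csum_minus. apply: eq_bigr => k _. exact: RtoC_minus. }
    have ringE : forall p a b : C, (p * a - b * p = p * - (b - a))%C by move=> p a b; ring.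
    exact: ringE. }
  rewrite Cmod_mult Cmod_R Rabs_Ropp Rabs_pos_eq.
  + have H1 := char_norm_le1 Hd y.
    have H2 : \rsum_(k < K) (/ sqrt (INR (q * k.+1)) - / sqrt (INR (y + q * k.+1))) <= / sqrt (INR q) - / sqrt (INR (q * K.+1)).
    { elim: K {H1} => [|K IH]; first by rewrite big_ord0 muln1; lra.
      rewrite big_ord_recr. apply: Rle_trans (Rplus_le_compat_r _ _ _ IH) _. rewrite /=.
      have : / sqrt (INR (q * K.+2)) <= / sqrt (INR (y + q * K.+1)).
      { apply: inv_sqrt_antitone; lia. }
      lra. }
    have P : 0 < / sqrt (INR (q * K.+1)) by apply: inv_sqrt_gt0; rewrite muln_gt0 q0.
    have P2 := inv_sqrt_gt0 q0. have C0 := Cmod_ge_0 (psi y).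
    apply: Rle_trans (_ : 1 * (/ sqrt (INR q)) <= _); last lra.
    apply: Rmult_le_compat => //; last by apply: Rle_trans H2 _; lra.
    apply: rsum_ge0 => k _. have : / sqrt (INR (y + q * k.+1)) <= / sqrt (INR (q * k.+1)) by apply: inv_sqrt_antitone; [rewrite muln_gt0 q0|exact: leq_addl]. lra.
  + apply: rsum_ge0 => k _. have : / sqrt (INR (y + q * k.+1)) <= / sqrt (INR (q * k.+1)) by apply: inv_sqrt_antitone; [rewrite muln_gt0 q0|exact: leq_addl]. lra.
- have -> : (\csum_(k < K) (psi (y + q * k.+1)%N * RtoC (/ sqrt (INR (y + q * k.+1)))) - RtoC 0 * psi y = \csum_(k < K) (psi (y + q * k.+1)%N * RtoC (/ sqrt (INR (y + q * k.+1)))))%C by ring.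
  have l1 : (1 < l)%N by rewrite ltn_neqAle l0 andbT eq_sym; apply/negP => /eqP E; rewrite E dvd1n in Hlq.
  have Hl : 1 <= INR l by rewrite -INR_1; exact: INR_leq.
  have P2 := inv_sqrt_gt0 q0.
  have PV : forall M N, Cmod (\csum_(M <= k < N) psi (y + q * k.+1)%N) <= 2 * sqrt (INR l) * (1 + ln (INR l)).
  { move=> M N.
    have -> : \csum_(M <= k < N) psi (y + q * k.+1)%N = \csum_(M <= k < N) psi ((y + q) + q * k)%N.
    { apply: eq_bigr => k _. by rewrite mulnS addnA. }
    case: (q_dvd_or_coprime pr_q Hql) => [cq|[l' [El _]]]; first exact: polya_vinogradov_coprime.
    apply: (polya_vinogradov_dvd Hpsi l1 _ _ _ El).
    have l'0 : (0 < l')%N by move: l0; rewrite El muln_gt0 => /andP[].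
    rewrite ltn_neqAle l'0 andbT eq_sym; apply/negP => /eqP E. by rewrite El E muln1 dvdnn in Hlq. }
  rewrite /rho0.
  apply: (@sqrt_weight_bound (fun k => psi (y + q * k.+1)%N) (fun k => / sqrt (INR (y + q * k.+1))) _ _ _ Hl) => //.
  + lra.
  + move=> i. apply: inv_sqrt_antitone; first by rewrite addn_gt0 y0. by rewrite leq_add2l leq_pmul2l.
  + move=> i. apply: Rlt_le. apply: inv_sqrt_gt0. by rewrite addn_gt0 y0.
  + move=> i. rewrite -Rinv_mult -sqrt_mult; [|exact: pos_INR|exact: pos_INR]. rewrite -INR_muln.
    apply: inv_sqrt_antitone; [by rewrite muln_gt0 q0|exact: leq_addl].
  + move=> i. exact: (char_norm_le1 Hd).
Qed.

End ClassSums.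

Lemma clim_subseq (u : nat -> C) (phi : nat -> nat) l : (forall n, (n <= phi n)%N) -> clim u l -> clim (fun n => u (phi n)) l.
Proof. move=> Hp H eps He. have [N HN] := H eps He. exists N => n Hn. apply: HN. have := Hp n. lia. Qed.

Section TwistedValues.
Variables (q g : nat).
Hypothesis pr_q : prime q.
Hypothesis gq : coprime g q.
Hypothesis gP : forall a, coprime a q -> exists k, (k < q.-1)%N /\ g ^ k = a %[mod q].
Variables (l : nat) (psi : nat -> C).
Hypothesis Hpsi : is_primitive_char l psi.
Hypothesis Hql : ~~ (q * q %| l)%N.

Let q1 : (1 < q)%N. Proof. exact: prime_gt1. Qed.
Let q0 : (0 < q)%N. Proof. exact: prime_gt0. Qed.
Notation n := q.-1.
Let n0 : (0 < n)%N. Proof. by rewrite -subn1 subn_gt0. Qed.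
Let Hd : is_dirichlet_char l psi. Proof. by case: Hpsi. Qed.

Notation X := (qchar q g).
Notation tw := (twist q g psi).
Notation gd := (good q g l psi).

(** The value 0 at bad indices keeps them in the sums over all characters and at the same time
    excludes them from the nonvanishing count. *)
Definition Lhalf (j : nat) : C := if gd j then Lval (tw j) (RtoC (/ 2)) else RtoC 0.
(** Fourier inversion of [Lhalf] on the unit group: up to the bad indices, the regularised sum of
    [psi(m) / sqrt m] over [m = y] modulo [q]. *)
Definition Lclass (y : nat) : C := (RtoC (/ INR n) * \csum_(j < n) (Lhalf j * Cconj (X j y)))%C.

(** The cut at [K * q - 1] gives every residue class exactly [K] terms, counting [m = 0], whose
    character value is 0. *)
Lemma partial_sum_class K j : (0 < K)%N ->
  csum (fun i => tw j i.+1 * RtoC (/ sqrt (INR i.+1)))%C (K * q).-1 =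
  \csum_(1 <= y < q) (X j y * class_sum q psi K y).
Proof.
move=> K0. have Kq : (0 < K * q)%N by rewrite muln_gt0 K0.
have X0 : forall k, X j (q * k) = RtoC 0.
{ move=> k. rewrite /qchar. case: ifP => //. rewrite coprimeMl => /andP[]. rewrite /coprime gcdnn. lia. }
pose F m := (tw j m * RtoC (/ sqrt (INR m)))%C.
transitivity (\csum_(m < K * q) F m).
{ rewrite csum_big. case: (K * q)%N Kq => // N _. rewrite [RHS]big_ord_recl /F /= /twist.
  have := X0 0%N. rewrite muln0 => ->. rewrite Cmult_0_r Cmult_0_l Cplus_0_l. by apply: eq_bigr. }
rewrite big_prog -(big_mkord xpredT (fun y => \csum_(k < K) F (y + q * k)%N)) big_ltn //.
have Z : \csum_(k < K) F (0 + q * k)%N = RtoC 0.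
{ apply: big1 => k _. by rewrite /F add0n /twist X0 Cmult_0_r Cmult_0_l. }
rewrite Z /= Cplus_0_l. apply: eq_bigr => y _. rewrite /class_sum big_distrr /=. apply: eq_bigr => k _.
rewrite /F /twist. rewrite (qchar_eqmod g j (_ : (y + q * k)%N = y %[mod q])); first by ring.
by rewrite mulnC addnC modnMDl.
Qed.

(** The divergent constant [class_const] multiplies this sum, so it disappears for every good [j]
    before the limit is taken. *)
Lemma good_char_sum j : gd j -> (l %| q)%N -> \csum_(1 <= y < q) (X j y * psi y) = RtoC 0.
Proof.
move=> Hg Hlq. have Hp := good_primitive Hg.
have E : tcond q l = q.
{ apply/eqP. rewrite /tcond eqn_dvd dvdn_lcmr andbT dvdn_lcm Hlq. exact: dvdnn. }
rewrite E in Hp.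
have [b [Hb _ Hfb]] := primitive_witness Hp (dvd1n q) q1.
have := char_sum_zero (proj1 Hp) (ex_intro _ b (conj Hb Hfb)).
rewrite -(big_mkord xpredT (tw j)) big_ltn // (char_eq0 (proj1 Hp)); last by rewrite /coprime gcd0n; lia.
rewrite Cplus_0_l => S0; rewrite -[RHS]S0. apply: eq_bigr => y _. exact: Cmult_comm.
Qed.

Lemma sum_inv_sqrt_range : \rsum_(1 <= y < q) / sqrt (INR y) <= 2 * sqrt (INR n).
Proof.
rewrite -(prednK q0) big_add1 /= big_mkord. exact: sum_inv_sqrt.
Qed.

Lemma inv_sqrt_pred : / sqrt (INR n) <= 3 / 2 * / sqrt (INR q).
Proof.
have Pn := INR_gt0 n0. have Pq := INR_gt0 q0.
have Sn := sqrt_lt_R0 _ Pn. have Sq := sqrt_lt_R0 _ Pq.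
have H : INR q <= 9 / 4 * INR n.
{ have E : INR q = INR n + 1 by rewrite -{1}(prednK q0) S_INR. have : 1 <= INR n by rewrite -INR_1; exact: INR_leq. lra. }
have : sqrt (INR q) <= 3 / 2 * sqrt (INR n).
{ have -> : 3 / 2 * sqrt (INR n) = sqrt (9 / 4 * INR n).
  { rewrite sqrt_mult; [|lra|lra]. congr (_ * _). have -> : 9 / 4 = 3 / 2 * (3 / 2) by field. rewrite sqrt_square; lra. }
  exact: sqrt_le_1_alt. }
move=> HS. have -> : 3 / 2 * / sqrt (INR q) = / (2 / 3 * sqrt (INR q)) by field; lra.
apply: Rinv_le_contravar; lra.
Qed.

Lemma bad_sum_le (F : nat -> R) A : 0 <= A -> (forall j, F j <= A) -> \rsum_(j < n | ~~ gd j) F j <= 2 * A.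
Proof.
move=> A0 HF.
have [b Hb] := bad_small pr_q gq gP Hpsi Hql.
apply: Rle_trans (_ : \rsum_(j < n | ~~ gd j) A <= _).
{ exact: rsum_le. }
apply: Rle_trans (_ : \rsum_(j < n) ((if nat_of_ord j == 0%N then A else 0) + (if nat_of_ord j == b then A else 0)) <= _).
{ apply: Rle_trans (_ : \rsum_(j < n | ~~ gd j) ((if nat_of_ord j == 0%N then A else 0) + (if nat_of_ord j == b then A else 0)) <= _).
  - apply: rsum_le => j Hj. case: (Hb j (ltn_ord j) Hj) => ->; rewrite eqxx; case: ifP => _; lra.
  - apply: (@rsum_sub_le _ (fun j : 'I_n => ~~ gd j) xpredT (fun j : 'I_n => (if nat_of_ord j == 0%N then A else 0) + (if nat_of_ord j == b then A else 0))) => // j.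
    case: ifP => _; case: ifP => _; lra. }
rewrite big_split /=.
have one : forall c, \rsum_(j < n) (if nat_of_ord j == c then A else 0) <= A.
{ move=> c. rewrite -big_mkcond /=. case: (ltnP c n) => Hc.
  - rewrite (big_pred1 (Ordinal Hc)); first lra. by move=> j; apply/eqP/eqP => [E|->//]; apply: val_inj.
  - rewrite big_pred0 // => j. apply/eqP => E. have := ltn_ord j. by rewrite E ltnNge Hc. }
apply: Rle_trans (Rplus_le_compat _ _ _ _ (one 0%N) (one b)) _. lra.
Qed.

(** Over all [j], orthogonality would return the class sum minus its divergent part exactly. The at
    most two bad indices are subtracted; each contributes at most [2 sqrt n + n rho0], harmless
    after division by [n]. *)
Lemma Lclass_approx y : (0 < y < q)%N ->
  Cmod (Lclass y - psi y * RtoC (/ sqrt (INR y)))%C <= 5 * rho0 q l.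
Proof.
move=> Hy.
have Pn := INR_gt0 n0.
have cy := coprime_lt pr_q Hy.
have HR := rho0_ge pr_q Hpsi. have Pq := inv_sqrt_gt0 q0.
have Rpos : 0 <= rho0 q l by lra.
pose PK K j := \csum_(1 <= y < q) (X j y * class_sum q psi K y).
pose u K := (RtoC (/ INR n) * \csum_(j < n) ((if gd j then PK K j else RtoC 0) * Cconj (X j y)))%C.
have Hlim : clim (fun K => u K.+1 - psi y * RtoC (/ sqrt (INR y)))%C (Lclass y - psi y * RtoC (/ sqrt (INR y)))%C.
{ apply: clim_plus; last exact: clim_const.
  apply: clim_scal. apply: (@clim_csum _ (index_enum 'I_n) (fun (j : 'I_n) K => (if gd j then PK K.+1 j else RtoC 0) * Cconj (X j y))%C (fun j : 'I_n => Lhalf j * Cconj (X j y))%C) => j.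
  apply: (clim_ext (fun K => Cconj (X j y) * (if gd j then PK K.+1 j else RtoC 0)))%C; first by move=> K; exact: Cmult_comm.
  rewrite Cmult_comm. apply: clim_scal. rewrite /Lhalf. case: ifP => Hg; last exact: clim_const.
  have := Lval_half (good_primitive Hg) (tcond_gt1 pr_q Hpsi).
  move=> /(@clim_subseq _ (fun K => (K.+1 * q).-1)) H.
  apply: clim_ext (H _) => K; first by rewrite partial_sum_class. nia. }
apply: clim_le Hlim _ => K'.
have K0 : (0 < K'.+1)%N by []. set K := K'.+1 in K0 *.
pose s x := (class_sum q psi K x - RtoC (class_const q l K) * psi x)%C.
have Hs : forall x, (0 < x < q)%N -> Cmod (s x) <= / sqrt (INR x) + rho0 q l.
{ move=> x Hx. have B := class_sum_bound pr_q Hpsi Hql K0 Hx.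
  have -> : s x = (psi x * RtoC (/ sqrt (INR x)) + (class_sum q psi K x - psi x * RtoC (/ sqrt (INR x)) - RtoC (class_const q l K) * psi x))%C by rewrite /s; ring.
  apply: Rle_trans (Cmod_triangle _ _) _. apply: Rplus_le_compat => //.
  rewrite Cmod_mult Cmod_R Rabs_pos_eq; last by apply: Rlt_le; apply: inv_sqrt_gt0; case/andP: Hx.
  have := char_norm_le1 Hd x. have := Cmod_ge_0 (psi x).
  have : 0 < / sqrt (INR x) by apply: inv_sqrt_gt0; case/andP: Hx. nra. }
pose S j := \csum_(1 <= x < q) (X j x * s x).
have PS : forall j, gd j -> PK K j = S j.
{ move=> j Hg.
  have -> : S j = (PK K j - RtoC (class_const q l K) * \csum_(1 <= x < q) (X j x * psi x))%C.
  { rewrite /S /PK big_distrr /= -csum_minus. apply: eq_bigr => x _. rewrite /s. ring. }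
  rewrite /class_const. case: ifP => Hlq; last by ring.
  rewrite good_char_sum //. ring. }
have SB : forall j, Cmod (S j) <= 2 * sqrt (INR n) + INR n * rho0 q l.
{ move=> j. apply: Rle_trans (Cmod_csum _ _ _) _.
  apply: Rle_trans (_ : \rsum_(1 <= x < q) (/ sqrt (INR x) + rho0 q l) <= _).
  - rewrite !big_nat. apply: rsum_le => x Hx. rewrite Cmod_mult qchar_norm; last exact: (coprime_lt pr_q).
    rewrite Rmult_1_l. exact: Hs.
  - rewrite big_split /= rsum_nat_const // subn1. apply: Rplus_le_compat_r. exact: sum_inv_sqrt_range. }
have full : (\csum_(j < n) (S j * Cconj (X j y)) = RtoC (INR n) * s y)%C.
{ under eq_bigr => j _ do rewrite /S big_distrl /=.
  rewrite exchange_big /= (bigD1_seq y) ?iota_uniq ?mem_index_iota //= [X in (_ + X)%C]big1_seq.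
  - transitivity (s y * \csum_(j < n) (X j y * Cconj (X j y)))%C.
    { rewrite Cplus_0_r big_distrr /=. apply: eq_bigr => j _. ring. }
    rewrite (qchar_orth pr_q gP) // eqxx. ring.
  - move=> x /andP[xy]; rewrite mem_index_iota => Hx.
    transitivity (s x * \csum_(j < n) (X j x * Cconj (X j y)))%C.
    { rewrite big_distrr /=. apply: eq_bigr => j _. ring. }
    rewrite (qchar_orth pr_q gP) //. case/andP: Hx => x0 xq; case/andP: Hy => y0 yq.
    rewrite !modn_small // (negbTE xy). exact: Cmult_0_r. }
have split : \csum_(j < n) ((if gd j then PK K j else RtoC 0) * Cconj (X j y)) =
   (RtoC (INR n) * s y - \csum_(j < n | ~~ gd j) (S j * Cconj (X j y)))%C.
{ have E1 : \csum_(j < n) ((if gd j then PK K j else RtoC 0) * Cconj (X j y)) = \csum_(j < n | gd j) (S j * Cconj (X j y)).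
  { rewrite [RHS]big_mkcond. apply: eq_bigr => j _. case: ifP => Hg; [by rewrite PS|exact: Cmult_0_l]. }
  rewrite E1 -full [X in _ = (X - _)%C](bigID (fun j : 'I_n => gd j)).
  have cancel : forall a b : C, a = (a + b - b)%C by move=> a b; ring.
  exact: cancel. }
rewrite /u split.
have -> : (RtoC (/ INR n) * (RtoC (INR n) * s y - \csum_(j < n | ~~ gd j) (S j * Cconj (X j y))) - psi y * RtoC (/ sqrt (INR y)) =
  (class_sum q psi K y - psi y * RtoC (/ sqrt (INR y)) - RtoC (class_const q l K) * psi y) + - (RtoC (/ INR n) * \csum_(j < n | ~~ gd j) (S j * Cconj (X j y))))%C.
{ have E : (RtoC (/ INR n) * RtoC (INR n) = 1)%C by rewrite -RtoC_mult Rinv_l //; lra.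
  rewrite /s. set T := bigop _ _ _. set c := class_sum _ _ _ _. set k := RtoC (class_const _ _ _).
  transitivity ((RtoC (/ INR n) * RtoC (INR n)) * (c - k * psi y) - RtoC (/ INR n) * T - psi y * RtoC (/ sqrt (INR y)))%C; first by ring.
  rewrite E. ring. }
apply: Rle_trans (Cmod_triangle _ _) _. rewrite Cmod_opp.
have B1 := class_sum_bound pr_q Hpsi Hql K0 Hy.
have B2 : Cmod (RtoC (/ INR n) * \csum_(j < n | ~~ gd j) (S j * Cconj (X j y))) <= / INR n * (2 * (2 * sqrt (INR n) + INR n * rho0 q l)).
{ rewrite Cmod_mult Cmod_R Rabs_pos_eq; last by apply: Rlt_le; exact: Rinv_0_lt_compat.
  apply: Rmult_le_compat_l; first by apply: Rlt_le; exact: Rinv_0_lt_compat.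
  apply: Rle_trans (Cmod_csum _ _ _) _.
  apply: (bad_sum_le (F := fun j => Cmod (S j * Cconj (X j y)))).
  - have := sqrt_pos (INR n). nra.
  - move=> j. rewrite Cmod_mult Cmod_conj qchar_norm // Rmult_1_r. exact: SB. }
have E2 : / INR n * (2 * (2 * sqrt (INR n) + INR n * rho0 q l)) = 4 * / sqrt (INR n) + 2 * rho0 q l.
{ have Sn := sqrt_lt_R0 _ Pn. rewrite -{1 3}(sqrt_sqrt (INR n)); last lra. field. lra. }
(* The total is [3 rho0 + 4 / sqrt n], and [4 / sqrt n <= 6 / sqrt q <= 6/5 rho0]; this is below
   [5 rho0]. *)
have := inv_sqrt_pred. lra.
Qed.

End TwistedValues.

(** * The mean square *)

Lemma sqr_le a b : 0 <= a -> a <= b -> a ^ 2 <= b ^ 2.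
Proof. move=> *; nra. Qed.

Section MeanSquare.
Variables (q g : nat).
Hypothesis pr_q : prime q.
Hypothesis gq : coprime g q.
Hypothesis gP : forall a, coprime a q -> exists k, (k < q.-1)%N /\ g ^ k = a %[mod q].

Let q1 : (1 < q)%N. Proof. exact: prime_gt1. Qed.
Let q0 : (0 < q)%N. Proof. exact: prime_gt0. Qed.
Notation n := q.-1.
Let nq : INR n <= INR q. Proof. apply: INR_leq. exact: leq_pred. Qed.
Notation X := (qchar q g).

Lemma qchar_sieve K (a : nat -> C) :
  \rsum_(j < n) (Cmod (\csum_(m < K * q) (a m * X j m)) ^ 2) =
  INR n * \rsum_(1 <= y < q) (Cmod (\csum_(k < K) a (y + q * k)%N) ^ 2).
Proof.
rewrite -(qchar_parseval pr_q gP). apply: eq_bigr => j _. congr (_ ^ 2). congr Cmod.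
rewrite (big_prog _ _ _ (fun m => a m * X j m)%C) -(big_mkord xpredT (fun y => \csum_(k < K) (a (y + q * k)%N * X j (y + q * k)%N))) big_ltn //.
have Z : \csum_(k < K) (a (0 + q * k)%N * X j (0 + q * k)%N) = RtoC 0.
{ apply: big1 => k _. rewrite add0n /qchar coprimeMl.
  have -> : coprime q q = false by rewrite /coprime gcdnn; apply/eqP; lia.
  exact: Cmult_0_r. }
rewrite Z /= Cplus_0_l. apply: eq_bigr => y _. rewrite big_distrl /=. apply: eq_bigr => k _.
by rewrite (qchar_eqmod g j (_ : (y + q * k)%N = y %[mod q])) // mulnC addnC modnMDl.
Qed.

Variables (l : nat) (psi : nat -> C).
Hypothesis Hpsi : is_primitive_char l psi.
Let Hd : is_dirichlet_char l psi. Proof. by case: Hpsi. Qed.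

Notation tw := (twist q g psi).
Notation gd := (good q g l psi).
Notation Q := (tcond q l).
Let Q1 : (1 < Q)%N. Proof. exact: (tcond_gt1 pr_q Hpsi). Qed.
Let Q0 : (0 < Q)%N. Proof. exact: ltnW. Qed.
Let M := (Q %/ q)%N.
Let QM : Q = (M * q)%N. Proof. by rewrite /M divnK //; exact: dvdn_lcmr. Qed.
Let qQ : (q <= Q)%N. Proof. by apply: dvdn_leq => //; exact: dvdn_lcmr. Qed.
Let M0 : (0 < M)%N. Proof. by rewrite /M divn_gt0. Qed.

Definition logQ : R := 1 + ln (INR Q).

Lemma logQ_ge1 : 1 <= logQ.
Proof. rewrite /logQ. have : 0 <= ln (INR Q) by apply: ln_ge0; rewrite -INR_1; exact: INR_leq. lra. Qed.

Lemma Lhalf_bound j : Cmod (Lhalf q g l psi j) <= 5 * sqrt (sqrt (INR Q)) * logQ.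
Proof.
rewrite /Lhalf; case: ifP => Hg; first exact: (Lval_half_bound (good_primitive Hg) Q1).
rewrite Cmod_0. have := logQ_ge1. have := sqrt_pos (sqrt (INR Q)). nra.
Qed.

Definition psum (j N : nat) : C := \csum_(1 <= m < N.+1) tw j m.

(** By [qchar_sieve] the mean square counts coincidences modulo [q]. A class holds at most
    [K = N / q + 1] of the [N] integers. This estimate is the efficient one for [N] up to
    [sqrt Q]. *)
Lemma psum_trivial N : \rsum_(j < n) (Cmod (psum j N) ^ 2) <= INR N ^ 2 + INR q * INR N.
Proof.
pose K := (N %/ q).+1.
have NK : (N < K * q)%N by rewrite /K mulSn addnC [X in (X < _)%N](divn_eq N q) ltn_add2l ltn_mod.
pose a m : C := if (0 < m <= N)%N then psi m else RtoC 0.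
have E : forall j, psum j N = \csum_(m < K * q) (a m * X j m).
{ move=> j. rewrite /psum -(big_mkord xpredT (fun m => a m * X j m)%C).
  rewrite [RHS](big_cat_nat _ _ (n := N.+1)) //= [X in _ = (_ + X)%C]big1_seq ?Cplus_0_r.
  - rewrite [RHS]big_ltn //. rewrite {1}/a /= Cmult_0_l Cplus_0_l !big_nat. apply: eq_bigr => m /andP[m0 mN].
    by rewrite /a m0 -ltnS mN.
  - move=> m /andP[_]; rewrite mem_index_iota => /andP[mN _]. rewrite /a [(m <= N)%N]leqNgt mN andbF. exact: Cmult_0_l. }
under eq_bigr => j _ do rewrite E.
rewrite qchar_sieve.
have an : forall m, Cmod (a m) <= if (0 < m <= N)%N then 1 else 0.
{ move=> m. rewrite /a. case: ifP => _; [exact: (char_norm_le1 Hd)|rewrite Cmod_0; lra]. }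
have B : \rsum_(1 <= y < q) (Cmod (\csum_(k < K) a (y + q * k)%N) ^ 2) <= INR K * INR N.
{ apply: Rle_trans (_ : \rsum_(1 <= y < q) (INR K * \rsum_(k < K) (if (0 < y + q * k <= N)%N then 1 else 0)) <= _).
  - apply: rsum_le => y _. set c := Cmod _.
    have c1 : c <= \rsum_(k < K) (if (0 < y + q * k <= N)%N then 1 else 0).
    { apply: Rle_trans (Cmod_csum _ _ _) _. apply: rsum_le => k _. exact: an. }
    have c2 : c <= INR K.
    { apply: Rle_trans c1 _. rewrite -[INR K]Rmult_1_r -rsum_const. apply: rsum_le => k _. case: ifP => _; lra. }
    have c0 := Cmod_ge_0 (\csum_(k < K) a (y + q * k)%N). rewrite -/c in c0.
    have -> : c ^ 2 = c * c by ring. exact: Rmult_le_compat.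
  - rewrite -big_distrr /=. apply: Rmult_le_compat_l; first exact: pos_INR.
    apply: Rle_trans (_ : \rsum_(y < q) \rsum_(k < K) (if (0 < y + q * k <= N)%N then 1 else 0) <= _).
    + rewrite -(big_mkord xpredT (fun y => \rsum_(k < K) (if (0 < y + q * k <= N)%N then 1 else 0))) [X in _ <= X]big_ltn //.
      have : 0 <= \rsum_(k < K) (if (0 < 0 + q * k <= N)%N then 1 else 0) by apply: rsum_ge0 => k _; case: ifP => _; lra.
      set A := bigop _ _ _; set B := bigop _ _ _ => HA. change (B <= A + B). lra.
    + rewrite -(big_prog _ q K (fun m => if (0 < m <= N)%N then 1 else 0)).
      rewrite -(big_mkord xpredT (fun m => if (0 < m <= N)%N then 1 else 0)) (big_cat_nat _ _ (n := N.+1)) //= [X in _ + X <= _]big1_seq.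
      * rewrite big_ltn //= big_add1 /= big_mkord Rplus_0_l Rplus_0_r -[X in _ <= X]Rmult_1_r -rsum_const.
        apply: rsum_le => m _. case: ifP => _; lra.
      * move=> m /andP[_]; rewrite mem_index_iota => /andP[mN _]. by rewrite [(m <= N)%N]leqNgt mN andbF. }
apply: Rle_trans (Rmult_le_compat_l _ _ _ (pos_INR n) B) _.
have KN : INR K * INR q <= INR N + INR q.
{ rewrite -INR_muln -INR_addn. apply: INR_leq. by rewrite /K mulSn addnC leq_add2r leq_trunc_div. }
have := pos_INR N. have := pos_INR K. have := pos_INR n.
move=> Pn PK PN.
have : INR n * INR K <= INR N + INR q by nra.
nra.
Qed.

(** Gauss inversion exchanges the short sum for a complete sum modulo [Q]. After conjugation it is
    again linear in [X j], so [qchar_sieve] applies a second time. *)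
Lemma good_psum_dual N j : gd j -> Cmod (psum j N) ^ 2 =
  / INR Q * Cmod (\csum_(a < M * q) ((psi a * Cconj (\csum_(1 <= m < N.+1) er Q (a * m))) * X j a)) ^ 2.
Proof.
move=> Hg. have Hp := good_primitive Hg.
have -> : psum j N = (gauss_coef Q (tw j) * \csum_(a < Q) (Cconj (tw j a) * \csum_(1 <= m < N.+1) er Q (a * m)))%C.
{ rewrite /psum. under eq_bigr => m _ do rewrite (char_fourier (proj1 Hp) Hp).
  rewrite -big_distrr /= exchange_big /=. congr Cmult. apply: eq_bigr => a _. by rewrite big_distrr. }
rewrite Cmod_mult Rpow_mult_distr (gauss_coef_norm (proj1 Hp) Hp). congr (_ * _).
- have PQ := INR_gt0 Q0. by rewrite pow_inv /= Rmult_1_r sqrt_sqrt //; lra.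
- rewrite -Cmod_conj csum_conj. congr (_ ^ 2). congr Cmod. rewrite -QM. apply: eq_bigr => a _.
  rewrite Cmult_conj Cconj_conj /twist. ring.
Qed.

(** The frequency [y + q * k] comes within [q] of 0 only for [k = 0], and within [q] of [Q] only for
    [k = M - 1]; there the minimum with the length [N] is retained. *)
Lemma dual_entry_bound N y k : (0 < y < q)%N -> (k < M)%N ->
  Cmod (\csum_(1 <= m < N.+1) er Q ((y + q * k) * m)) <=
    (if k == 0%N then Rmin (INR N) (INR Q / INR y) else INR M / INR k) +
    (if (M.-1 - k == 0)%N then Rmin (INR N) (INR Q / INR (q - y)%N) else INR M / INR (M.-1 - k)%N).
Proof.
move=> /andP[y0 yq] kM.
have aQ : (0 < y + q * k < Q)%N by rewrite addn_gt0 y0 QM /=; nia.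
have B1 := er_interval_bound Q0 1 N.+1 aQ.
have B2 : Cmod (\csum_(1 <= m < N.+1) er Q ((y + q * k) * m)) <= INR N.
{ apply: Rle_trans (Cmod_csum _ _ _) _. under eq_bigr => m _ do rewrite Cmod_er.
  rewrite rsum_nat_const // subn1 /=. lra. }
have PQ := INR_gt0 Q0. have Pq := INR_gt0 q0. have PN := pos_INR N.
have EQ : INR Q = INR M * INR q by rewrite QM INR_muln.
have dl : forall x z, (0 < x)%N -> (x <= z)%N -> INR Q / INR z <= INR Q / INR x.
{ move=> x z x0 xz. apply: Rmult_le_compat_l; first lra. apply: Rinv_le_contravar; [exact: INR_gt0|exact: INR_leq]. }
have mk : forall x, (0 < x)%N -> INR Q / INR (q * x)%N = INR M / INR x.
{ move=> x x0. rewrite INR_muln EQ. have := INR_gt0 x0. move=> ?; field; lra. }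
have E2 : (Q - (y + q * k) = (q - y) + q * (M.-1 - k))%N by rewrite QM; nia.
have U1 : Rmin (INR N) (INR Q / INR (y + q * k)%N) <= if k == 0%N then Rmin (INR N) (INR Q / INR y) else INR M / INR k.
{ case: eqP => [->|/eqP k0]; first by rewrite muln0 addn0; lra.
  apply: Rle_trans (Rmin_r _ _) _. rewrite -mk ?lt0n //. apply: dl; [by rewrite muln_gt0 q0 lt0n|exact: leq_addl]. }
have U2 : Rmin (INR N) (INR Q / INR (Q - (y + q * k))%N) <= (if (M.-1 - k == 0)%N then Rmin (INR N) (INR Q / INR (q - y)%N) else INR M / INR (M.-1 - k)%N).
{ rewrite E2. case: eqP => [->|/eqP k0]; first by rewrite muln0 addn0; lra.
  apply: Rle_trans (Rmin_r _ _) _. rewrite -mk ?lt0n //. apply: dl; [by rewrite muln_gt0 q0 lt0n|exact: leq_addl]. }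
have Pu : 0 <= INR Q / INR (y + q * k)%N by apply: Rdiv_le_0_compat; [lra|apply: INR_gt0; case/andP: aQ].
have Pv : 0 <= INR Q / INR (Q - (y + q * k))%N by apply: Rdiv_le_0_compat; [lra|apply: INR_gt0; rewrite subn_gt0; case/andP: aQ].
apply: Rle_trans (Rplus_le_compat _ _ _ _ U1 U2).
rewrite /Rmin. case: Rle_dec => ?; case: Rle_dec => ?; lra.
Qed.

Lemma dual_row_bound N y : (0 < y < q)%N ->
  \rsum_(k < M) Cmod (\csum_(1 <= m < N.+1) er Q ((y + q * k) * m)) <=
  Rmin (INR N) (INR Q / INR y) + Rmin (INR N) (INR Q / INR (q - y)%N) + 2 * (INR M * logQ).
Proof.
move=> Hy.
apply: Rle_trans (rsum_le _ (fun (k : 'I_M) _ => dual_entry_bound N Hy (ltn_ord k))) _.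
have harm : \rsum_(1 <= k < M) (INR M / INR k) <= INR M * logQ.
{ rewrite -big_distrr /=. apply: Rmult_le_compat_l; first exact: pos_INR.
  apply: Rle_trans (harmonic_lt_bound M0) _. apply: Rplus_le_compat_l. apply: ln_le; first exact: INR_gt0.
  apply: INR_leq. by rewrite QM leq_pmulr. }
have one : forall c, \rsum_(k < M) (if nat_of_ord k == 0%N then c else INR M / INR k) <= c + INR M * logQ.
{ move=> c. rewrite -(big_mkord xpredT (fun k => if k == 0%N then c else INR M / INR k)) big_ltn //.
  apply: Rplus_le_compat_l. apply: Rle_trans harm. apply: Req_le. rewrite !big_nat. apply: eq_bigr => k /andP[k0 _].
  by rewrite -leqn0 leqNgt k0. }
have two : \rsum_(k < M) (if (M.-1 - k == 0)%N then Rmin (INR N) (INR Q / INR (q - y)%N) else INR M / INR (M.-1 - k)%N) <= Rmin (INR N) (INR Q / INR (q - y)%N) + INR M * logQ.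
{ rewrite (reindex_inj rev_ord_inj) /=. apply: Rle_trans (one _). apply: Req_le. apply: eq_bigr => k _.
  have -> // : (M.-1 - (M - k.+1) = k)%N by have := ltn_ord k; lia. }
rewrite big_split. apply: Rle_trans (Rplus_le_compat _ _ _ _ (one (Rmin (INR N) (INR Q / INR y))) two) _. lra.
Qed.

(** The estimate for [N] beyond [sqrt Q]. Since [min(N, Q / y) ^ 2 <= N * Q / y], the near-zero
    frequencies add up to harmonic sums. *)
Lemma psum_dual_bound N : \rsum_(j < n | gd j) (Cmod (psum j N) ^ 2) <= 12 * logQ ^ 2 * (INR q * INR N + INR Q).
Proof.
have PQ := INR_gt0 Q0. have Pq := INR_gt0 q0. have PN := pos_INR N. have PM := INR_gt0 M0. have H1 := logQ_ge1.
have EQ : INR Q = INR M * INR q by rewrite QM INR_muln.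
apply: (Rle_trans _ (/ INR Q * \rsum_(j < n) (Cmod (\csum_(a < M * q) ((psi a * Cconj (\csum_(1 <= m < N.+1) er Q (a * m))) * X j a)) ^ 2))).
{ rewrite big_distrr. apply: (Rle_trans _ (\rsum_(j < n | gd j) (/ INR Q * Cmod (\csum_(a < M * q) ((psi a * Cconj (\csum_(1 <= m < N.+1) er Q (a * m))) * X j a)) ^ 2))).
  - apply: rsum_le => j Hg. rewrite good_psum_dual //. lra.
  - apply: (@rsum_sub_le _ (fun j : 'I_n => gd j) xpredT (fun j : 'I_n => / INR Q * Cmod (\csum_(a < M * q) ((psi a * Cconj (\csum_(1 <= m < N.+1) er Q (a * m))) * X j a)) ^ 2)) => // j.
    apply: Rmult_le_pos; [by apply: Rlt_le; exact: Rinv_0_lt_compat|exact: pow2_ge_0]. }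
rewrite (qchar_sieve M (fun a => psi a * Cconj (\csum_(1 <= m < N.+1) er Q (a * m)))%C).
have row : forall y, (0 < y < q)%N -> Cmod (\csum_(k < M) (psi (y + q * k)%N * Cconj (\csum_(1 <= m < N.+1) er Q ((y + q * k) * m)))) ^ 2 <=
   (3 * INR N * INR Q) * / INR y + (3 * INR N * INR Q) * / INR (q - y)%N + 12 * (INR M * logQ) ^ 2.
{ move=> y Hy. have R := dual_row_bound N Hy.
  have y0 : 0 < INR y by apply: INR_gt0; case/andP: Hy.
  have qy0 : 0 < INR (q - y)%N by apply: INR_gt0; rewrite subn_gt0; case/andP: Hy.
  set u := Rmin _ _ in R. set v := Rmin (INR N) (INR Q / INR (q - y)%N) in R. set w := INR M * logQ in R *.
  set T := Cmod _.
  have TR : T <= u + v + 2 * w.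
  { apply: Rle_trans R. apply: Rle_trans (Cmod_csum _ _ _) _. apply: rsum_le => k _. rewrite Cmod_mult Cmod_conj.
    have := char_norm_le1 Hd (y + q * k). have := Cmod_ge_0 (psi (y + q * k)%N). have := Cmod_ge_0 (\csum_(1 <= m < N.+1) er Q ((y + q * k) * m)). nra. }
  have T0 : 0 <= T by exact: Cmod_ge_0.
  have mm : forall z, 0 < z -> Rmin (INR N) (INR Q / z) ^ 2 <= INR N * INR Q * / z.
  { move=> z z0. have Pz : 0 <= INR Q / z by apply: Rdiv_le_0_compat; lra.
    have -> : INR N * INR Q * / z = INR N * (INR Q / z) by rewrite /Rdiv; ring.
    rewrite /Rmin. case: Rle_dec => ?; nra. }
  have mu : u ^ 2 <= INR N * INR Q * / INR y by exact: mm.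
  have mv : v ^ 2 <= INR N * INR Q * / INR (q - y)%N by exact: mm.
  have : T ^ 2 <= (u + v + 2 * w) ^ 2 by exact: sqr_le.
  have : (u + v + 2 * w) ^ 2 <= 3 * u ^ 2 + 3 * v ^ 2 + 12 * w ^ 2.
  { have := pow2_ge_0 (u - v). have := pow2_ge_0 (u - 2 * w). have := pow2_ge_0 (v - 2 * w). nra. }
  lra. }
have S : \rsum_(1 <= y < q) (Cmod (\csum_(k < M) (psi (y + q * k)%N * Cconj (\csum_(1 <= m < N.+1) er Q ((y + q * k) * m)))) ^ 2) <= 6 * INR N * INR Q * logQ + INR n * (12 * (INR M * logQ) ^ 2).
{ apply: Rle_trans (_ : \rsum_(1 <= y < q) ((3 * INR N * INR Q) * / INR y + (3 * INR N * INR Q) * / INR (q - y)%N + 12 * (INR M * logQ) ^ 2) <= _).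
  { rewrite !big_nat. by apply: rsum_le => y Hy; exact: row. }
  have hq : \rsum_(1 <= y < q) / INR y <= logQ.
  { apply: Rle_trans (harmonic_lt_bound q0) _. apply: Rplus_le_compat_l. apply: ln_le => //. exact: INR_leq. }
  have P3 : 0 <= 3 * INR N * INR Q by nra.
  rewrite !big_split -!big_distrr rsum_nat_const // subn1.
  have -> : \rsum_(1 <= y < q) / INR (q - y)%N = \rsum_(1 <= y < q) / INR y.
  { rewrite big_nat_rev /= !big_nat. apply: eq_bigr => b /andP[b0 bl]. congr (/ INR _). lia. }
  have HA := Rmult_le_compat_l _ _ _ P3 hq.
  apply: Rle_trans (Rplus_le_compat_r _ _ _ (Rplus_le_compat _ _ _ _ HA HA)) _. rewrite /=. lra. }
have PIQ : 0 < / INR Q by exact: Rinv_0_lt_compat.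
have Pn := pos_INR n.
have step : / INR Q * (INR n * (6 * INR N * INR Q * logQ + INR n * (12 * (INR M * logQ) ^ 2))) <= 12 * logQ ^ 2 * (INR q * INR N + INR Q).
{ have -> : / INR Q * (INR n * (6 * INR N * INR Q * logQ + INR n * (12 * (INR M * logQ) ^ 2))) =
     6 * (INR n * INR N) * logQ + 12 * logQ ^ 2 * (/ INR Q * (INR n * INR M) ^ 2) by field; lra.
  have I : / INR Q * (INR n * INR M) ^ 2 <= INR Q.
  { have : (INR n * INR M) ^ 2 <= INR Q ^ 2 by apply: sqr_le; rewrite ?EQ; nra.
    move=> H. have := Rmult_le_compat_l _ _ _ (Rlt_le _ _ PIQ) H. have -> : / INR Q * INR Q ^ 2 = INR Q by field; lra. done. }
  have J : INR n * INR N <= INR q * INR N by nra.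
  have J0 : 0 <= INR n * INR N by nra.
  have L2 : logQ <= logQ ^ 2 by nra.
  have : 12 * logQ ^ 2 * (/ INR Q * (INR n * INR M) ^ 2) <= 12 * logQ ^ 2 * INR Q by apply: Rmult_le_compat_l => //; nra.
  have : INR n * INR N * logQ <= INR q * INR N * logQ ^ 2 by apply: Rmult_le_compat => //; nra.
  nra. }
apply: Rle_trans step. apply: Rmult_le_compat_l; first lra. apply: Rmult_le_compat_l; [lra|exact: S].
Qed.

End MeanSquare.

Lemma inv_sqrt_diff i : / sqrt (INR i.+1) - / sqrt (INR i.+2) <= / sqrt (INR i.+1) * / INR i.+1.
Proof.
have P := INR_gt0 (ltn0Sn i). have E : INR i.+2 = INR i.+1 + 1 by exact: S_INR.
have S1 := sqrt_lt_R0 _ P. have S2 : 0 < sqrt (INR i.+2) by apply: sqrt_lt_R0; lra.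
have E1 := sqrt_sqrt (INR i.+1) ltac:(lra). have E2 := sqrt_sqrt (INR i.+2) ltac:(lra).
set a := sqrt (INR i.+1) in S1 E1 *. set b := sqrt (INR i.+2) in S2 E2 *.
have ab : a <= b by apply: sqrt_le_1_alt; lra.
have -> : / a - / b = / a * ((b - a) * / b) by field; lra.
apply: Rmult_le_compat_l; first by apply: Rlt_le; exact: Rinv_0_lt_compat.
rewrite -E1. apply: (Rmult_le_reg_l (b * (a * a))); first nra.
have -> : b * (a * a) * ((b - a) * / b) = a * a * (b - a) by field; lra.
have -> : b * (a * a) * / (a * a) = b by field; lra.
have : (b - a) * (b + a) = 1 by nra.
move=> D. have : (b - a) * a <= 1 / 2 by nra.
nra.
Qed.

Section MeanSquareValue.
Variables (q g : nat).
Hypothesis pr_q : prime q.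
Hypothesis gq : coprime g q.
Hypothesis gP : forall a, coprime a q -> exists k, (k < q.-1)%N /\ g ^ k = a %[mod q].
Let q0 : (0 < q)%N. Proof. exact: prime_gt0. Qed.
Notation n := q.-1.
Let nq : INR n <= INR q. Proof. apply: INR_leq. exact: leq_pred. Qed.
Notation X := (qchar q g).
Variables (l : nat) (psi : nat -> C).
Hypothesis Hpsi : is_primitive_char l psi.
Notation tw := (twist q g psi).
Notation gd := (good q g l psi).
Notation Q := (tcond q l).
Notation LQ := (logQ q l).
Let Q1 : (1 < Q)%N. Proof. exact: (tcond_gt1 pr_q Hpsi). Qed.
Let Q0 : (0 < Q)%N. Proof. exact: ltnW. Qed.
Let H1 : 1 <= LQ. Proof. exact: (logQ_ge1 pr_q Hpsi). Qed.

(** At the crossover [sqrt Q]: below it [N ^ 2 <= N * sqrt Q] in [psum_trivial], above it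
    [Q <= N * sqrt Q] in [psum_dual_bound]. *)
Lemma psum_bound N : (0 < N)%N ->
  \rsum_(j < n | gd j) (Cmod (psum q g psi j N) ^ 2) <= 12 * LQ ^ 2 * (INR N * (INR q + sqrt (INR Q))).
Proof.
move=> N0. have PN := INR_gt0 N0. have PQ := INR_gt0 Q0. have Pq := INR_gt0 q0.
have SQ := sqrt_lt_R0 _ PQ. have EQ := sqrt_sqrt (INR Q) ltac:(lra).
have L2 : 1 <= LQ ^ 2 by nra.
case: (Rle_lt_dec (INR N) (sqrt (INR Q))) => H.
- apply: Rle_trans (_ : INR N ^ 2 + INR q * INR N <= _).
  + apply: Rle_trans (psum_trivial pr_q gq gP Hpsi N).
    apply: (@rsum_sub_le _ (fun j : 'I_n => gd j) xpredT (fun j : 'I_n => Cmod (psum q g psi j N) ^ 2)) => // j. exact: pow2_ge_0.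
  + have A : INR N ^ 2 + INR q * INR N <= INR N * (INR q + sqrt (INR Q)) by nra.
    have : 0 <= INR N * (INR q + sqrt (INR Q)) by nra. nra.
- apply: Rle_trans (psum_dual_bound pr_q gq gP Hpsi N) _.
  apply: Rmult_le_compat_l; first nra. nra.
Qed.

(** Partial summation up to the conductor. Past [Q], Pólya-Vinogradov meets a weight at most
    [1 / sqrt Q]; this tail and the boundary term at [Q] cost [2 * LQ] each. *)
Lemma good_L_bound j : gd j ->
  Cmod (Lhalf q g l psi j) <= \rsum_(i < Q) (/ sqrt (INR i.+1) * (Cmod (psum q g psi j i.+1) * / INR i.+1)) + 4 * LQ.
Proof.
move=> Hg. have Hp := good_primitive Hg. rewrite /Lhalf Hg.
have := @clim_subseq _ (fun N => N + Q)%N _ (fun N => leq_addr Q N) (Lval_half Hp Q1).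
move=> HL. apply: clim_le HL _ => N.
have PQ := INR_gt0 Q0. have SQ := sqrt_lt_R0 _ PQ.
have PV : forall A B, Cmod (\csum_(A <= k < B) tw j k.+1) <= 2 * sqrt (INR Q) * LQ.
{ move=> A B. have := polya_vinogradov_coprime Hp Q1 1 A B (coprime1n Q).
  by under eq_bigr => k _ do rewrite mul1n add1n. }
have vQ : / sqrt (INR Q.+1) <= / sqrt (INR Q) by apply: inv_sqrt_antitone.
have I : sqrt (INR Q) * / sqrt (INR Q) = 1 by apply: Rinv_r; lra.
have P1 := inv_sqrt_gt0 (ltn0Sn Q).
have KQ : sqrt (INR Q) * / sqrt (INR Q.+1) <= 1 by rewrite -I; apply: Rmult_le_compat_l; lra.
have KL : 2 * sqrt (INR Q) * LQ * / sqrt (INR Q.+1) <= 2 * LQ by nra.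
rewrite csum_big addnC big_split_ord /=.
apply: Rle_trans (Cmod_triangle _ _) _.
have T1 : Cmod (\csum_(i < N) (tw j (Q + i).+1 * RtoC (/ sqrt (INR (Q + i).+1)))) <= 2 * LQ.
{ have := @abel_bound (fun i => tw j (Q + i).+1) (fun i => / sqrt (INR (Q + i).+1)) (2 * sqrt (INR Q) * LQ) N.
  rewrite addn0 => T. apply: Rle_trans (T _ _ _) _.
  - move=> i. apply: inv_sqrt_antitone => //. by rewrite addnS.
  - move=> i. apply: Rlt_le. exact: inv_sqrt_gt0.
  - move=> B. have := PV Q (Q + B)%N. rewrite -[X in \csum_(X <= _ < _) _]add0n big_addn big_mkord addKn.
    by under eq_bigr => i _ do rewrite addnC.
  - exact: KL. }
have T2 : Cmod (\csum_(i < Q) (tw j i.+1 * RtoC (/ sqrt (INR i.+1)))) <=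
   \rsum_(i < Q) (/ sqrt (INR i.+1) * (Cmod (psum q g psi j i.+1) * / INR i.+1)) + 2 * LQ.
{ rewrite (abel_sum (fun i => tw j i.+1) (fun i => / sqrt (INR i.+1))).
  apply: Rle_trans (Cmod_triangle _ _) _. apply: Rplus_le_compat.
  - apply: Rle_trans (Cmod_csum _ _ _) _. apply: rsum_le => i _.
    rewrite Cmod_mult Cmod_R Rabs_pos_eq; last first.
    { have := @inv_sqrt_antitone i.+1 i.+2 isT (leqnSn _). lra. }
    have -> : \csum_(k < i.+1) tw j k.+1 = psum q g psi j i.+1 by rewrite /psum big_add1 big_mkord.
    rewrite (Rmult_comm (/ sqrt _)) Rmult_assoc. apply: Rmult_le_compat_l; first exact: Cmod_ge_0.
    rewrite Rmult_comm. exact: inv_sqrt_diff.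
  - rewrite Cmod_mult Cmod_R Rabs_pos_eq; last exact: Rlt_le.
    apply: Rle_trans KL. apply: Rmult_le_compat_r; first exact: Rlt_le. have := PV 0%N Q. by rewrite big_mkord. }
apply: Rle_trans (Rplus_le_compat _ _ _ _ T2 T1) _.
apply: Req_le. have lin : forall x y : R, x + 2 * y + 2 * y = x + 4 * y by move=> x y; ring.
exact: lin.
Qed.

(** Cauchy-Schwarz distributes [i^(-3/2)] as [i^(-1/2)] times [i^(-1)], so that averaging over [j]
    leaves two harmonic sums, hence [LQ ^ 4] together with [psum_bound]. The constant is
    [2 * 12 + 32]. *)
Lemma L_mean_square :
  \rsum_(j < n) (Cmod (Lhalf q g l psi j) ^ 2) <= 56 * LQ ^ 4 * (INR q + sqrt (INR Q)).
Proof.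
have PQ := INR_gt0 Q0. have Pq := INR_gt0 q0. have SQ := sqrt_lt_R0 _ PQ. have Pn := pos_INR n.
pose A j := \rsum_(i < Q) (/ sqrt (INR i.+1) * (Cmod (psum q g psi j i.+1) * / INR i.+1)).
have iv : forall i, 0 < / INR i.+1 by move=> i; apply: Rinv_0_lt_compat; exact: INR_gt0.
have hs : \rsum_(i < Q) / INR i.+1 <= LQ.
{ have := harmonic_bound Q0. by rewrite big_add1 big_mkord. }
have A0 : forall j, 0 <= A j.
{ move=> j. apply: rsum_ge0 => i _. apply: Rmult_le_pos; first by apply: Rlt_le; exact: inv_sqrt_gt0.
  apply: Rmult_le_pos; [exact: Cmod_ge_0|exact: Rlt_le]. }
have A2 : forall j, A j ^ 2 <= LQ * \rsum_(i < Q) ((Cmod (psum q g psi j i.+1) * / INR i.+1) ^ 2).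
{ move=> j. apply: Rle_trans (cauchy_schwarz _ _ _) _.
  - move=> i. apply: Rlt_le. exact: inv_sqrt_gt0.
  - move=> i. apply: Rmult_le_pos; [exact: Cmod_ge_0|exact: Rlt_le].
  - apply: Rmult_le_compat_r; first by apply: rsum_ge0 => i _; exact: pow2_ge_0.
    apply: Rle_trans hs. apply: Req_le. apply: eq_bigr => i _. rewrite pow_inv pow2_sqrt //. exact: pos_INR. }
have pt : forall j : 'I_n, gd j -> Cmod (Lhalf q g l psi j) ^ 2 <= 2 * A j ^ 2 + 32 * LQ ^ 2.
{ move=> j Hg. have B := good_L_bound Hg. rewrite -/(A j) in B.
  have : Cmod (Lhalf q g l psi j) ^ 2 <= (A j + 4 * LQ) ^ 2 by apply: sqr_le => //; exact: Cmod_ge_0.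
  have := pow2_ge_0 (A j - 4 * LQ). have := A0 j. nra. }
have S2 : \rsum_(j < n | gd j) (A j ^ 2) <= 12 * LQ ^ 4 * (INR q + sqrt (INR Q)).
{ apply: Rle_trans (_ : \rsum_(j < n | gd j) (LQ * \rsum_(i < Q) ((Cmod (psum q g psi j i.+1) * / INR i.+1) ^ 2)) <= _).
  { apply: rsum_le => j _. exact: A2. }
  rewrite -big_distrr exchange_big.
  have in1 : \rsum_(i < Q) \rsum_(j < n | gd j) ((Cmod (psum q g psi j i.+1) * / INR i.+1) ^ 2) <= \rsum_(i < Q) ((12 * LQ ^ 2 * (INR q + sqrt (INR Q))) * / INR i.+1).
  { apply: rsum_le => i _.
    have -> : \rsum_(j < n | gd j) ((Cmod (psum q g psi j i.+1) * / INR i.+1) ^ 2) = (/ INR i.+1) ^ 2 * \rsum_(j < n | gd j) (Cmod (psum q g psi j i.+1) ^ 2).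
    { rewrite big_distrr. apply: eq_bigr => j _. rewrite /=. ring. }
    apply: Rle_trans (Rmult_le_compat_l _ _ _ (pow2_ge_0 _) (psum_bound (ltn0Sn i))) _.
    apply: Req_le. have := INR_gt0 (ltn0Sn i). move=> ?. field. lra. }
  rewrite -big_distrr in in1.
  have c0 : 0 <= 12 * LQ ^ 2 * (INR q + sqrt (INR Q)) by nra.
  have in2 := Rle_trans _ _ _ in1 (Rmult_le_compat_l _ _ _ c0 hs).
  have L0 : 0 <= LQ by lra.
  apply: Rle_trans (Rmult_le_compat_l _ _ _ L0 in2) _. apply: Req_le. ring. }
have -> : \rsum_(j < n) (Cmod (Lhalf q g l psi j) ^ 2) = \rsum_(j < n | gd j) (Cmod (Lhalf q g l psi j) ^ 2).
{ rewrite [RHS]big_mkcond. apply: eq_bigr => j _. case: ifP => // Hg. rewrite /Lhalf Hg Cmod_0. ring. }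
apply: Rle_trans (rsum_le _ pt) _.
rewrite big_split -big_distrr.
have S3 : \rsum_(j < n | gd j) (32 * LQ ^ 2) <= INR n * (32 * LQ ^ 2).
{ rewrite -rsum_const. apply: (@rsum_sub_le _ (fun j : 'I_n => gd j) xpredT (fun j : 'I_n => 32 * LQ ^ 2)) => // _. nra. }
have two : 0 <= 2 by lra.
apply: Rle_trans (Rplus_le_compat _ _ _ _ (Rmult_le_compat_l _ _ _ two S2) S3) _.
have L24 : LQ ^ 2 <= LQ ^ 4.
{ have -> : LQ ^ 4 = LQ ^ 2 * LQ ^ 2 by ring. have : 1 <= LQ ^ 2 by nra. nra. }
have : INR n * (32 * LQ ^ 2) <= INR q * (32 * LQ ^ 4) by apply: Rmult_le_compat => //; nra.
have : 0 <= LQ ^ 4 * sqrt (INR Q) by apply: Rmult_le_pos; [apply: pow_le; lra|lra].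
lra.
Qed.

End MeanSquareValue.

(** * Moments and counting *)

Lemma cprod_conj (I : Type) (r : seq I) (P : pred I) (F : I -> C) :
  Cconj (\big[Cmult/RtoC 1]_(i <- r | P i) F i) = \big[Cmult/RtoC 1]_(i <- r | P i) Cconj (F i).
Proof. by apply: big_morph => [x y|]; [exact: Cmult_conj|rewrite /Cconj /= Ropp_0]. Qed.

Lemma Cmod_cprod (I : Type) (r : seq I) (P : pred I) (F : I -> C) :
  Cmod (\big[Cmult/RtoC 1]_(i <- r | P i) F i) = \big[Rmult/1]_(i <- r | P i) Cmod (F i).
Proof. by apply: big_morph => [x y|]; [exact: Cmod_mult|exact: Cmod_1]. Qed.

Lemma rprod_ge0 (I : Type) (r : seq I) (P : pred I) (F : I -> R) : (forall i, P i -> 0 <= F i) ->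
  0 <= \big[Rmult/1]_(i <- r | P i) F i.
Proof. by move=> H; elim/big_rec: _ => [|i x Pi Hx]; [lra|apply: Rmult_le_pos => //; exact: H]. Qed.

Lemma rprod_le (I : Type) (r : seq I) (P : pred I) (F G : I -> R) :
  (forall i, P i -> 0 <= F i <= G i) ->
  \big[Rmult/1]_(i <- r | P i) F i <= \big[Rmult/1]_(i <- r | P i) G i.
Proof.
move=> H. suff [A B] : 0 <= \big[Rmult/1]_(i <- r | P i) F i /\ \big[Rmult/1]_(i <- r | P i) F i <= \big[Rmult/1]_(i <- r | P i) G i by [].
elim/big_rec2: _ => [|i x y Pi [H1 H2]]; first lra.
have [F0 FG] := H i Pi. split; first exact: Rmult_le_pos. exact: Rmult_le_compat.
Qed.

Lemma rprod_const m (c : R) : \big[Rmult/1]_(i < m) c = c ^ m.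
Proof. by elim: m => [|m IH]; rewrite ?big_ord0 // big_ord_recr IH /= Rmult_comm. Qed.

Lemma rprod_pow (I : Type) (r : seq I) (P : pred I) (F : I -> R) k :
  (\big[Rmult/1]_(i <- r | P i) F i) ^ k = \big[Rmult/1]_(i <- r | P i) (F i ^ k).
Proof. by apply: (big_morph (fun x => x ^ k)) => [x y|]; [exact: Rpow_mult_distr|exact: pow1]. Qed.

Lemma er_sum n m (t : 'I_m -> nat) k : (0 < n)%N ->
  \big[Cmult/RtoC 1]_(i < m) er n (t i * k) = er n ((\sum_(i < m) t i) * k).
Proof.
move=> n0. elim: m t => [|m IH] t; first by rewrite !big_ord0 mul0n er0.
by rewrite !big_ord_recr IH mulnDl er_add.
Qed.

Section Tuples.
Variables (n m : nat).
Hypothesis n0 : (0 < n)%N.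
Variable j0 : nat.

(** In terms of indices to the primitive root, this says that the product of the characters is the
    one of index [j0]. *)
Definition tcompat (t : {ffun 'I_m -> 'I_n}) : bool := (\sum_i (t i : nat) == j0 %[mod n])%N.

(** The congruence on the sum of indices is detected by additive characters modulo [n]; [k] is the
    discrete logarithm of the residue class [y]. *)
Lemma tuple_moment (V : 'I_m -> nat -> C) :
  \csum_(k < n) (er n (j0 * k) * \big[Cmult/RtoC 1]_(i < m) (\csum_(j < n) (V i j * Cconj (er n (j * k))))%R) =
  (RtoC (INR n) * \csum_(t | tcompat t) \big[Cmult/RtoC 1]_(i < m) V i (t i))%C.
Proof.
have T k : \big[Cmult/RtoC 1]_(i < m) (\csum_(j < n) (V i j * Cconj (er n (j * k))))%R =
  \csum_(t : {ffun 'I_m -> 'I_n} | true) (\big[Cmult/RtoC 1]_(i < m) (V i (t i) * Cconj (er n (t i * k)))%C).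
{ exact: (bigA_distr_bigA (fun (i : 'I_m) (j : 'I_n) => (V i j * Cconj (er n (j * k)))%C)). }
transitivity (\csum_(k < n) \csum_(t : {ffun 'I_m -> 'I_n} | true) (er n (j0 * k) * \big[Cmult/RtoC 1]_(i < m) (V i (t i) * Cconj (er n (t i * k)))%C)).
{ apply: eq_bigr => k _. by rewrite T big_distrr. }
rewrite exchange_big big_distrr [RHS]big_mkcond. apply: eq_bigr => t _.
transitivity ((\big[Cmult/RtoC 1]_(i < m) V i (t i)) * \csum_(k < n) (er n (j0 * k) * Cconj (er n ((\sum_i (t i : nat)) * k))))%C.
{ rewrite big_distrr. apply: eq_bigr => k _. rewrite big_split /= -cprod_conj (er_sum (fun i => t i) k n0).
  have swap : forall a b c : C, (a * (b * c) = b * (a * c))%C by move=> a b c; ring.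
  exact: swap. }
rewrite (er_orth n0) /tcompat eq_sym. case: eqP => _; [exact: Cmult_comm|exact: Cmult_0_r].
Qed.

(** The last coordinate is determined by the others. Bounding its factor by [B] frees the sum over
    the remaining coordinates, which then factors. *)
Lemma tuple_second_moment (a : 'I_m.+1 -> 'I_n -> R) (B D : R) (Pt : pred {ffun 'I_m.+1 -> 'I_n}) :
  (forall t s, Pt t -> Pt s -> (forall i, i != ord_max -> t i = s i) -> t = s) ->
  (forall i j, 0 <= a i j) -> (forall j, a ord_max j <= B) -> 0 <= B ->
  (forall i, \rsum_(j < n) a i j <= D) ->
  \rsum_(t | Pt t) \big[Rmult/1]_(i < m.+1) a i (t i) <= B * D ^ m.
Proof.
move=> Hinj a0 aB B0 HD.
pose z : 'I_n := Ordinal n0.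
pose h (t : {ffun 'I_m.+1 -> 'I_n}) : {ffun 'I_m.+1 -> 'I_n} := [ffun i => if i == ord_max then z else t i].
(* An indicator at [z] in the last slot: the image of [h] then sits inside a full product sum whose
   last factor is 1. *)
pose b (i : 'I_m.+1) (j : 'I_n) : R := if i == ord_max then (if j == z then 1 else 0) else a i j.
have b0 : forall i j, 0 <= b i j by move=> i j; rewrite /b; case: ifP => _; [case: ifP => _; lra|exact: a0].
pose G (t : {ffun 'I_m.+1 -> 'I_n}) := \big[Rmult/1]_(i < m.+1) b i (t i).
have G0 : forall t, 0 <= G t by move=> t; apply: rprod_ge0 => i _; exact: b0.
have hinj : {in [set t | Pt t] &, injective h}.
{ move=> t s; rewrite !inE => Ht Hs E. apply: Hinj => // i /negbTE Hi.
  have := congr1 (fun f : {ffun 'I_m.+1 -> 'I_n} => f i) E. by rewrite /h !ffunE Hi. }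
have pt : forall t : {ffun 'I_m.+1 -> 'I_n}, \big[Rmult/1]_(i < m.+1) a i (t i) <= B * G (h t).
{ move=> t. rewrite /G !big_ord_recr /=.
  have -> : b ord_max (h t ord_max) = 1 by rewrite /b /h ffunE !eqxx.
  rewrite Rmult_1_r Rmult_comm.
  have E : \big[Rmult/1]_(i < m) b (widen_ord (leqnSn m) i) (h t (widen_ord (leqnSn m) i)) = \big[Rmult/1]_(i < m) a (widen_ord (leqnSn m) i) (t (widen_ord (leqnSn m) i)).
  { apply: eq_bigr => i _. have Hi : (widen_ord (leqnSn m) i == ord_max) = false by apply/negbTE; rewrite neq_ltn /= ltn_ord.
    by rewrite /b /h ffunE Hi. }
  rewrite E. apply: Rmult_le_compat_r => //. apply: rprod_ge0 => i _. exact: a0. }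
apply: Rle_trans (rsum_le _ (fun t _ => pt t)) _.
rewrite -big_distrr. apply: Rmult_le_compat_l => //.
apply: Rle_trans (_ : \rsum_(s | true) G s <= _).
{ have -> : \rsum_(t | Pt t) G (h t) = \big[Rplus/0]_(t in [set t | Pt t]) G (h t) by apply: eq_bigl => t; rewrite inE.
  rewrite -(big_imset G hinj).
  exact: (@rsum_sub_le _ (fun s => s \in [set h x | x in [set t | Pt t]]) xpredT G). }
rewrite /G -(bigA_distr_bigA b) big_ord_recr /=.
have -> : \rsum_(j < n) b ord_max j = 1.
{ rewrite (bigD1 z) //= big1 /b ?eqxx; first by ring. by move=> j /negbTE ->. }
rewrite Rmult_1_r -rprod_const. apply: rprod_le => i _.
have Hi : (widen_ord (leqnSn m) i == ord_max) = false by apply/negbTE; rewrite neq_ltn /= ltn_ord.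
split; first by apply: rsum_ge0 => j _; exact: b0.
rewrite /b Hi. exact: HD.
Qed.

Lemma tcompat_inj (t s : {ffun 'I_m -> 'I_n}) (i0 : 'I_m) : tcompat t -> tcompat s ->
  (forall i, i != i0 -> t i = s i) -> t = s.
Proof.
rewrite /tcompat => /eqP Ht /eqP Hs H. apply/ffunP => i. case: (eqVneq i i0) => [->|]; last exact: H.
move: Ht. rewrite -Hs (bigD1 i0) //= [in RHS](bigD1 i0) //= (eq_bigr (fun i => (s i : nat))); last by move=> k Hk; rewrite H.
move=> /eqP. rewrite eqn_modDr !modn_small // => /eqP. exact: val_inj.
Qed.

End Tuples.

Section NonvanishingCount.
Variables (n m j0 : nat).
Hypothesis n0 : (0 < n)%N.
Variable V : 'I_m.+1 -> nat -> C.

Definition nonvanishing : {set {ffun 'I_m.+1 -> 'I_n}} :=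
  [set t | tcompat j0 t && [forall i, if excluded_middle_informative (V i (t i : nat) = RtoC 0) then false else true]].

Lemma nonvanishingP t : t \in nonvanishing -> tcompat j0 t /\ forall i, V i (t i : nat) <> RtoC 0.
Proof.
rewrite inE => /andP[H1 /forallP H2]; split=> // i. have := H2 i. by case: excluded_middle_informative.
Qed.

Lemma nonvanishing_lower (B D : R) :
  (forall j : 'I_n, Cmod (V ord_max j) ^ 2 <= B) -> 0 <= B ->
  (forall i, \rsum_(j < n) (Cmod (V i j) ^ 2) <= D) ->
  Cmod (\csum_(t : {ffun 'I_m.+1 -> 'I_n} | tcompat j0 t) \big[Cmult/RtoC 1]_(i < m.+1) V i (t i : nat)) ^ 2
    <= INR #|nonvanishing| * (B * D ^ m).
Proof.
move=> HB B0 HD.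
pose W (t : {ffun 'I_m.+1 -> 'I_n}) := \big[Cmult/RtoC 1]_(i < m.+1) V i (t i : nat).
have E : \csum_(t : {ffun 'I_m.+1 -> 'I_n} | tcompat j0 t) W t = \csum_(t : {ffun 'I_m.+1 -> 'I_n} | t \in nonvanishing) W t.
{ rewrite [LHS]big_mkcond [RHS]big_mkcond. apply: eq_bigr => t _.
  case: (boolP (t \in nonvanishing)) => [/nonvanishingP[-> _] //|].
  rewrite inE. case: (tcompat j0 t) => //=. rewrite negb_forall => /existsP[i].
  case: excluded_middle_informative => // Vi _. rewrite /W (bigD1 i) //= Vi. exact: Cmult_0_l. }
rewrite [X in Cmod X]E.
have W0 : forall t, 0 <= Cmod (W t) by move=> t; exact: Cmod_ge_0.
apply: Rle_trans (_ : (\rsum_(t : {ffun 'I_m.+1 -> 'I_n} | t \in nonvanishing) (1 * Cmod (W t))) ^ 2 <= _).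
{ apply: sqr_le; first exact: Cmod_ge_0. apply: Rle_trans (Cmod_csum _ _ _) _. apply: rsum_le => t _. lra. }
apply: Rle_trans (cauchy_schwarz _ _ W0) _; first by move=> t; lra.
have -> : \rsum_(t : {ffun 'I_m.+1 -> 'I_n} | t \in nonvanishing) (1 ^ 2) = INR #|nonvanishing|.
{ rewrite -sum1_card (big_morph INR INR_addn (erefl (INR 0))). apply: eq_bigr => t _. rewrite INR_1. ring. }
apply: Rmult_le_compat_l; first exact: pos_INR.
apply: Rle_trans (_ : \rsum_(t : {ffun 'I_m.+1 -> 'I_n} | tcompat j0 t) (Cmod (W t) ^ 2) <= _).
{ apply: (@rsum_sub_le _ (fun t => t \in nonvanishing) (fun t => tcompat j0 t) (fun t => Cmod (W t) ^ 2)).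
  - move=> t. exact: pow2_ge_0.
  - by move=> t /nonvanishingP[]. }
apply: Rle_trans (@tuple_second_moment n m n0 (fun i j => Cmod (V i j) ^ 2) B D (fun t => tcompat j0 t) _ _ HB B0 HD).
- apply: Req_le. apply: eq_bigr => t _. by rewrite /W Cmod_cprod rprod_pow.
- move=> t s Ht Hs H. exact: tcompat_inj Ht Hs H.
- move=> i j. exact: pow2_ge_0.
Qed.

End NonvanishingCount.

(** * The main term and its stability under perturbation *)

Lemma INR2 : INR 2 = 2.
Proof. by rewrite S_INR INR_1; lra. Qed.

(** Convexity: [x^(-3/2)] is at most the integral of half of it over [[x - 1, x + 1]], which is the
    difference of the inverse square roots at the endpoints. *)
Lemma odd_term_telescopes z :
  / sqrt (INR (2 * z.+1 + 1)) * / INR (2 * z.+1 + 1) <= / sqrt (INR (2 * z.+1)) - / sqrt (INR (2 * z.+2)).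
Proof.
have E1 : INR (2 * z.+1) = INR (2 * z.+1 + 1) - 1 by rewrite INR_addn INR_1; ring.
have E2 : INR (2 * z.+2) = INR (2 * z.+1 + 1) + 1 by rewrite -S_INR; congr INR; lia.
have X2 : INR 2 <= INR (2 * z.+1 + 1) by apply: INR_leq; lia.
rewrite INR2 in X2.
rewrite E1 E2. set x := INR (2 * z.+1 + 1) in X2 *.
have Sa : 0 < sqrt (x - 1) by apply: sqrt_lt_R0; lra. have Sb : 0 < sqrt (x + 1) by apply: sqrt_lt_R0; lra.
have Sx : 0 < sqrt x by apply: sqrt_lt_R0; lra.
have Ea := sqrt_sqrt (x - 1) ltac:(lra). have Eb := sqrt_sqrt (x + 1) ltac:(lra). have Ex := sqrt_sqrt x ltac:(lra).
set a := sqrt (x - 1) in Sa Ea *. set b := sqrt (x + 1) in Sb Eb *. set s := sqrt x in Sx Ex *.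
have ab : a * b <= x.
{ have P : (a * b) ^ 2 <= x ^ 2.
  { have -> : (a * b) ^ 2 = (a * a) * (b * b) by ring. rewrite Ea Eb. nra. }
  apply: Rnot_lt_le => H. have : 0 < a * b by nra. nra. }
have apb : a + b <= 2 * s.
{ apply: Rnot_lt_le => H. have : (a + b) * (a + b) <= 4 * x by nra. nra. }
have D : (b - a) * (a + b) = 2 by nra.
have -> : / a - / b = (b - a) * / (a * b) by field; lra.
have ba : / s <= b - a.
{ apply: (Rmult_le_reg_r s) => //. rewrite Rinv_l; last lra. nra. }
have I : / x <= / (a * b) by apply: Rinv_le_contravar; nra.
have Is : 0 < / s by exact: Rinv_0_lt_compat. have Ix : 0 < / x by apply: Rinv_0_lt_compat; lra.
apply: Rmult_le_compat; lra.
Qed.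

(* Removing the factor at 2 leaves a series over the odd integers, whose terms beyond the first
   add up to at most [1 / sqrt 2 < 1]. *)
Lemma main_term_lower (a : nat -> C) h : (50 <= h)%N ->
  (forall y, a (2 * y)%N = (a 2%N * a y)%C) -> a 1%N = RtoC 1 ->
  (forall y, (0 < y)%N -> Cmod (a y) <= / sqrt (INR y) * / INR y) ->
  1 / 10 <= Cmod (\csum_(1 <= y < (2 * h).+1) a y).
Proof.
move=> Hh aM a1 aB.
have Ph : INR 50 <= INR h by exact: INR_leq.
have E50 : INR 50 = 50 by rewrite INR_IZR_INZ.
rewrite E50 in Ph.
set S := bigop _ _ _.
have S1 : S = (\csum_(z < h) a (2 * z + 1)%N + \csum_(z < h) a (2 * z.+1)%N)%C.
{ rewrite /S big_add1 /= big_mkord -big_split /=. elim: h {Hh S Ph} => [|h IH]; first by rewrite !big_ord0.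
  rewrite mulnS !big_ord_recr /= IH -Cplus_assoc. congr (_ + (a _ + a _))%C; lia. }
have S2 : (a 2%N * S = \csum_(z < h) a (2 * z.+1)%N + \csum_(z < h) a (2 * (h + z).+1)%N)%C.
{ rewrite /S big_add1 /= big_mkord big_distrr /= mul2n -addnn big_split_ord /=.
  by congr Cplus; apply: eq_bigr => z _; rewrite aM. }
(* The even terms of [S] cancel those terms of [a 2 * S] that stay in range; only the terms beyond
   [2 h] are left over. *)
have S3 : ((1 - a 2%N) * S = \csum_(z < h) a (2 * z + 1)%N - \csum_(z < h) a (2 * (h + z).+1)%N)%C.
{ have -> : ((1 - a 2%N) * S = S - a 2%N * S)%C by ring. rewrite S2 {1}S1.
  have cancel : forall x y w : C, (x + y - (y + w) = x - w)%C by move=> x y w; ring.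
  exact: cancel. }
have r2 : sqrt 2 * sqrt 2 = 2 by apply: sqrt_sqrt; lra.
have r2p : 0 < sqrt 2 by apply: sqrt_lt_R0; lra.
have r2b : 141 / 100 <= sqrt 2.
{ have -> : 141 / 100 = sqrt (141 / 100 * (141 / 100)) by rewrite sqrt_square; lra. apply: sqrt_le_1_alt. lra. }
have odds : 29 / 100 <= Cmod (\csum_(z < h) a (2 * z + 1)%N).
{ case: h Hh {S S1 S2 S3 Ph} => // h _. rewrite big_ord_recl /= a1.
  have tail : Cmod (\csum_(z < h) a (2 * z.+1 + 1)%N) <= / sqrt 2.
  { apply: Rle_trans (Cmod_csum _ _ _) _.
    apply: Rle_trans (_ : \rsum_(z < h) (/ sqrt (INR (2 * z.+1)) - / sqrt (INR (2 * z.+2))) <= _).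
    { apply: rsum_le => z _. apply: Rle_trans (aB _ _) _; first by rewrite addn1. exact: odd_term_telescopes. }
    apply: Rle_trans (_ : / sqrt 2 - / sqrt (INR (2 * h.+1)) <= _).
    - elim: h => [|h IH]; first by rewrite big_ord0 muln1 INR2; lra.
      rewrite big_ord_recr. apply: Rle_trans (Rplus_le_compat_r _ _ _ IH) _. rewrite /=. lra.
    - have : 0 < / sqrt (INR (2 * h.+1)) by apply: inv_sqrt_gt0. lra. }
  have -> : \csum_(i < h) a (2 * bump 0 i + 1)%N = \csum_(z < h) a (2 * z.+1 + 1)%N by apply: eq_bigr.
  set T := bigop _ _ _ in tail *.
  have E1 : RtoC 1 = ((1 + T) + - T)%C by ring.
  have := Cmod_triangle (1 + T) (- T). rewrite -E1 Cmod_1 Cmod_opp.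
  have : / sqrt 2 <= 71 / 100.
  { have -> : 71 / 100 = / (100 / 71) by field. apply: Rinv_le_contravar; lra. }
  lra. }
have rest : Cmod (\csum_(z < h) a (2 * (h + z).+1)%N) <= 5 / 100.
(* There are [h] terms, each at most [1/10] times [1 / (2 h)]; [h >= 50] gives
   [sqrt (2 h) >= 10]. *)
{ apply: Rle_trans (Cmod_csum _ _ _) _.
  have Q10 : 10 <= sqrt (2 * INR h).
  { have -> : 10 = sqrt (10 * 10) by rewrite sqrt_square; lra. apply: sqrt_le_1_alt. lra. }
  apply: Rle_trans (_ : \rsum_(z < h) (/ 10 * / (2 * INR h)) <= _).
  - apply: rsum_le => z _. apply: Rle_trans (aB _ _) _; first by rewrite muln_gt0.
    have Hz : 2 * INR h <= INR (2 * (h + z).+1).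
    { rewrite -{1}INR2 -INR_muln. apply: INR_leq. lia. }
    apply: Rmult_le_compat.
    + apply: Rlt_le. apply: inv_sqrt_gt0. by rewrite muln_gt0.
    + apply: Rlt_le. apply: Rinv_0_lt_compat. lra.
    + apply: Rinv_le_contravar; first lra. apply: Rle_trans Q10 _. exact: sqrt_le_1_alt.
    + apply: Rinv_le_contravar; lra.
  - rewrite rsum_const. apply: Req_le. field. lra. }
have a2 : Cmod (a 2%N) <= 36 / 100.
{ apply: Rle_trans (aB 2%N isT) _. rewrite INR2.
  have : / sqrt 2 <= 71 / 100.
  { have -> : 71 / 100 = / (100 / 71) by field. apply: Rinv_le_contravar; lra. }
  lra. }
have L : 24 / 100 <= Cmod ((1 - a 2%N) * S).
{ rewrite S3. set U := \csum_(z < h) a (2 * z + 1)%N in odds *. set W := \csum_(z < h) a (2 * (h + z).+1)%N in rest *.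
  have E1 : U = ((U - W) + W)%C by ring. have := Cmod_triangle (U - W) W. rewrite -E1. lra. }
rewrite Cmod_mult in L.
have : Cmod (1 - a 2%N) <= 136 / 100.
{ apply: Rle_trans (Cmod_triangle _ _) _. rewrite Cmod_1 Cmod_opp. lra. }
have := Cmod_ge_0 S. have := Cmod_ge_0 (1 - a 2%N). nra.
Qed.

Lemma pow_sum_le k x y : 0 <= x -> 0 <= y -> (x + y) ^ k <= 2 ^ k * (x ^ k + y ^ k).
Proof.
move=> x0 y0. have P2 : 0 <= 2 ^ k by apply: pow_le; lra.
have Px : 0 <= x ^ k by exact: pow_le. have Py : 0 <= y ^ k by exact: pow_le.
case: (Rle_lt_dec x y) => H.
- apply: Rle_trans (_ : (2 * y) ^ k <= _); first by apply: pow_incr; lra. rewrite Rpow_mult_distr. nra.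
- apply: Rle_trans (_ : (2 * x) ^ k <= _); first by apply: pow_incr; lra. rewrite Rpow_mult_distr. nra.
Qed.

Lemma pow_diff_le k u r : 0 <= u -> 0 <= r -> (u + r) ^ k.+1 - u ^ k.+1 <= INR k.+1 * r * (u + r) ^ k.
Proof.
move=> u0 r0. elim: k => [|k IH]; first by rewrite INR_1 /=; lra.
have P : 0 <= (u + r) ^ k by apply: pow_le; lra.
have Pu : u ^ k.+1 <= (u + r) ^ k.+1 by apply: pow_incr; lra.
rewrite (S_INR k.+1).
change ((u + r) ^ k.+2) with ((u + r) * (u + r) ^ k.+1). change (u ^ k.+2) with (u * u ^ k.+1).
have E : (u + r) * (u + r) ^ k = (u + r) ^ k.+1 by [].
have := Rmult_le_compat_r (u + r) _ _ ltac:(lra) IH. nra.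
Qed.

Lemma cprod_diff_le m (z w : 'I_m -> C) u r : 0 <= u -> 0 <= r ->
  (forall i, Cmod (w i) <= u) -> (forall i, Cmod (z i - w i) <= r) ->
  Cmod (\big[Cmult/RtoC 1]_(i < m) z i - \big[Cmult/RtoC 1]_(i < m) w i) <= (u + r) ^ m - u ^ m.
Proof.
move=> u0 r0. elim: m z w => [|m IH] z w Hw Hz.
{ rewrite !big_ord0. have -> : (1 - 1 = 0)%C by ring. rewrite Cmod_0 /=. lra. }
rewrite !big_ord_recr /=.
have {}IH := IH (fun i => z (widen_ord (leqnSn m) i)) (fun i => w (widen_ord (leqnSn m) i)) (fun i => Hw _) (fun i => Hz _).
set A := \big[Cmult/RtoC 1]_(i < m) z _ in IH *. set B := \big[Cmult/RtoC 1]_(i < m) w _ in IH *.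
have HB : Cmod B <= u ^ m.
{ rewrite /B Cmod_cprod -rprod_const. apply: rprod_le => i _. split; [exact: Cmod_ge_0|exact: Hw]. }
have Hzm : Cmod (z ord_max) <= u + r.
{ have -> : z ord_max = (w ord_max + (z ord_max - w ord_max))%C by ring.
  apply: Rle_trans (Cmod_triangle _ _) _. have := Hw ord_max. have := Hz ord_max. lra. }
have -> : (A * z ord_max - B * w ord_max = (A - B) * z ord_max + B * (z ord_max - w ord_max))%C by ring.
apply: Rle_trans (Cmod_triangle _ _) _. rewrite !Cmod_mult.
have A1 : Cmod (A - B) * Cmod (z ord_max) <= ((u + r) ^ m - u ^ m) * (u + r) by apply: Rmult_le_compat => //; exact: Cmod_ge_0.
have A2 : Cmod B * Cmod (z ord_max - w ord_max) <= u ^ m * r by apply: Rmult_le_compat => //; exact: Cmod_ge_0.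
lra.
Qed.

(** For each [y] the products differ by at most [m r (u + r)^(m-1)] with [u = y^(-1/2)], where [m]
    here stands for [m.+3]. Having at least three factors gives [u^(m-1) <= 1 / y], so the sum over
    [y] costs [r] times a logarithm plus [q * r^m]. *)
Lemma perturbed_moment_lower (q m h : nat) (chi : nat -> C) (Z w : 'I_m.+3 -> nat -> C) (r : R) :
  q = (2 * h).+1 -> (50 <= h)%N -> 0 <= r ->
  (forall y, Cmod (chi y) <= 1) ->
  (forall i y, (0 < y < q)%N -> Cmod (w i y) <= / sqrt (INR y)) ->
  (forall i y, (0 < y < q)%N -> Cmod (Z i y - w i y) <= r) ->
  1 / 10 <= Cmod (\csum_(1 <= y < q) (chi y * \big[Cmult/RtoC 1]_(i < m.+3) w i y)) ->
  INR m.+3 * 2 ^ m.+3 * (r * (1 + ln (INR q)) + INR q * r ^ m.+3) <= 1 / 20 ->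
  1 / 20 <= Cmod (\csum_(1 <= y < q) (chi y * \big[Cmult/RtoC 1]_(i < m.+3) Z i y)).
Proof.
move=> Eq Hh r0 Hchi Hw HZ Hmain Herr.
set A := \csum_(1 <= y < q) (chi y * \big[Cmult/RtoC 1]_(i < m.+3) Z i y). set B := bigop _ _ _ in Hmain.
have q0 : (0 < q)%N by rewrite Eq.
have D : Cmod (B - A) <= INR m.+3 * 2 ^ m.+3 * (r * (1 + ln (INR q)) + INR q * r ^ m.+3).
{ rewrite /A /B -csum_minus. apply: Rle_trans (Cmod_csum _ _ _) _.
  apply: Rle_trans (_ : \rsum_(1 <= y < q) ((INR m.+3 * 2 ^ m.+3) * (r * / INR y + r ^ m.+3)) <= _).
  - rewrite !big_nat. apply: rsum_le => y Hy.
    have y0 : (0 < y)%N by case/andP: Hy.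
    have P := inv_sqrt_gt0 y0. set u := / sqrt (INR y) in P.
    have u1 : u <= 1.
    { rewrite /u -[X in _ <= X]Rinv_1. apply: Rinv_le_contravar; first lra. rewrite -sqrt_1. apply: sqrt_le_1_alt. rewrite -INR_1. exact: INR_leq. }
    have u2 : u ^ 2 = / INR y by rewrite /u pow_inv pow2_sqrt //; exact: pos_INR.
    have -> : (chi y * \big[Cmult/RtoC 1]_(i < m.+3) w i y - chi y * \big[Cmult/RtoC 1]_(i < m.+3) Z i y = - chi y * (\big[Cmult/RtoC 1]_(i < m.+3) Z i y - \big[Cmult/RtoC 1]_(i < m.+3) w i y))%C by ring.
    rewrite Cmod_mult Cmod_opp.
    have E1 := @cprod_diff_le m.+3 (fun i => Z i y) (fun i => w i y) u r (Rlt_le _ _ P) r0 (fun i => Hw i y Hy) (fun i => HZ i y Hy).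
    have E2 := pow_diff_le m.+2 (Rlt_le _ _ P) r0.
    have E3 := pow_sum_le m.+2 (Rlt_le _ _ P) r0.
    have Pm := pos_INR m.+3. have P2 : 0 < 2 ^ m.+2 by apply: pow_lt; lra.
    have Pr : 0 <= r ^ m.+2 by exact: pow_le.
    have E4 : u ^ m.+2 <= / INR y.
    { rewrite -u2. have -> : u ^ m.+2 = u ^ 2 * u ^ m by rewrite /=; ring.
      have : u ^ m <= 1 by rewrite -(pow1 m); apply: pow_incr; lra.
      have : 0 <= u ^ 2 by nra. nra. }
    apply: Rle_trans (_ : 1 * (INR m.+3 * r * (2 ^ m.+2 * (/ INR y + r ^ m.+2))) <= _).
    { apply: Rmult_le_compat => //; try exact: Cmod_ge_0. apply: Rle_trans E1 _. apply: Rle_trans E2 _.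
      apply: Rmult_le_compat_l; first nra. apply: Rle_trans E3 _. apply: Rmult_le_compat_l; lra. }
    have Py : 0 < / INR y by apply: Rinv_0_lt_compat; exact: INR_gt0.
    change (2 ^ m.+3) with (2 * 2 ^ m.+2). change (r ^ m.+3) with (r * r ^ m.+2).
    have X : 0 <= INR m.+3 * 2 ^ m.+2 * (r * / INR y + r * r ^ m.+2) by apply: Rmult_le_pos; nra.
    lra.
  - have c0 : 0 <= INR m.+3 * 2 ^ m.+3 by apply: Rmult_le_pos; [exact: pos_INR|apply: pow_le; lra].
    rewrite -big_distrr. apply: Rmult_le_compat_l => //.
    rewrite big_split -big_distrr. apply: Rplus_le_compat.
    + apply: Rmult_le_compat_l => //. exact: harmonic_lt_bound.
    + rewrite rsum_nat_const // subn1. apply: Rmult_le_compat_r; first exact: pow_le. apply: INR_leq. exact: leq_pred. }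
have E : B = ((B - A) + A)%C by ring.
have := Cmod_triangle (B - A) A. rewrite -E. lra.
Qed.

(** * Both moments for a given family of characters *)

Section MomentInequality.
Variables (q g m L j0 : nat).
Hypothesis pr_q : prime q.
Hypothesis gq : coprime g q.
Hypothesis gP : forall a, coprime a q -> exists k, (k < q.-1)%N /\ g ^ k = a %[mod q].
Variables (l : 'I_m.+3 -> nat) (psi : 'I_m.+3 -> nat -> C).
Hypothesis Hpsi : forall i, is_primitive_char (l i) (psi i).
Hypothesis lL : forall i, (l i <= L)%N.
Hypothesis Lq : (L < q * q)%N.
Hypothesis q100 : (100 < q)%N.

Let q0 : (0 < q)%N. Proof. exact: prime_gt0. Qed.
Notation n := q.-1.
Let n0 : (0 < n)%N. Proof. by rewrite -ltnS prednK // prime_gt1. Qed.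
Notation X := (qchar q g).
Let l0 i : (0 < l i)%N. Proof. exact: char_Q_gt0 (proj1 (Hpsi i)). Qed.
Let L0 : (0 < L)%N. Proof. exact: leq_trans (l0 ord0) (lL ord0). Qed.
Let Hql i : ~~ (q * q %| l i)%N.
Proof. apply/negP => /dvdn_leq H. have := leq_trans (H (l0 i)) (lL i). by rewrite leqNgt Lq. Qed.

Definition Lfam (i : 'I_m.+3) (j : nat) : C := Lhalf q g (l i) (psi i) j.
(** This and the next three are the earlier bounds made uniform in [i], through [l i <= L] and
    [tcond q (l i) <= q * L]; the 25 here is the 5 of [rho0] times the 5 of [Lclass_approx]. *)
Definition rhoL : R := 25 * / sqrt (INR q) * sqrt (sqrt (INR L)) * (1 + ln (INR L)).
Definition logqL : R := 1 + ln (INR (q * L)).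
Definition supL : R := 25 * sqrt (INR (q * L)) * logqL ^ 2.
Definition msqL : R := 56 * logqL ^ 4 * (INR q + sqrt (INR (q * L))).

Let ln_nat_ge0 k : (0 < k)%N -> 0 <= ln (INR k).
Proof. by move=> k0; apply: ln_ge0; rewrite -INR_1; exact: INR_leq. Qed.

Let ln_nat_le j k : (0 < j)%N -> (j <= k)%N -> ln (INR j) <= ln (INR k).
Proof. by move=> j0' jk; apply: ln_le; [exact: INR_gt0|exact: INR_leq]. Qed.

Lemma rho0_le i : 5 * rho0 q (l i) <= rhoL.
Proof.
rewrite /rho0 /rhoL.
have A := ln_nat_ge0 (l0 i). have B := ln_nat_le (l0 i) (lL i). have P := inv_sqrt_gt0 q0.
have S : sqrt (sqrt (INR (l i))) <= sqrt (sqrt (INR L)) by do 2 apply: sqrt_le_1_alt; exact: INR_leq.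
have S0 := sqrt_pos (sqrt (INR (l i))).
have : sqrt (sqrt (INR (l i))) * (1 + ln (INR (l i))) <= sqrt (sqrt (INR L)) * (1 + ln (INR L)) by apply: Rmult_le_compat; lra.
nra.
Qed.

Let tcond_le i : (tcond q (l i) <= q * L)%N.
Proof.
apply: leq_trans (_ : q * l i <= _)%N; last by rewrite leq_mul2l lL orbT.
apply: dvdn_leq; first by rewrite muln_gt0 q0 l0. by rewrite /tcond dvdn_lcm dvdn_mull ?dvdn_mulr.
Qed.

Let tcond_gt0 i : (0 < tcond q (l i))%N.
Proof. apply: ltnW. exact: (tcond_gt1 pr_q (Hpsi i)). Qed.

Let logQ_le i : 1 <= logQ q (l i) <= logqL.
Proof.
split; first exact: (logQ_ge1 pr_q (Hpsi i)).
rewrite /logQ /logqL. have := ln_nat_le (tcond_gt0 i) (tcond_le i). lra.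
Qed.

Lemma Lfam_sup i j : Cmod (Lfam i j) ^ 2 <= supL.
Proof.
have B := Lhalf_bound g pr_q (Hpsi i) j. have [L1 L2] := logQ_le i.
have S0 := sqrt_pos (INR (tcond q (l i))).
have S : sqrt (INR (tcond q (l i))) <= sqrt (INR (q * L)) by apply: sqrt_le_1_alt; exact: INR_leq.
apply: Rle_trans (_ : (5 * sqrt (sqrt (INR (tcond q (l i)))) * logQ q (l i)) ^ 2 <= _).
{ apply: sqr_le; first exact: Cmod_ge_0. exact: B. }
have -> : (5 * sqrt (sqrt (INR (tcond q (l i)))) * logQ q (l i)) ^ 2 = 25 * (sqrt (sqrt (INR (tcond q (l i)))) * sqrt (sqrt (INR (tcond q (l i))))) * logQ q (l i) ^ 2 by ring.
rewrite sqrt_sqrt // /supL. apply: Rmult_le_compat; [lra|nra|lra|]. apply: sqr_le; lra.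
Qed.

Lemma Lfam_msq i : \rsum_(j < n) (Cmod (Lfam i j) ^ 2) <= msqL.
Proof.
apply: Rle_trans (L_mean_square pr_q gq gP (Hpsi i)) _. have [L1 L2] := logQ_le i.
have S : sqrt (INR (tcond q (l i))) <= sqrt (INR (q * L)) by apply: sqrt_le_1_alt; exact: INR_leq.
have S0 := sqrt_pos (INR (tcond q (l i))). have Pq := pos_INR q.
have P4 : logQ q (l i) ^ 4 <= logqL ^ 4 by apply: pow_incr; lra.
have P0 : 0 <= logQ q (l i) ^ 4 by apply: pow_le; lra.
rewrite /msqL. apply: Rmult_le_compat; lra.
Qed.

Let a (y : nat) : C := (X j0 y * \big[Cmult/RtoC 1]_(i < m.+3) (psi i y * RtoC (/ sqrt (INR y))))%C.

Lemma moment_main : 1 / 10 <= Cmod (\csum_(1 <= y < q) a y).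
Proof.
have [h Eh] : exists h, q = (2 * h).+1.
{ exists q./2. have := even_prime pr_q. case=> [E|O]; first by have := q100; rewrite E. rewrite mul2n -{1}(odd_double_half q) O. by []. }
rewrite Eh. apply: main_term_lower.
- lia.
- move=> y. rewrite /a (char_mul (qchar_dirichlet pr_q gq gP j0)).
  have -> : \big[Cmult/RtoC 1]_(i < m.+3) (psi i (2 * y)%N * RtoC (/ sqrt (INR (2 * y))))%C = ((\big[Cmult/RtoC 1]_(i < m.+3) (psi i 2%N * RtoC (/ sqrt (INR 2)))) * (\big[Cmult/RtoC 1]_(i < m.+3) (psi i y * RtoC (/ sqrt (INR y)))))%C.
  { rewrite -big_split /=. apply: eq_bigr => i _. rewrite (char_mul (proj1 (Hpsi i))) INR_muln sqrt_mult; try exact: pos_INR.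
    rewrite Rinv_mult RtoC_mult. ring. }
  ring.
- rewrite /a (char1 (qchar_dirichlet pr_q gq gP j0)) big1 ?Cmult_1_l // => i _.
  by rewrite (char1 (proj1 (Hpsi i))) INR_1 sqrt_1 Rinv_1 Cmult_1_l.
- move=> y y0. rewrite /a Cmod_mult Cmod_cprod.
  have P := inv_sqrt_gt0 y0. set u := / sqrt (INR y) in P *.
  have u1 : u <= 1.
  { rewrite /u -[X in _ <= X]Rinv_1. apply: Rinv_le_contravar; first lra. rewrite -sqrt_1. apply: sqrt_le_1_alt. rewrite -INR_1. exact: INR_leq. }
  have u2 : / INR y = u * u by rewrite /u -Rinv_mult sqrt_sqrt //; exact: pos_INR.
  have A1 := char_norm_le1 (qchar_dirichlet pr_q gq gP j0) y.
  have A2 : \big[Rmult/1]_(i < m.+3) Cmod (psi i y * RtoC u) <= u ^ m.+3.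
  { rewrite -rprod_const. apply: rprod_le => i _. split; first exact: Cmod_ge_0.
    rewrite Cmod_mult Cmod_R Rabs_pos_eq; last lra. have := char_norm_le1 (proj1 (Hpsi i)) y. nra. }
  have A3 : u ^ m.+3 <= u * (u * u).
  { have -> : u ^ m.+3 = (u * (u * u)) * u ^ m by rewrite /=; ring.
    have : u ^ m <= 1 by rewrite -(pow1 m); apply: pow_incr; lra.
    have : 0 <= u * (u * u) by nra. nra. }
  rewrite u2. apply: Rle_trans (_ : 1 * (u * (u * u)) <= _); last lra.
  apply: Rmult_le_compat => //; [exact: Cmod_ge_0|apply: rprod_ge0 => i _; exact: Cmod_ge_0|exact: (Rle_trans _ _ _ A2 A3)].
Qed.

Hypothesis Hsmall : INR m.+3 * 2 ^ m.+3 * (rhoL * (1 + ln (INR q)) + INR q * rhoL ^ m.+3) <= 1 / 20.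

Lemma rhoL_ge0 : 0 <= rhoL.
Proof.
have := inv_sqrt_gt0 q0. have := ln_nat_ge0 L0. have := sqrt_pos (sqrt (INR L)). move=> A B D.
rewrite /rhoL. apply: Rmult_le_pos; [apply: Rmult_le_pos|]; lra.
Qed.

Lemma moment_lower :
  INR n ^ m.+2 / 20 <= Cmod (\csum_(t : {ffun 'I_m.+3 -> 'I_n} | tcompat j0 t) \big[Cmult/RtoC 1]_(i < m.+3) Lfam i (t i : nat)).
Proof.
have Pn := INR_gt0 n0.
set M1 := bigop _ _ _.
pose Z (i : 'I_m.+3) y := Lclass q g (l i) (psi i) y.
have E : (RtoC (INR n) * M1 = RtoC (INR n ^ m.+3) * \csum_(1 <= y < q) (X j0 y * \big[Cmult/RtoC 1]_(i < m.+3) Z i y))%C.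
{ rewrite /M1 -(tuple_moment n0 j0 (fun i j => Lfam i j)) (big_units pr_q gP).
  - rewrite big_distrr. apply: eq_bigr => k _.
    have -> : \big[Cmult/RtoC 1]_(i < m.+3) (\csum_(j < n) (Lfam i j * Cconj (er n (j * k))))%R = (RtoC (INR n ^ m.+3) * \big[Cmult/RtoC 1]_(i < m.+3) Z i (g ^ k)%N)%C.
    { have -> : RtoC (INR n ^ m.+3) = \big[Cmult/RtoC 1]_(i < m.+3) RtoC (INR n).
      { elim: (m.+3) => [|p IH]; first by rewrite big_ord0. rewrite big_ord_recr -IH /= RtoC_mult. exact: Cmult_comm. }
      rewrite -big_split /=. apply: eq_bigr => i _. rewrite /Z /Lclass.
      rewrite Cmult_assoc -RtoC_mult Rinv_r; last lra. rewrite Cmult_1_l. apply: eq_bigr => j _.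
      by rewrite (qchar_gexp pr_q gq gP). }
    rewrite (qchar_gexp pr_q gq gP).
    have swap : forall x y z : C, (x * (y * z) = y * (x * z))%C by move=> x y z; ring.
    exact: swap.
  - move=> y y' Ey. rewrite (qchar_eqmod g j0 Ey). congr Cmult. apply: eq_bigr => i _. rewrite /Z /Lclass. congr Cmult.
    apply: eq_bigr => j _. by rewrite (qchar_eqmod g j Ey). }
have [h Eh] : exists h, q = (2 * h).+1.
{ exists q./2. have := even_prime pr_q. case=> [E2|O]; first by have := q100; rewrite E2. rewrite mul2n -{1}(odd_double_half q) O. by []. }
have Hh : (50 <= h)%N by lia.
have low := @perturbed_moment_lower q m h (X j0) Z (fun i y => psi i y * RtoC (/ sqrt (INR y)))%C rhoL Eh Hh rhoL_ge0 (char_norm_le1 (qchar_dirichlet pr_q gq gP j0)).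
have {}low : 1 / 20 <= Cmod (\csum_(1 <= y < q) (X j0 y * \big[Cmult/RtoC 1]_(i < m.+3) Z i y)).
{ apply: low => //.
  - move=> i y /andP[y0 _]. have P := inv_sqrt_gt0 y0. rewrite Cmod_mult Cmod_R Rabs_pos_eq; last lra.
    have := char_norm_le1 (proj1 (Hpsi i)) y. nra.
  - move=> i y Hy. apply: Rle_trans (Lclass_approx pr_q gq gP (Hpsi i) (Hql i) Hy) (rho0_le i).
  - exact: moment_main. }
have E2 : INR n * Cmod M1 = INR n ^ m.+3 * Cmod (\csum_(1 <= y < q) (X j0 y * \big[Cmult/RtoC 1]_(i < m.+3) Z i y)).
{ have := congr1 Cmod E. rewrite !Cmod_mult !Cmod_R !Rabs_pos_eq //; [apply: pow_le; lra|lra]. }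
set T := Cmod (bigop _ _ _) in low E2.
apply: (Rmult_le_reg_l (INR n)) => //. rewrite E2.
change (INR n ^ m.+3) with (INR n * INR n ^ m.+2).
have P2 : 0 < INR n ^ m.+2 by exact: pow_lt.
have : INR n ^ m.+2 / 20 <= INR n ^ m.+2 * T by nra. nra.
Qed.

Lemma moment_inequality :
  (INR n ^ m.+2 / 20) ^ 2 <= INR #|nonvanishing n j0 Lfam| * (supL * msqL ^ m.+2).
Proof.
have Pn : 0 <= INR n ^ m.+2 by apply: pow_le; exact: pos_INR.
apply: Rle_trans (_ : _ <= Cmod (\csum_(t : {ffun 'I_m.+3 -> 'I_n} | tcompat j0 t) \big[Cmult/RtoC 1]_(i < m.+3) Lfam i (t i : nat)) ^ 2) _.
{ apply: sqr_le; [lra|exact: moment_lower]. }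
apply: nonvanishing_lower => //.
- move=> j. exact: Lfam_sup.
- apply: Rle_trans (pow2_ge_0 (Cmod (Lfam ord0 0%N))) (Lfam_sup _ _).
- exact: Lfam_msq.
Qed.

End MomentInequality.

(** * Comparison of exponents, with [x = ln q] and [lam = ln L] *)

Lemma exp_pow t k : exp t ^ k = exp (INR k * t).
Proof.
elim: k => [|k IH]; first by rewrite INR_0 Rmult_0_l exp_0.
rewrite S_INR /= IH -exp_plus. congr exp. ring.
Qed.

Lemma sqrt_exp t : sqrt (exp t) = exp (t / 2).
Proof.
have E : exp t = exp (t / 2) * exp (t / 2) by rewrite -exp_plus; congr exp; field.
rewrite E sqrt_square //. by apply: Rlt_le; exact: exp_pos.
Qed.

Lemma exp_neg_small K eta s c : 0 < K -> 0 < eta -> 0 < s -> s * Rabs (ln (K / eta)) <= c -> K * exp (- c / s) <= eta.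
Proof.
move=> K0 e0 s0 Hc.
have P : 0 < K / eta by exact: Rdiv_lt_0_compat.
have H : ln (K / eta) <= c / s.
{ apply/Rle_div_r => //. have := Rle_abs (ln (K / eta)). nra. }
have := exp_le _ _ H. rewrite exp_ln // => H2.
have -> : - c / s = - (c / s) by field; lra.
rewrite exp_Ropp. apply/Rle_div_l; first exact: exp_pos.
have : eta * (K / eta) = K by field; lra. nra.
Qed.

(** The device by which a logarithm is traded for an arbitrarily small power. *)
Lemma one_plus_le_exp t s : 0 < s -> s <= 1 -> 0 <= t -> 1 + t <= exp (s * t) / s.
Proof. move=> s0 s1 t0. apply/Rle_div_r => //. have := exp_ineq1_le (s * t). nra. Qed.

Section Asymptotics.
Variables (m : nat) (eps : R).
Hypothesis eps0 : 0 < eps.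
Notation mu := (INR m.+3).
Notation kappa := (mu / (2 * mu - 4) + eps).

Let mu3 : 3 <= mu.
Proof. have -> : mu = INR m + 3 by rewrite -addn3 INR_addn; congr (_ + _); rewrite INR_IZR_INZ. have := pos_INR m. lra. Qed.

Lemma size_constraint x lam : 0 <= lam -> 10 + kappa * lam <= x ->
  mu * lam <= (2 * mu - 4) * x /\ lam <= 2 * x.
Proof.
move=> l0 H.
have H1 : mu / (2 * mu - 4) * lam <= x by nra.
have E : mu * lam = (2 * mu - 4) * (mu / (2 * mu - 4) * lam) by field; lra.
have A : mu * lam <= (2 * mu - 4) * x by rewrite E; apply: Rmult_le_compat_l; lra.
split=> //. have : 0 <= x by nra. nra.
Qed.

Lemma small_error : exists c0, 10 <= c0 /\ forall x lam, 0 <= lam -> c0 + kappa * lam <= x ->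
  mu * 2 ^ m.+3 * ((25 * exp (- x / 2 + lam / 4) * (1 + lam)) * (1 + x) +
     exp x * (25 * exp (- x / 2 + lam / 4) * (1 + lam)) ^ m.+3) <= 1 / 20.
Proof.
have P2 : 0 < 2 ^ m.+3 by apply: pow_lt; lra.
pose eta := / (40 * (mu * 2 ^ m.+3)).
have eta0 : 0 < eta by apply: Rinv_0_lt_compat; nra.
(* The [eps] in the hypothesis on [q] leaves a gain of [eps * (mu - 2) / 2 * lam] in the exponent of
   the second error; [del] makes the absorption of [(1 + lam) ^ mu] spend no more than that. *)
pose del := Rmin 1 (eps * (mu - 2) / (2 * mu)).
have del0 : 0 < del by apply: Rmin_pos; [lra|apply: Rdiv_lt_0_compat; nra].
have del1 : del <= 1 by exact: Rmin_l.
have del2 : mu * del <= eps * (mu - 2) / 2.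
{ have := Rmin_r 1 (eps * (mu - 2) / (2 * mu)). rewrite -/del => H.
  have -> : eps * (mu - 2) / 2 = mu * (eps * (mu - 2) / (2 * mu)) by field; lra. apply: Rmult_le_compat_l; lra. }
pose K1 := (25 / del) ^ m.+3.
have K10 : 0 < K1 by apply: pow_lt; apply: Rdiv_lt_0_compat; lra.
pose K2 := 1600 * mu ^ 2.
have K20 : 0 < K2 by rewrite /K2; nra.
(* Large enough that [K1 * exp (- c0 / 2)] and [K2 * exp (- c0 / (2 * mu))] are both at most [eta];
   the two errors then add up to 1/20. *)
pose c0 := 10 + 2 * Rabs (ln (K1 / eta)) + 2 * mu * Rabs (ln (K2 / eta)).
have R1 := Rabs_pos (ln (K1 / eta)). have R2 := Rabs_pos (ln (K2 / eta)).
have R2' : 0 <= 2 * mu * Rabs (ln (K2 / eta)) by apply: Rmult_le_pos; lra.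
exists c0; split; first by rewrite /c0; lra.
move=> x lam l0 Hx.
have kl : 0 <= kappa * lam by apply: Rmult_le_pos => //; apply: Rplus_le_le_0_compat; [apply: Rdiv_le_0_compat|]; lra.
have c10 : 10 <= c0 by rewrite /c0; lra.
have [S1 S2] := size_constraint l0 (Rle_trans _ _ _ (Rplus_le_compat_r _ _ _ c10) Hx).
have x10 : c0 <= x by lra.
set r := 25 * exp (- x / 2 + lam / 4) * (1 + lam).
have A1 : exp x * r ^ m.+3 <= eta.
{ apply: Rle_trans (_ : K1 * exp (- c0 / 2) <= _); last by apply: exp_neg_small => //; [lra|rewrite /c0; lra].
  have rb : r <= (25 / del) * exp (- x / 2 + lam / 4 + del * lam).
  { have := one_plus_le_exp del0 del1 l0. move=> H. have Pe := exp_pos (- x / 2 + lam / 4).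
    have -> : 25 / del * exp (- x / 2 + lam / 4 + del * lam) = 25 * exp (- x / 2 + lam / 4) * (exp (del * lam) / del) by rewrite exp_plus; field; lra.
    rewrite /r. apply: Rmult_le_compat_l => //. lra. }
  have r0 : 0 <= r by rewrite /r; have := exp_pos (- x / 2 + lam / 4) => Pe; apply: Rmult_le_pos; lra.
  have := pow_incr _ _ m.+3 (conj r0 rb). rewrite Rpow_mult_distr exp_pow -/K1 => H.
  apply: Rle_trans (Rmult_le_compat_l _ _ _ (Rlt_le _ _ (exp_pos x)) H) _.
  have -> : exp x * (K1 * exp (mu * (- x / 2 + lam / 4 + del * lam))) = K1 * exp (x + mu * (- x / 2 + lam / 4 + del * lam)) by rewrite exp_plus; ring.
  apply: Rmult_le_compat_l; first lra. apply: exp_le.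
  have E : kappa * lam * (mu - 2) = mu * lam / 2 + eps * (mu - 2) * lam by field; lra.
  have X1 : (mu - 2) * (c0 + kappa * lam) <= (mu - 2) * x by apply: Rmult_le_compat_l; lra.
  have X2 : mu * del * lam <= eps * (mu - 2) / 2 * lam by apply: Rmult_le_compat_r.
  have X3 : c0 <= (mu - 2) * c0 by nra.
  have -> : x + mu * (- x / 2 + lam / 4 + del * lam) = - ((mu - 2) * x) / 2 + mu * lam / 4 + mu * del * lam by field.
  have X4 : (mu - 2) * (c0 + kappa * lam) = (mu - 2) * c0 + (mu * lam / 2 + eps * (mu - 2) * lam) by rewrite -E; ring.
  rewrite X4 in X1. lra. }
have A2 : r * (1 + x) <= eta.
{ apply: Rle_trans (_ : K2 * exp (- c0 / (2 * mu)) <= _); last by apply: exp_neg_small => //; [lra|rewrite /c0; lra].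
  (* This is [mu * lam <= (2 * mu - 4) * x] divided by [4 * mu]; half of the gain [x / mu] then pays
     for the logarithms. *)
  have Ex : - x / 2 + lam / 4 <= - (x / mu).
  { apply: (Rmult_le_reg_l (4 * mu)); first lra.
    have -> : 4 * mu * - (x / mu) = - 4 * x by field; lra. lra. }
  have X1 : (1 + lam) * (1 + x) <= (1 + 2 * x) * (1 + 2 * x) by apply: Rmult_le_compat; lra.
  have X2 : 1 + 2 * x <= 8 * mu * exp (x / (4 * mu)).
  { have := exp_ineq1_le (x / (4 * mu)). have : 8 * mu * (x / (4 * mu)) = 2 * x by field; lra. nra. }
  have X3 : (1 + 2 * x) * (1 + 2 * x) <= 64 * mu ^ 2 * exp (x / (2 * mu)).
  { have -> : 64 * mu ^ 2 * exp (x / (2 * mu)) = (8 * mu * exp (x / (4 * mu))) * (8 * mu * exp (x / (4 * mu))).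
    { have -> : exp (x / (2 * mu)) = exp (x / (4 * mu)) * exp (x / (4 * mu)) by rewrite -exp_plus; congr exp; field; lra. ring. }
    apply: Rmult_le_compat; lra. }
  have X4 : exp (- x / 2 + lam / 4) <= exp (- (x / mu)) by exact: exp_le.
  have -> : r * (1 + x) = 25 * (exp (- x / 2 + lam / 4) * ((1 + lam) * (1 + x))) by rewrite /r; ring.
  apply: Rle_trans (_ : 25 * (exp (- (x / mu)) * (64 * mu ^ 2 * exp (x / (2 * mu)))) <= _).
  { apply: Rmult_le_compat_l; first lra. apply: Rmult_le_compat => //; [by apply: Rlt_le; exact: exp_pos|apply: Rmult_le_pos; lra|lra]. }
  have -> : 25 * (exp (- (x / mu)) * (64 * mu ^ 2 * exp (x / (2 * mu)))) = K2 * exp (- x / (2 * mu)).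
  { have -> : - x / (2 * mu) = - (x / mu) + x / (2 * mu) by field; lra. rewrite exp_plus /K2. ring. }
  apply: Rmult_le_compat_l; first lra. apply: exp_le. rewrite /Rdiv. apply: Rmult_le_compat_r; last lra.
  apply: Rlt_le. apply: Rinv_0_lt_compat. lra. }
have E20 : 1 / 20 = mu * 2 ^ m.+3 * (eta + eta) by rewrite /eta; field; lra.
rewrite E20. apply: Rmult_le_compat_l; nra.
Qed.

(** Dividing the squared first moment by the second leaves the exponent [2 (mu - 1) x - (x + lam) /
    2 - (mu - 1) max(x, (x + lam) / 2)], with [eps * x] set aside for the logarithms. *)
Lemma count_lower_bound : exists c, 0 < c /\ forall x lam n N : R, 0 <= lam -> 10 + kappa * lam <= x ->
  exp x / 2 <= n -> 0 <= N ->
  (n ^ m.+2 / 20) ^ 2 <= N * ((25 * exp ((x + lam) / 2) * (1 + (x + lam)) ^ 2) *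
     (56 * (1 + (x + lam)) ^ 4 * (exp x + exp ((x + lam) / 2))) ^ m.+2) ->
  c * exp ((5 * mu / 6 - 1 - eps) * x) * exp (- mu / 6 * lam) <= N.
Proof.
(* The power of the logarithm in the second moment: 2 from the pointwise bound and 4 from each of
   the [m.+2] mean squares. *)
pose p := (2 + 4 * m.+2)%N.
have Pp : 0 < INR p by apply: INR_gt0.
pose del := Rmin 1 (eps / INR p).
have del0 : 0 < del by apply: Rmin_pos; [lra|exact: Rdiv_lt_0_compat].
have del1 : del <= 1 by exact: Rmin_l.
have del2 : INR p * del <= eps.
{ have H := Rmin_r 1 (eps / INR p). rewrite -/del in H.
  have -> : eps = INR p * (eps / INR p) by field; lra. apply: Rmult_le_compat_l; lra. }
pose K := 25 * 112 ^ m.+2 * (3 / del) ^ p.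
have K0 : 0 < K.
{ rewrite /K. apply: Rmult_lt_0_compat; last by apply: pow_lt; apply: Rdiv_lt_0_compat; lra.
  apply: Rmult_lt_0_compat; [lra|apply: pow_lt; lra]. }
pose D := (/ 2) ^ m.+2 / 20.
have D0 : 0 < D by apply: Rdiv_lt_0_compat; [apply: pow_lt; lra|lra].
exists (D ^ 2 / K); split; first by apply: Rdiv_lt_0_compat => //; exact: pow_lt.
move=> x lam n N l0 Hx Hn N0 HN.
have [S1 S2] := size_constraint l0 Hx.
have kl : 0 <= kappa * lam by apply: Rmult_le_pos => //; apply: Rplus_le_le_0_compat; [apply: Rdiv_le_0_compat|]; lra.
have x0 : 10 <= x by lra.
pose lg := 1 + (x + lam).
have lgb : lg <= (3 / del) * exp (del * x).
{ have := @one_plus_le_exp x del del0 del1 ltac:(lra).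
  have -> : 3 / del * exp (del * x) = 3 * (exp (del * x) / del) by field; lra. rewrite /lg. lra. }
have lg0 : 0 <= lg by rewrite /lg; lra.
have lgp : lg ^ p <= (3 / del) ^ p * exp (eps * x).
{ have := pow_incr _ _ p (conj lg0 lgb). rewrite Rpow_mult_distr exp_pow => H. apply: Rle_trans H _.
  apply: Rmult_le_compat_l; first by apply: pow_le; apply: Rdiv_le_0_compat; lra.
  apply: exp_le. have -> : INR p * (del * x) = (INR p * del) * x by ring. apply: Rmult_le_compat_r; lra. }
pose w := Rmax x ((x + lam) / 2).
have wb : exp x + exp ((x + lam) / 2) <= 2 * exp w.
{ have := exp_le _ _ (Rmax_l x ((x + lam) / 2)). have := exp_le _ _ (Rmax_r x ((x + lam) / 2)). rewrite -/w. lra. }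
have mun : INR m.+2 = mu - 1 by rewrite (S_INR m.+2); ring.
have up : (25 * exp ((x + lam) / 2) * lg ^ 2) * (56 * lg ^ 4 * (exp x + exp ((x + lam) / 2))) ^ m.+2 <=
   K * exp ((x + lam) / 2 + eps * x + (mu - 1) * w).
{ apply: Rle_trans (_ : (25 * exp ((x + lam) / 2) * lg ^ 2) * (56 * lg ^ 4 * (2 * exp w)) ^ m.+2 <= _).
  { apply: Rmult_le_compat_l.
    - apply: Rmult_le_pos; [have := exp_pos ((x + lam) / 2); lra|exact: pow_le].
    - apply: pow_incr. have P4 : 0 <= lg ^ 4 by exact: pow_le. have := exp_pos x. have := exp_pos ((x + lam) / 2).
      move=> ? ?. split; first by apply: Rmult_le_pos; lra. apply: Rmult_le_compat_l; lra. }
  have -> : 56 * lg ^ 4 * (2 * exp w) = 112 * lg ^ 4 * exp w by ring.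
  have dist : forall u v t : R, (u * v * t) ^ m.+2 = u ^ m.+2 * v ^ m.+2 * t ^ m.+2 by move=> u v t; rewrite !Rpow_mult_distr.
  rewrite dist exp_pow mun -pow_mult.
  have -> : 25 * exp ((x + lam) / 2) * lg ^ 2 * (112 ^ m.+2 * lg ^ (4 * m.+2)%coq_nat * exp ((mu - 1) * w)) =
      25 * 112 ^ m.+2 * (lg ^ 2 * lg ^ (4 * m.+2)%coq_nat) * (exp ((x + lam) / 2) * exp ((mu - 1) * w)) by ring.
  rewrite -pow_add.
  have -> : exp ((x + lam) / 2 + eps * x + (mu - 1) * w) = exp (eps * x) * (exp ((x + lam) / 2) * exp ((mu - 1) * w)) by rewrite !exp_plus; ring.
  rewrite /K. have P : 0 < exp ((x + lam) / 2) * exp ((mu - 1) * w) by apply: Rmult_lt_0_compat; exact: exp_pos.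
  have P25 : 0 <= 25 * 112 ^ m.+2 by apply: Rmult_le_pos; [lra|apply: pow_le; lra].
  apply: Rle_trans (Rmult_le_compat_r _ _ _ (Rlt_le _ _ P) (Rmult_le_compat_l _ _ _ P25 lgp)) _. apply: Req_le.
  have asc : forall t u v z : R, t * (u * v) * z = t * u * (v * z) by move=> t u v z; ring.
  exact: asc. }
have lo : D ^ 2 * exp (2 * (mu - 1) * x) <= (n ^ m.+2 / 20) ^ 2.
{ have -> : D ^ 2 * exp (2 * (mu - 1) * x) = (D * exp ((mu - 1) * x)) ^ 2.
  { rewrite Rpow_mult_distr exp_pow. congr (_ * exp _). rewrite INR2. ring. }
  apply: sqr_le; first by apply: Rmult_le_pos; [lra|apply: Rlt_le; exact: exp_pos].
  rewrite /D. have -> : (/ 2) ^ m.+2 / 20 * exp ((mu - 1) * x) = (exp x / 2) ^ m.+2 / 20.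
  { rewrite /Rdiv Rpow_mult_distr exp_pow mun. ring. }
  rewrite /Rdiv. apply: Rmult_le_compat_r; first lra. apply: pow_incr. split=> //. have := exp_pos x. lra. }
have PK := exp_pos ((x + lam) / 2 + eps * x + (mu - 1) * w).
have fin : D ^ 2 * exp (2 * (mu - 1) * x) <= N * (K * exp ((x + lam) / 2 + eps * x + (mu - 1) * w)).
{ apply: Rle_trans lo _. apply: Rle_trans HN _. exact: Rmult_le_compat_l. }
(* For [lam >= x] this reduces to [mu * lam <= (2 * mu - 3) * x], which [size_constraint] supplies.
   For [lam < x] the difference is [(mu / 6 - 1 / 2) * (x + lam)], nonnegative because [mu >= 3]. *)
have expo : (5 * mu / 6 - 1 - eps) * x + - mu / 6 * lam <= 2 * (mu - 1) * x - ((x + lam) / 2 + eps * x + (mu - 1) * w).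
{ rewrite /w /Rmax. case: Rle_dec => H.
  - have -> : 2 * (mu - 1) * x - ((x + lam) / 2 + eps * x + (mu - 1) * ((x + lam) / 2)) = 2 * (mu - 1) * x - eps * x - (mu * x + mu * lam) / 2 by field.
    nra.
  - have : 0 <= (mu / 6 - 1 / 2) * (x + lam) by apply: Rmult_le_pos; lra. nra. }
rewrite Rmult_assoc -exp_plus.
apply: Rle_trans (_ : D ^ 2 / K * exp (2 * (mu - 1) * x - ((x + lam) / 2 + eps * x + (mu - 1) * w)) <= _).
{ apply: Rmult_le_compat_l; last exact: exp_le. apply: Rdiv_le_0_compat => //. exact: pow2_ge_0. }
rewrite /Rminus exp_plus exp_Ropp.
set E1 := exp _ in fin *. set E2 := exp _ in PK fin *.
apply: (Rmult_le_reg_r (K * E2)); first exact: Rmult_lt_0_compat.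
have -> : D ^ 2 / K * (E1 * / E2) * (K * E2) = D ^ 2 * E1 by field; lra.
exact: fin.
Qed.

End Asymptotics.

(** * From tuples of indices to tuples of characters *)

Lemma nmax_ge m l i : (i < m)%N -> (l i <= nmax m l)%N.
Proof.
elim: m => // m IH. rewrite ltnS leq_eqVlt => /orP[/eqP ->|/IH H] /=; [apply/leP; lia|].
apply: leq_trans H _. apply/leP. lia.
Qed.

Lemma cprod_big m f : cprod m f = \big[Cmult/RtoC 1]_(i < m) f i.
Proof. by elim: m => [|m IH] /=; rewrite ?big_ord0 // big_ord_recr /= IH. Qed.

Lemma exp10_gt : 100 < exp 10.
Proof.
have H := exp_ineq1_le (5 / 2). have E : exp 10 = exp (5 / 2) ^ 4 by rewrite exp_pow; congr exp; rewrite INR_IZR_INZ /=; field.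
rewrite E. have : (7 / 2) ^ 4 <= exp (5 / 2) ^ 4 by apply: pow_incr; lra. lra.
Qed.

Section Counting.
Variables (q g m j0 : nat).
Hypothesis pr_q : prime.prime q.
Hypothesis gq : coprime g q.
Hypothesis gP : forall a, coprime a q -> exists k, (k < q.-1)%N /\ g ^ k = a %[mod q].
Variables (l : nat -> nat) (psi : nat -> nat -> C).
Hypothesis Hpsi : forall i, (i < m.+1)%N -> is_primitive_char (l i) (psi i).
Notation n := q.-1.
Let n0 : (0 < n)%N. Proof. by rewrite -ltnS prednK ?prime_gt0 // prime_gt1. Qed.

Definition tuple_chars (t : {ffun 'I_m.+1 -> 'I_n}) (i : nat) : nat -> C :=
  if (i < m.+1)%N then qchar q g (t (inord i)) else (fun _ => RtoC 0).

Lemma tuple_charsE t (i : 'I_m.+1) : tuple_chars t i = qchar q g (t i).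
Proof. by rewrite /tuple_chars ltn_ord inord_val. Qed.

Lemma card_ge_nonvanishing chi :
  (forall a, chi a = qchar q g j0 a) ->
  card_ge m.+1
    (fun chis => Wide q m.+1 chi chis /\
       forall i, lt i m.+1 -> Lval (fun a => Cmult (psi i a) (chis i a)) (RtoC (/ 2)) <> RtoC 0)
    #|nonvanishing n j0 (fun i : 'I_m.+1 => Lhalf q g (l i) (psi i))|.
Proof.
move=> Hchi. set S := nonvanishing _ _ _.
pose t0 : {ffun 'I_m.+1 -> 'I_n} := [ffun => Ordinal n0].
pose tk k := nth t0 (enum S) k.
exists (fun k => tuple_chars (tk k)). split.
- move=> k /ltP Hk.
  have Ht : tk k \in S by rewrite -mem_enum; apply: mem_nth; rewrite -cardE.
  have [Hc Hn] := nonvanishingP Ht.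
  (* A nonzero [Lhalf] cannot be the default value, so the index is good and [Lhalf] is the genuine
     central value. *)
  have Hg : forall i : 'I_m.+1, good q g (l i) (psi i) (tk k i) /\ Lval (twist q g (psi i) (tk k i)) (RtoC (/ 2)) <> RtoC 0.
  { move=> i. have := Hn i. rewrite /Lhalf. by case: ifP. }
  split; [split|].
  + move=> i /ltP Hi. rewrite (tuple_charsE _ (Ordinal Hi)). apply: (qchar_primitive pr_q gq gP).
    have [G _] := Hg (Ordinal Hi). by rewrite (good_gt0 G) ltn_ord.
  + move=> a. rewrite cprod_big Hchi.
    transitivity (\big[Cmult/RtoC 1]_(i < m.+1) qchar q g (tk k i) a).
    { apply: eq_bigr => i _. by rewrite tuple_charsE. }
    rewrite /qchar. case: (coprime a q).
    * rewrite (er_sum (fun i => tk k i)) //. apply: (er_eq n0). by rewrite -modnMml (eqP Hc) modnMml.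
    * by rewrite big_ord_recr /=; exact: Cmult_0_r.
  + move=> i /ltP Hi. have [_ N] := Hg (Ordinal Hi). by rewrite (tuple_charsE _ (Ordinal Hi)).
- move=> k1 k2 /ltP H1 /ltP H2 E.
  have Et : tk k1 = tk k2.
  (* A character is recovered from its value at the primitive root [g]. *)
  { apply/ffunP => i. apply: val_inj. apply: (qchar_inj pr_q gq gP); rewrite ?ltn_ord //.
    have := E i (elimT ltP (ltn_ord i)). by rewrite !tuple_charsE => ->. }
  apply/eqP. rewrite -(nth_uniq t0 _ _ (enum_uniq S)) -?cardE //. by apply/eqP.
Qed.

End Counting.

Theorem wide_nonvanishing_count m eps : 0 < eps ->
  exists Cme cme : R, 0 < Cme /\ 0 < cme /\
  forall (l : nat -> nat) (psi : nat -> nat -> C),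
    (forall i, lt i m.+3 -> is_primitive_char (l i) (psi i)) ->
    forall q : nat, Znumtheory.prime (Z.of_nat q) ->
    Cme * Rpower (INR (nmax m.+3 l)) (INR m.+3 / (2 * INR m.+3 - 4) + eps) <= INR q ->
    forall chi : nat -> C, is_dirichlet_char q chi ->
    exists N : nat,
      cme * Rpower (INR q) (5 * INR m.+3 / 6 - 1 - eps)
          * Rpower (INR (nmax m.+3 l)) (- INR m.+3 / 6) <= INR N /\
      card_ge m.+3
        (fun chis => Wide q m.+3 chi chis /\
           forall i, lt i m.+3 ->
             Lval (fun n => Cmult (psi i n) (chis i n)) (RtoC (/ 2)) <> RtoC 0)
        N.
Proof.
move=> eps0.
have [c0 [Hc0 Hsmall]] := small_error m eps0.
have [c [Hc Hcount]] := count_lower_bound m eps0.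
(* With [exp c0] as the constant, the hypothesis on [q] becomes the linear inequality
   [c0 + kappa * lam <= x] between logarithms. *)
exists (exp c0), c; split; first exact: exp_pos. split=> // l psi Hpsi q /prime_Z_nat pr_q Hq chi Hchi.
set L := nmax m.+3 l in Hq *.
have Hpsi' : forall i : 'I_m.+3, is_primitive_char (l i) (psi i) by move=> i; apply: Hpsi; apply/ltP.
have lL : forall i : 'I_m.+3, (l i <= L)%N by move=> i; apply: nmax_ge.
have L0 : (0 < L)%N by apply: leq_trans (lL ord0); exact: (char_Q_gt0 (proj1 (Hpsi' ord0))).
have q0 : (0 < q)%N by exact: prime_gt0.
have PL := INR_gt0 L0. have Pq := INR_gt0 q0.
pose x := ln (INR q). pose lam := ln (INR L).
have Eq : INR q = exp x by rewrite exp_ln. have EL : INR L = exp lam by rewrite exp_ln.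
have lam0 : 0 <= lam by apply: ln_ge0; rewrite -INR_1; exact: INR_leq.
have Hx : c0 + (INR m.+3 / (2 * INR m.+3 - 4) + eps) * lam <= x.
{ move: Hq. rewrite /Rpower -/lam -exp_plus => Hq. have := ln_le _ _ (exp_pos _) Hq. by rewrite ln_exp. }
have Hx10 : 10 + (INR m.+3 / (2 * INR m.+3 - 4) + eps) * lam <= x by lra.
have [S1 S2] := size_constraint eps0 lam0 Hx10.
have mu3 : 3 <= INR m.+3 by have := @INR_leq 3 m.+3 isT; rewrite [INR 3]INR_IZR_INZ.
have x10 : 10 <= x.
{ have : 0 <= (INR m.+3 / (2 * INR m.+3 - 4) + eps) * lam by apply: Rmult_le_pos => //; apply: Rplus_le_le_0_compat; [apply: Rdiv_le_0_compat|]; lra. lra. }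
have q100 : (100 < q)%N.
{ rewrite ltnNge. apply/negP => H. have := INR_leq H. rewrite [INR 100]INR_IZR_INZ /=. have := exp_le _ _ x10. have := exp10_gt. rewrite -Eq. lra. }
(* From [mu * lam <= (2 * mu - 4) * x] with [x > 0] the inequality [lam < 2 * x] is strict. *)
have Lq : (L < q * q)%N.
{ rewrite ltnNge. apply/negP => H. have := INR_leq H. rewrite INR_muln EL Eq -exp_plus => H2.
  have := ln_le _ _ (exp_pos _) H2. rewrite !ln_exp. nra. }
have [g [gq gP]] := primitive_root pr_q.
have [j0 [_ Ej0]] := qchar_all pr_q gq gP Hchi.
exists #|nonvanishing q.-1 j0 (fun i : 'I_m.+3 => Lhalf q g (l i) (psi i))|; split; last exact: card_ge_nonvanishing.
rewrite /Rpower -/x -/lam.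
have rhoE : rhoL q L = 25 * exp (- x / 2 + lam / 4) * (1 + lam).
{ rewrite /rhoL Eq {1}EL !sqrt_exp -exp_Ropp -/lam. congr (_ * _).
  rewrite Rmult_assoc -exp_plus. congr (_ * exp _). field. }
have small : INR m.+3 * 2 ^ m.+3 * (rhoL q L * (1 + ln (INR q)) + INR q * rhoL q L ^ m.+3) <= 1 / 20.
{ rewrite rhoE -/x Eq. exact: Hsmall. }
have MI := moment_inequality j0 pr_q gq gP Hpsi' lL Lq q100 small.
apply: (Hcount x lam (INR q.-1) _ lam0 Hx10).
- rewrite -Eq. have -> : INR q = INR q.-1 + 1 by rewrite -S_INR prednK.
  have : 1 <= INR q.-1 by rewrite -INR_1; apply: INR_leq; lia. lra.
- exact: pos_INR.
- apply: Rle_trans MI _. apply: Req_le. congr (_ * _).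
  have EqL : INR (q * L) = exp (x + lam) by rewrite INR_muln Eq EL exp_plus.
  by rewrite /supL /msqL /logqL EqL ln_exp sqrt_exp Eq.
Qed.

End DirichletMoments.

Theorem theorem1p2 :
  forall m : nat, (3 <= m)%nat ->
  forall eps : R, 0 < eps ->
  exists Cme cme : R, 0 < Cme /\ 0 < cme /\
  forall (l : nat -> nat) (psi : nat -> nat -> C),
    (forall i, (i < m)%nat -> is_primitive_char (l i) (psi i)) ->
    forall q : nat, prime (Z.of_nat q) ->
    Cme * Rpower (INR (nmax m l)) (INR m / (2 * INR m - 4) + eps) <= INR q ->
    forall chi : nat -> C, is_dirichlet_char q chi ->
    exists N : nat,
      cme * Rpower (INR q) (5 * INR m / 6 - 1 - eps)
          * Rpower (INR (nmax m l)) (- INR m / 6) <= INR N /\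
      card_ge m
        (fun chis => Wide q m chi chis /\
           forall i, (i < m)%nat ->
             Lval (fun n => Cmult (psi i n) (chis i n)) (RtoC (/ 2)) <> RtoC 0)
        N.
Proof.
intros [|[|[|m]]] Hm eps Heps; try lia.
exact (@DirichletMoments.wide_nonvanishing_count m eps Heps).
Qed.
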